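(* Let $q>0$ be a constant with $q\neq1$. Let $\Omega\subset\mathbb{R}^2$ be an ellipse (the open region bounded by an ellipse) having one of its foci at the origin, and suppose its eccentricity $e$ satisfies $$\begin{cases}0<e^2<\dfrac34-\dfrac{1}{4\sqrt{q}} & \text{if } q>1 \text{ or } \tfrac14<q<1,\\[2mm] 0<e^2<q & \text{if } 0<q\le \tfrac14.\end{cases}$$ Let $\phi$ be a $C^1$ function on $\mathbb{S}^1$ which is not identically zero. Then there are at most finitely many wave numbers $k>0$ such that $\Omega$ is non-scattering in the presence of the incident wave $v=\mathbf{H}[k,\phi]$.
   Context: We identify $\mathbb{S}^1$ with $[0,2\pi)$ (and with $\mathbb{R}/(2\pi\mathbb{Z})$) via $\theta\mapsto(\cos\theta,\sin\theta)^T$; for $\xi\in\mathbb{S}^1$, $\theta_\xi$ denotes its angular coordinate. For $k>0$ and $\phi\in L^2(\mathbb{S}^1)$ the Herglotz wave is $\mathbf{H}[k,\phi](x)=\int_{-\pi}^{\pi}\phi(\xi)e^{\mathrm{i}k\xi\cdot x}\,d\theta_\xi$, $x\in\mathbb{R}^2$. For a bounded domain $\Omega$ with index of refraction the constant $q$, $\Omega$ is called non-scattering in the presence of the incident wave $\mathbf{H}[k,\phi]$ (at wave number $k$) if there exists $u\in H^1(\Omega)$ with $\Delta u+k^2qu=0$ in $\Omega$ and $u=\mathbf{H}[k,\phi]$, $\partial_\nu u=\partial_\nu\mathbf{H}[k,\phi]$ on $\partial\Omega$ ($\nu$ the outward unit normal). The eccentricity of an ellipse with semi-major axis $a$ and semi-minor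 axis $b$ is $\sqrt{1-b^2/a^2}$. *)

(* Defs.v *)
From HB Require Import structures.
From mathcomp Require Import all_boot all_order all_algebra.
From mathcomp Require Import all_classical all_reals all_analysis.
Import Order.TTheory GRing.Theory Num.Theory numFieldNormedType.Exports.

Set Implicit Arguments.
Unset Strict Implicit.
Unset Printing Implicit Defensive.

Local Open Scope classical_set_scope.
Local Open Scope ring_scope.

Section Defs.
Context {R : realType}.

Definition leb2 := ((@lebesgue_measure R) \x (@lebesgue_measure R))%E.

Definition d1 (f : R * R -> R) (x : R * R) : R := 'D_((1:R), (0:R)) f x.
Definition d2 (f : R * R -> R) (x : R * R) : R := 'D_((0:R), (1:R)) f x.

Definition C1c (U : set (R * R)) (psi : R * R -> R) : Prop :=
  [/\ (forall x, differentiable psi x), continuous (d1 psi), continuous (d2 psi)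
    & exists K : set (R * R), [/\ compact K, K `<=` U & forall x, ~ K x -> psi x = 0]].

Definition L2 (D : set (R * R)) (f : R * R -> R) : Prop :=
  measurable_fun D f /\ leb2.-integrable D (fun x => (f x ^+ 2)%:E).

Definition weak_grad (D : set (R * R)) (u g1 g2 : R * R -> R) : Prop :=
  forall psi, C1c D psi ->
    (\int[leb2]_(x in D) (u x * d1 psi x)%:E = - \int[leb2]_(x in D) (g1 x * psi x)%:E)%E /\
    (\int[leb2]_(x in D) (u x * d2 psi x)%:E = - \int[leb2]_(x in D) (g2 x * psi x)%:E)%E.

Definition H1 (D : set (R * R)) (u g1 g2 : R * R -> R) : Prop :=
  [/\ L2 D u, L2 D g1, L2 D g2 & weak_grad D u g1 g2].

Definition H1_0 (D : set (R * R)) (w g1 g2 : R * R -> R) : Prop :=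
  H1 D w g1 g2 /\
  exists psi : nat -> R * R -> R, (forall n, C1c D (psi n)) /\
    (fun n => (\int[leb2]_(x in D)
        ((w x - psi n x) ^+ 2 + (g1 x - d1 (psi n) x) ^+ 2
          + (g2 x - d2 (psi n) x) ^+ 2)%:E)%E) @ \oo --> 0%E.

(** Real-valued version of the interior transmission (Cauchy data) problem:
    there is u in H^1(D) with  Delta u + k^2 q u = 0 in D (weakly),
    u = v on the boundary (u - v in H^1_0(D)) and
    d_nu u = d_nu v on the boundary, in the weak (Green's formula) sense:
    for every C^1 compactly supported psi on R^2,
      int_D grad u . grad psi - k^2 q u psi = int_D grad v . grad psi - k^2 v psi
    (the right-hand side equals int_{dD} d_nu v psi since Delta v + k^2 v = 0). *)
Definition nonscat_real (D : set (R * R)) (k q : R) (v : R * R -> R) : Prop :=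
  exists u g1 g2 : R * R -> R,
    [/\ H1 D u g1 g2,
        H1_0 D (fun x => u x - v x) (fun x => g1 x - d1 v x) (fun x => g2 x - d2 v x)
      & forall psi, C1c setT psi ->
          (\int[leb2]_(x in D)
              (g1 x * d1 psi x + g2 x * d2 psi x - k ^+ 2 * q * u x * psi x)%:E
           = \int[leb2]_(x in D)
              (d1 v x * d1 psi x + d2 v x * d2 psi x - k ^+ 2 * v x * psi x)%:E)%E].

(** Real and imaginary parts of the Herglotz wave H[k, phi], phi = phr + i phi_im,
    phi seen as a function of the angle theta in [-pi, pi]. *)
Definition herglotz_re (k : R) (phr phim : R -> R) (x : R * R) : R :=
  Rintegral (@lebesgue_measure R) `[- pi, pi]
    (fun t => phr t * cos (k * (x.1 * cos t + x.2 * sin t))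
              - phim t * sin (k * (x.1 * cos t + x.2 * sin t))).
Definition herglotz_im (k : R) (phr phim : R -> R) (x : R * R) : R :=
  Rintegral (@lebesgue_measure R) `[- pi, pi]
    (fun t => phr t * sin (k * (x.1 * cos t + x.2 * sin t))
              + phim t * cos (k * (x.1 * cos t + x.2 * sin t))).

(** D is non-scattering for H[k, phi] with constant index q.  Since the
    equation has real coefficients, a complex solution u = u_re + i u_im
    exists iff both real problems (real and imaginary parts) are solvable. *)
Definition non_scattering (D : set (R * R)) (q k : R) (phr phim : R -> R) : Prop :=
  nonscat_real D k q (herglotz_re k phr phim) /\
  nonscat_real D k q (herglotz_im k phr phim).

Definition ellipse_region (a b : R) (c : R * R) (th : R) : set (R * R) :=
  [set x | ((x.1 - c.1) * cos th + (x.2 - c.2) * sin th) ^+ 2 / a ^+ 2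
           + (- (x.1 - c.1) * sin th + (x.2 - c.2) * cos th) ^+ 2 / b ^+ 2 < 1].

(** the two foci of that ellipse (when b <= a) *)
Definition focus_plus (a b : R) (c : R * R) (th : R) : R * R :=
  (c.1 + Num.sqrt (a ^+ 2 - b ^+ 2) * cos th, c.2 + Num.sqrt (a ^+ 2 - b ^+ 2) * sin th).
Definition focus_minus (a b : R) (c : R * R) (th : R) : R * R :=
  (c.1 - Num.sqrt (a ^+ 2 - b ^+ 2) * cos th, c.2 - Num.sqrt (a ^+ 2 - b ^+ 2) * sin th).

Definition eccentricity (a b : R) : R := Num.sqrt (1 - b ^+ 2 / a ^+ 2).

Definition C1_circle (f : R -> R) : Prop :=
  [/\ (forall t, f (t + 2 * pi) = f t), (forall t, derivable f t 1) & continuous (fun t => 'D_1 f t)].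

End Defs.

(* Main.v *)
Require Import Defs.
From HB Require Import structures.
From mathcomp Require Import all_boot all_order all_algebra.
From mathcomp Require Import all_classical all_reals all_analysis.
From mathcomp Require Import measurable_realfun ring lra.
Import Order.TTheory GRing.Theory Num.Theory numFieldNormedType.Exports.
Local Open Scope classical_set_scope.
Local Open Scope ring_scope.

(* Testing the two weak formulations against the plane waves [w] solving
   [Delta w + k^2 q w = 0] gives [int_Omega v w = 0].  On an ellipse the Fourier
   transform of the indicator is explicit, [J_1(r) / r] up to a phase, and when a focus
   is at the origin the phase simplifies by the focal property [|U| = 1 + e cos s].
   With [W] the image of the direction of [w], a bad [k] satisfies, for all [t],
     int fr(s) cos (k S) bes (k N) + fi(s) sin (k S) bes (k N) ds = 0,
   where [S = |U| + |W|] and [N = |U + W|], together with the same identity for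
   [(fi, - fr)].  For fixed [t] the left-hand side is entire in [k], so if infinitely many
   bad [k] were bounded, every [k] would be bad.  It thus suffices to exclude large [k].
   By the asymptotics of [bes], the integral is oscillatory with phases [S - N >= 0] and
   [S + N].  For suitable [t0], [S - N] vanishes to second order at a single [s0] with
   density nonzero at [s0], and [(S +- N)] has no other point where both its [s] and [t]
   derivatives vanish.  Averaging over [t] near [t0] makes all other contributions
   [O(1/k)], whereas the point [s0] contributes at least [c k^(-1/2)] after choosing the
   linear combination of the two identities so that the integrand is nearly
   [sin (k (S - N))], which has a sign near [s0]. *)

(** For a single [t] the periodic phases [S - N] and [S + N] necessarily have further stationary
    points in [s], whose contributions have the same order k^(-1/2) as the one sought and could
    cancel it; this obstacle forces the average over [t]. A stationary point survives the average
    only if the [t]-derivative vanishes too, and by the focal geometry this happens only when [W] is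
    a positive multiple of [U]. Along that curve [S - N] is identically zero, so the average causes
    no cancellation there. With g = sqrt q, the eccentricity bound enters as e < g: the point (e, 0)
    lies inside the circle of radius g, so every ray from it meets the circle once and each [s0]
    gets its [t0]. The condition q != 1 keeps [U + W] away from zero and excludes the other focus in
    the critical equations. The real and imaginary parts of the incident wave give the two
    identities, which together allow the complex density to be multiplied by any constant. The phase
    of the Bessel asymptotics is absorbed in this way, so the asymptotics must supply only that
    their amplitude is nonzero. *)

Set Implicit Arguments.
Unset Strict Implicit.
Unset Printing Implicit Defensive.

(** * Derivatives, continuity and integrals on the line *)

Section Calc.
Context {R : realType}.
Implicit Types (f g F : R -> R) (x l r : R).

Lemma is_derive_addf f g x (a b : R) : is_derive x 1 f a -> is_derive x 1 g b ->
  is_derive x 1 (fun y => f y + g y) (a + b).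
Proof. exact: is_deriveD. Qed.

Lemma is_derive_oppf f x (a : R) : is_derive x 1 f a ->
  is_derive x 1 (fun y => - f y) (- a).
Proof. exact: is_deriveN. Qed.

Lemma is_derive_mulf f g x (a b : R) : is_derive x 1 f a -> is_derive x 1 g b ->
  is_derive x 1 (fun y => f y * g y) (a * g x + f x * b).
Proof.
move=> fa gb; apply: (is_derive_eq (is_deriveM fa gb)).
by rewrite /GRing.scale /= addrC [g x * a]mulrC.
Qed.

Lemma is_derive_expf f n x (a : R) : is_derive x 1 f a ->
  is_derive x 1 (fun y => f y ^+ n) (n%:R * f x ^+ n.-1 * a).
Proof.
move=> fa; have -> : (fun y => f y ^+ n) = f ^+ n by apply/funext => y; rewrite fctE.
exact: is_deriveX.
Qed.

Lemma is_derive_cstf (c : R) x : is_derive x 1 (fun _ : R => c) 0.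
Proof. exact: is_derive_cst. Qed.

Lemma is_derive_idf x : is_derive x 1 (fun y : R => y) 1.
Proof. exact: is_derive_id. Qed.

Lemma is_derive_sinf f x (a : R) : is_derive x 1 f a ->
  is_derive x 1 (fun y => sin (f y)) (cos (f x) * a).
Proof. by move=> fa; apply: (@is_derive1_comp _ sin f). Qed.

Lemma is_derive_cosf f x (a : R) : is_derive x 1 f a ->
  is_derive x 1 (fun y => cos (f y)) (- sin (f x) * a).
Proof. by move=> fa; apply: (@is_derive1_comp _ cos f). Qed.

Lemma is_derive_expRf f x (a : R) : is_derive x 1 f a ->
  is_derive x 1 (fun y => expR (f y)) (expR (f x) * a).
Proof. by move=> fa; apply: (@is_derive1_comp _ expR f). Qed.

Lemma is_derive_invf f x (a : R) : f x != 0 -> is_derive x 1 f a ->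
  is_derive x 1 (fun y => (f y)^-1) (- (f x ^+ 2)^-1 * a).
Proof. by move=> f0 fa; apply: is_deriveV. Qed.

Lemma is_derive_sqrtf f x (a : R) : 0 < f x -> is_derive x 1 f a ->
  is_derive x 1 (fun y => Num.sqrt (f y)) ((2 * Num.sqrt (f x))^-1 * a).
Proof.
by move=> f0 fa; apply: (@is_derive1_comp _ Num.sqrt f); exact: is_derive1_sqrt.
Qed.

Lemma is_derive_compf F f x (a b : R) : is_derive (f x) 1 F b -> is_derive x 1 f a ->
  is_derive x 1 (fun y => F (f y)) (b * a).
Proof. by move=> Fb fa; apply: (@is_derive1_comp _ F f). Qed.

Lemma is_derive_continuous f x (a : R) : is_derive x 1 f a -> {for x, continuous f}.
Proof.
by move=> [fa _]; apply: differentiable_continuous; apply/derivable1_diffP.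
Qed.

End Calc.

(** Hypotheses are tried first, so a derivative fact about an opaque function, put in the context
    just before, serves as a leaf. Side conditions such as a nonzero denominator remain as goals,
    followed by the equation with the announced derivative. *)
Ltac derive_step := first
  [ eassumption
  | eapply is_derive_cstf
  | eapply is_derive_idf
  | eapply is_derive_expf
  | eapply is_derive_addf
  | eapply is_derive_oppf
  | eapply is_derive_mulf
  | eapply is_derive_sinf
  | eapply is_derive_cosf
  | eapply is_derive_expRf
  | eapply is_derive_sqrtf
  | eapply is_derive_invf ].
Ltac derive_with := simple notypeclasses refine (is_derive_eq _ _);
  [ | repeat derive_step; cbv beta | cbv beta].

Section Cont.
Context {R : realType} {T : topologicalType}.
Implicit Types (f g : T -> R) (x : T).

Lemma cts_cst (c : R) x : {for x, continuous (fun _ : T => c)}.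
Proof. exact: cvg_cst. Qed.
Lemma cts_add f g x : {for x, continuous f} -> {for x, continuous g} ->
  {for x, continuous (fun y => f y + g y)}.
Proof. by move=> ? ?; apply: cvgD. Qed.
Lemma cts_opp f x : {for x, continuous f} -> {for x, continuous (fun y => - f y)}.
Proof. by move=> ?; apply: cvgN. Qed.
Lemma cts_mul f g x : {for x, continuous f} -> {for x, continuous g} ->
  {for x, continuous (fun y => f y * g y)}.
Proof. by move=> ? ?; apply: cvgM. Qed.
Lemma cts_exp f n x : {for x, continuous f} -> {for x, continuous (fun y => f y ^+ n)}.
Proof. move=> cf; exact: (continuous_comp cf (@exprn_continuous R n (f x))). Qed.
Lemma cts_inv f x : f x != 0 -> {for x, continuous f} ->
  {for x, continuous (fun y => (f y)^-1)}.
Proof. by move=> ? ?; apply: cvgV. Qed.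
Lemma cts_comp (h : R -> R) f x : {for f x, continuous h} -> {for x, continuous f} ->
  {for x, continuous (fun y => h (f y))}.
Proof. move=> ch cf; exact: (continuous_comp cf ch). Qed.
Lemma cts_sin f x : {for x, continuous f} -> {for x, continuous (fun y => sin (f y))}.
Proof. apply: cts_comp; exact: continuous_sin. Qed.
Lemma cts_cos f x : {for x, continuous f} -> {for x, continuous (fun y => cos (f y))}.
Proof. apply: cts_comp; exact: continuous_cos. Qed.
Lemma cts_sqrt f x : {for x, continuous f} -> {for x, continuous (fun y => Num.sqrt (f y))}.
Proof. apply: cts_comp; exact: sqrt_continuous. Qed.
End Cont.

Lemma cts_cst_ {S T : topologicalType} (w : S) (x : T) : {for x, continuous (fun _ : T => w)}.
Proof. exact: cvg_cst. Qed.
Lemma cts_id {T : topologicalType} (x : T) : {for x, continuous (fun y : T => y)}.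
Proof. exact: cvg_id. Qed.
Lemma cts_fst {S T : topologicalType} (x : S * T) : {for x, continuous (fun y : S * T => y.1)}.
Proof. exact: cvg_fst. Qed.
Lemma cts_snd {S T : topologicalType} (x : S * T) : {for x, continuous (fun y : S * T => y.2)}.
Proof. exact: cvg_snd. Qed.
Lemma cts_pair {S T V : topologicalType} (f : S -> T) (g : S -> V) x :
  {for x, continuous f} -> {for x, continuous g} -> {for x, continuous (fun y => (f y, g y))}.
Proof. by move=> ? ?; apply: cvg_pair. Qed.
Lemma cts_comp2 {S T V : topologicalType} (h : T -> V) (f : S -> T) x :
  {for f x, continuous h} -> {for x, continuous f} ->
  {for x, continuous (fun y => h (f y))}.
Proof. move=> ch cf; exact: (continuous_comp cf ch). Qed.

(** Dispatch is on the shape of the function, so that the higher-order arguments of the rules are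
    given explicitly. A leaf must be a function with a [continuous] hypothesis in the context; hence
    the local [pose] and [change] that often precede [cts]. *)
Ltac cts_step := match goal with
  | |- prop_for _ (inPhantom (continuous ?f)) =>
    lazymatch f with
    | (fun _ => ?c) => first [apply: cts_cst | apply: cts_cst_]
    | (fun y => pair (@?g y) (@?h y)) => apply: (@cts_pair _ _ _ g h)
    | (fun y => y) => apply: cts_id
    | (fun y => fst y) => apply: cts_fst
    | fst => apply: cts_fst
    | snd => apply: cts_snd
    | (fun y => snd y) => apply: cts_snd
    | (fun y => Algebra.add (@?g y) (@?h y)) => apply: (@cts_add _ _ g h)
    | (fun y => Algebra.opp (@?g y)) => apply: (@cts_opp _ _ g)
    | (fun y => GRing.mul (@?g y) (@?h y)) => apply: (@cts_mul _ _ g h)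
    | (fun y => GRing.exp (@?g y) ?n) => apply: (@cts_exp _ _ g n)
    | (fun y => GRing.inv (@?g y)) => apply: (@cts_inv _ _ g); [try eassumption|]
    | (fun y => sin (@?g y)) => apply: (@cts_sin _ _ g)
    | (fun y => cos (@?g y)) => apply: (@cts_cos _ _ g)
    | (fun y => Num.sqrt (@?g y)) => apply: (@cts_sqrt _ _ g)
    | (fun y => ?h (@?g y)) =>
      match goal with H : continuous h |- _ => apply: (@cts_comp2 _ _ _ h g); [exact: H|] end
    | _ => match goal with H : continuous f |- _ => exact: H end
    end
  end.
Ltac cts := try match goal with |- continuous_at ?x ?f => change {for x, continuous f} end;
  repeat cts_step.

Definition itg {R : realType} (l r : R) (f : R -> R) : R :=
  \int[lebesgue_measure]_(x in `[l, r]) f x.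

(** Two-sided continuity at every point, endpoints included, so that the pointwise rules apply; it
    implies continuity of the restriction. *)
Definition cton {R : realType} (l r : R) (f : R -> R) : Prop :=
  forall x, l <= x <= r -> {for x, continuous f}.

Section Itg.
Context {R : realType}.
Implicit Types (f g F : R -> R) (x l r : R).

Lemma cton_within l r f : cton l r f -> {within `[l, r], continuous f}.
Proof.
by move=> cf; apply: continuous_in_subspaceT => x; rewrite inE/= in_itv/= => /cf.
Qed.

Lemma continuous_cton l r f : continuous f -> cton l r f.
Proof. by move=> cf x _; exact: cf. Qed.

Lemma cton_integrable l r f : cton l r f ->
  (@lebesgue_measure R).-integrable `[l, r] (EFin \o f).
Proof.
move=> cf; apply: continuous_compact_integrable; first exact: segment_compact.
exact: cton_within.
Qed.

Lemma itg_ext l r f g : (forall x, l <= x <= r -> f x = g x) -> itg l r f = itg l r g.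
Proof.
by move=> fg; apply: eq_Rintegral => x; rewrite inE/= in_itv/= => /fg.
Qed.

Lemma itg_add l r f g : cton l r f -> cton l r g ->
  itg l r (fun x => f x + g x) = itg l r f + itg l r g.
Proof. by move=> cf cg; rewrite /itg RintegralD//; apply: cton_integrable. Qed.

Lemma itg_scale l r (c : R) f : cton l r f ->
  itg l r (fun x => c * f x) = c * itg l r f.
Proof. by move=> cf; rewrite /itg RintegralZl//; apply: cton_integrable. Qed.

Lemma itg_opp l r f : cton l r f -> itg l r (fun x => - f x) = - itg l r f.
Proof.
move=> cf; rewrite -mulN1r -itg_scale//; apply: itg_ext => x _; by rewrite mulN1r.
Qed.

Lemma itg_sub l r f g : cton l r f -> cton l r g ->
  itg l r (fun x => f x - g x) = itg l r f - itg l r g.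
Proof. by move=> cf cg; rewrite /itg RintegralB//; apply: cton_integrable. Qed.

Lemma itg_cst l r (c : R) : l <= r -> itg l r (fun=> c) = c * (r - l).
Proof.
move=> lr; rewrite /itg Rintegral_cst//= lebesgue_measure_itv/= lte_fin.
move: lr; rewrite le_eqVlt => /predU1P[->|->//].
by rewrite ltxx subrr.
Qed.

Lemma itg_le l r f g : cton l r f -> cton l r g ->
  (forall x, l <= x <= r -> f x <= g x) -> itg l r f <= itg l r g.
Proof.
move=> cf cg fg; by rewrite /itg le_Rintegral//; exact: cton_integrable.
Qed.

Lemma itg_ge0 l r f : (forall x, l <= x <= r -> 0 <= f x) -> 0 <= itg l r f.
Proof. by move=> f0; apply: Rintegral_ge0 => x /=; rewrite in_itv/= => /f0. Qed.

Lemma cton_norm l r f : cton l r f -> cton l r (fun x => `|f x|).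
Proof.
by move=> cf x /cf fx; apply: (@cts_comp _ _ Num.norm) => //; exact: norm_continuous.
Qed.

Lemma itg_norm_le l r f (M : R) : l <= r -> cton l r f ->
  (forall x, l <= x <= r -> `|f x| <= M) -> `|itg l r f| <= M * (r - l).
Proof.
move=> lr cf fM; rewrite -itg_cst//; apply: (le_trans (y := itg l r (fun x => `|f x|))).
  by apply: le_normr_Rintegral => //; exact: cton_integrable.
by apply: itg_le => //; [exact: cton_norm|move=> x _; exact: cts_cst].
Qed.

Lemma itg_cat l m r f : l <= m -> m <= r -> cton l r f ->
  itg l r f = itg l m f + itg m r f.
Proof.
move=> lm mr cf.
have := @Rintegral_itvB R f (BLeft l) (BRight r) m (cton_integrable cf).
rewrite !bnd_simp => /(_ lm mr); rewrite -/(itg _ _ _) -/(itg _ _ _) => /eqP.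
rewrite subr_eq addrC => /eqP ->; congr (_ + _).
have itf : (@lebesgue_measure R).-integrable `[m, r] (EFin \o f).
  by apply: cton_integrable => x /andP[mx xr]; apply: cf; rewrite (le_trans lm mx).
apply: Rintegral_itv_obnd_cbnd; apply: integrableS itf => //.
by apply: subset_itvr; rewrite bnd_simp.
Qed.

Lemma itgxx x f : itg x x f = 0.
Proof. by rewrite /itg set_itv1 Rintegral_set1. Qed.

Lemma itg_FTC l r F f : l <= r -> (forall x, l <= x <= r -> is_derive x 1 F (f x)) ->
  cton l r f -> itg l r f = F r - F l.
Proof.
rewrite le_eqVlt => /predU1P[->|lr] dF cf; first by rewrite itgxx subrr.
rewrite /itg /Rintegral (@continuous_FTC2 R f F) //; first exact: cton_within.
- have cF x : l <= x <= r -> {for x, continuous F}.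
    by move=> /dF; exact: is_derive_continuous.
  split.
  + move=> x; rewrite in_itv/= => /andP[lx xr].
    by have [] : is_derive x 1 F (f x) by apply: dF; rewrite !ltW.
  + by apply: cvg_at_right_filter; apply: cF; rewrite lexx ltW.
  + by apply: cvg_at_left_filter; apply: cF; rewrite lexx ltW.
- move=> x; rewrite in_itv/= => /andP[lx xr].
  by rewrite derive1E; apply: derive_val; apply: dF; rewrite !ltW.
Qed.

Lemma primitive_exists l r f : continuous f -> 
  exists F : R -> R, forall x, l <= x <= r -> is_derive x 1 F (f x).
Proof.
move=> cf; exists (fun x => itg (l - 1) x f) => x /andP[lx xr].
have xr1 : x < r + 1 by rewrite (le_lt_trans xr)// ltrDl.
have lx1 : l - 1 < x by rewrite ltrBlDr (le_lt_trans lx)// ltrDl.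
have itf : (@lebesgue_measure R).-integrable `[l - 1, r + 1] (EFin \o f).
  by apply: cton_integrable; exact: continuous_cton.
have [dF <-] := continuous_FTC1_closed xr1 itf lx1 (cf x).
by rewrite derive1E; exact: derivableP.
Qed.

(** A primitive of [f] is composed with [phi], so [phi] may fail to be monotone. Its image may leave
    [a, b]; hence the primitive is taken on an interval [-M, M] containing the whole image. *)
Lemma itg_subst l r (a b : R) f (phi dphi : R -> R) : l <= r -> continuous f ->
  (forall x, l <= x <= r -> is_derive x 1 phi (dphi x)) -> cton l r dphi ->
  a <= b -> phi l = a -> phi r = b ->
  itg a b f = itg l r (fun x => f (phi x) * dphi x).
Proof.
move=> lr cf dphiP cdphi ab pl pr.
have cphi : cton l r phi by move=> x /dphiP; exact: is_derive_continuous.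
have [M HM] : exists M, forall x, l <= x <= r -> `|phi x| <= M.
  have cpt : compact (phi @` `[l, r]).
    by apply: continuous_compact; [exact: cton_within|exact: segment_compact].
  case: (compact_bounded cpt) => M [_ /(_ (M + 1))]; rewrite ltrDl ltr01 => /(_ isT) HM.
  by exists (M + 1) => x lxr; apply: HM; exists x => //=; rewrite in_itv.
have [F dF] := primitive_exists (- M) M cf.
have dFphi x : l <= x <= r -> is_derive x 1 (fun y => F (phi y)) (f (phi x) * dphi x).
  by move=> lxr; apply: is_derive_compf; [apply: dF; rewrite -ler_norml HM|exact: dphiP].
have cFphi : cton l r (fun x => f (phi x) * dphi x).
  move=> x lxr; apply: cts_mul; [|exact: cdphi].
  by apply: (@cts_comp _ _ f); [exact: cf|exact: cphi].
have dFab x : a <= x <= b -> is_derive x 1 F (f x).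
  move=> /andP[ax xb]; apply: dF.
  have := HM l; have := HM r; rewrite !lexx lr pl pr !ler_norml.
  move=> /(_ isT)/andP[_ bM] /(_ isT)/andP[aM _].
  by rewrite (le_trans aM ax) (le_trans xb bM).
by rewrite (itg_FTC lr dFphi cFphi) (itg_FTC ab dFab (continuous_cton cf)) pl pr.
Qed.

(** A tube argument: compactness of the segment makes [F (w, t)] uniformly close to [F (z, t)] for
    [w] near [z]. The parameter space is arbitrary because it will also be a product. *)
Lemma itg_cont {T : topologicalType} l r (F : T * R -> R) : continuous F ->
  continuous (fun z => itg l r (fun t => F (z, t))).
Proof.
move=> cF z; have [rl|lr] := ltP r l.
  rewrite (_ : (fun _ => _) = fun=> 0); first exact: cvg_cst.
  by apply/funext => w; rewrite /itg set_itv_ge ?bnd_simp -?ltNge// Rintegral_set0.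
have cFz w : continuous (fun t => F (w, t)).
  by move=> t; apply: (@cts_comp2 _ _ _ F (fun t => (w, t))); [exact: cF|apply: cts_pair; [exact: cts_cst_|exact: cts_id]].
apply/cvgrPdist_le => /= e e0.
(* The added 1 keeps the denominator positive when l = r. *)
pose d := e / (r - l + 1).
have d0 : 0 < d by rewrite divr_gt0// ltr_wpDl// subr_ge0.
have : \forall w \near z, `[l, r]%classic `<=` (fun t => `|F (z, t) - F (w, t)| <= d).
  have /compact_near_coveringP := @segment_compact R l r.
  apply => t _.
  have /cvgrPdist_le/(_ (d / 2)) := cF (z, t).
  rewrite divr_gt0// => /(_ isT) [[U V] /= [Uz Vt] UV].
  exists (V, U) => //= -[t' w] /= [Vt' Uw].
  have /= h1 := UV (z, t') (conj (nbhs_singleton Uz) Vt').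
  have /= h2 := UV (w, t') (conj Uw Vt').
  rewrite (_ : _ - _ = (F (z, t) - F (w, t')) - (F (z, t) - F (z, t'))); last by ring.
  rewrite (le_trans (ler_normB _ _))// [leRHS](splitr d) lerD//.
apply: filterS => w Hw.
rewrite -itg_sub; [|exact: continuous_cton..].
apply: (le_trans (@itg_norm_le l r _ d lr _ _)).
- move=> t _; apply: cts_add; first exact: cFz.
  by apply: cts_opp; exact: cFz.
- by move=> t lt; apply: Hw; rewrite /= in_itv.
- by rewrite /d mulrAC ler_pdivrMr ?ltr_wpDl ?subr_ge0// ler_pM2l// lerDl.
Qed.

End Itg.

(** * Measurability and Fubini in the plane *)

Section Plane.
Context {R : realType}.
Local Notation mu := (@lebesgue_measure R).

(** Measurability refers to the product sigma-algebra, so the open set is exhibited as a countable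
    union of half-open boxes with rational corners. *)
Lemma open2_measurable (A : set (R * R)) : open A -> measurable A.
Proof.
move=> oA.
pose box (a b c d : rat) : set (R * R) :=
  [set x | ratr a < x <= ratr b]%R `*` [set x | ratr c < x <= ratr d]%R.
(* Boxes not contained in [A] are replaced by the empty set, so the union can run over all rational
   quadruples. *)
pose good (a b c d : rat) : set (R * R) :=
  if `[< box a b c d `<=` A >] then box a b c d else set0.
have -> : A = \bigcup_a \bigcup_b \bigcup_c \bigcup_d good a b c d.
  apply/seteqP; split => [[x y] Axy|z [a _ [b _ [c _ [d _]]]]]; last first.
    by rewrite /good; case: asboolP => // + /[dup] ? => /[apply].
  have := open_nbhs_nbhs (conj oA Axy) => -[[U V] /= [Ux Vy] UV].
  have [e e0 eU] : exists2 e : R, 0 < e & forall z, `|x - z| < e -> U z.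
    by have [e /= e0 eU] := Ux; exists e => // z xz; exact: eU.
  have [e' e0' eV] : exists2 e : R, 0 < e & forall z, `|y - z| < e -> V z.
    by have [f /= f0 fV] := Vy; exists f => // z xz; exact: fV.
  have rat_box (t r : R) : 0 < r -> exists p q : rat, ratr p < t <= ratr q /\
      forall z, ratr p < z <= ratr q -> `|t - z| < r.
    move=> r0.
    have tr1 : t - r < t by rewrite ltrBlDr ltrDl.
    have tr2 : t < t + r by rewrite ltrDl.
    have [p] := rat_in_itvoo tr1.
    rewrite in_itv/= => /andP[p1 p2].
    have [q] := rat_in_itvoo tr2.
    rewrite in_itv/= => /andP[q1 q2].
    exists p, q; split; first by rewrite p2 ltW.
    move=> z /andP[pz zq]; rewrite ltr_norml; apply/andP; split; lra.
  have [a [b [xab Hab]]] := rat_box x e e0.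
  have [c [d [ycd Hcd]]] := rat_box y e' e0'.
  exists a => //; exists b => //; exists c => //; exists d => //.
  rewrite /good; case: asboolP => [_|]; first by split.
  by case=> -[z w] /= [zab wcd]; apply: UV; split; [exact/eU/Hab|exact/eV/Hcd].
do 4! (apply: bigcupT_measurable_rat => ?).
rewrite /good; case: asboolP => // _; apply: measurableX.
- exact: (measurable_itv `]ratr _, ratr _]).
- exact: (measurable_itv `]ratr _, ratr _]).
Qed.

Lemma continuous2_measurable (f : R * R -> R) : continuous f -> measurable_fun setT f.
Proof.
move=> /continuousP cf; apply: (measurability _ (measurable_realfun.RGenOpens.measurableE R)).
move=> _ [_ [a [b ->] <-]]; rewrite setTI; apply: open2_measurable.
exact/cf/interval_open.
Qed.

Lemma leb2_slice1 (D : set (R * R)) (f : R * R -> \bar R) : measurable D ->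
  leb2.-integrable D f ->
  (\int[leb2]_(z in D) f z = \int[mu]_x \int[mu]_(y in [set y | D (x, y)]) f (x, y))%E.
Proof.
move=> mD fi; rewrite integral_mkcond /leb2 -integral12_prod_meas1; last first.
  by apply/integrable_restrict => //; rewrite setTI.
apply: eq_integral => x _; rewrite /fubini_F [RHS]integral_mkcond.
apply: eq_integral => y _; rewrite !patchE.
by have -> : ((x, y) \in D) = (y \in [set y0 | D (x, y0)]) by apply/idP/idP; rewrite !inE.
Qed.

Lemma leb2_slice2 (D : set (R * R)) (f : R * R -> \bar R) : measurable D ->
  leb2.-integrable D f ->
  (\int[leb2]_(z in D) f z = \int[mu]_y \int[mu]_(x in [set x | D (x, y)]) f (x, y))%E.
Proof.
move=> mD fi; rewrite integral_mkcond /leb2 -integral21_prod_meas1; last first.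
  by apply/integrable_restrict => //; rewrite setTI.
apply: eq_integral => x _; rewrite /fubini_G [RHS]integral_mkcond.
apply: eq_integral => y _; rewrite !patchE.
by have -> : ((y, x) \in D) = (y \in [set y0 | D (y0, x)]) by apply/idP/idP; rewrite !inE.
Qed.

Definition box (a b c d : R) : set (R * R) := `[a, b]%classic `*` `[c, d]%classic.

Lemma measurable_box a b c d : measurable (box a b c d).
Proof. by apply: measurableX; exact: measurable_itv. Qed.

Lemma leb2_box a b c d : (leb2 (box a b c d) < +oo)%E.
Proof.
rewrite /leb2 /box product_measure1E//; [|exact: measurable_itv..].
have fin u v : (mu `[u, v]%classic < +oo)%E.
  by rewrite lebesgue_measure_itv/=; case: ifP => _; rewrite ?ltry// -EFinB ltry.
by apply: lte_mul_pinfty; [exact: measure_ge0|rewrite ge0_fin_numE; [exact: fin|exact: measure_ge0]|exact: fin].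
Qed.

Lemma compact_box a b c d : compact (box a b c d).
Proof. by apply: compact_setX; exact: segment_compact. Qed.

Lemma bounded_leb2_integrable (D : set (R * R)) (f : R * R -> R) (M : R) a b c d :
  measurable D -> D `<=` box a b c d -> measurable_fun D f ->
  (forall z, D z -> `|f z| <= M) -> leb2.-integrable D (EFin \o f).
Proof.
move=> mD Dbox mf fM.
apply: (@measurable_bounded_integrable _ _ _ (@leb2 R)) => //.
- apply: le_lt_trans (leb2_box a b c d).
  by apply: le_measure => //; rewrite inE//; exact: measurable_box.
- by exists M; split; [exact: num_real|move=> N MN z Dz; exact: le_trans (fM z Dz) (ltW MN)].
Qed.

Lemma box_bound (f : R * R -> R) a b c d : continuous f ->
  exists M, forall z, box a b c d z -> `|f z| <= M.
Proof.
move=> cf.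
have cpt : compact (f @` box a b c d).
  apply: continuous_compact; last exact: compact_box.
  by apply: continuous_subspaceT; exact: cf.
case: (compact_bounded cpt) => M [_ /(_ (M + 1))]; rewrite ltrDl ltr01 => /(_ isT) HM.
by exists (M + 1) => x Bx; apply: HM; exists x.
Qed.

Lemma continuous_box_integrable (f : R * R -> R) a b c d : continuous f ->
  leb2.-integrable (box a b c d) (EFin \o f).
Proof.
move=> cf; have [M fM] := @box_bound f a b c d cf.
apply: (@bounded_leb2_integrable _ _ M a b c d) => //; first exact: measurable_box.
by apply: measurable_funTS; exact: continuous2_measurable.
Qed.

Lemma continuous_slice1 (f : R * R -> R) x : continuous f -> continuous (fun y => f (x, y)).
Proof.
move=> cf y; apply: (@cts_comp2 _ _ _ f (fun y => (x, y))); first exact: cf.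
by apply: cts_pair; [exact: cts_cst_|exact: cts_id].
Qed.

Lemma continuous_slice2 (f : R * R -> R) y : continuous f -> continuous (fun x => f (x, y)).
Proof.
move=> cf x; apply: (@cts_comp2 _ _ _ f (fun x => (x, y))); first exact: cf.
by apply: cts_pair; [exact: cts_id|exact: cts_cst_].
Qed.

Lemma continuous_swap (f : R * R -> R) : continuous f -> continuous (fun z => f (z.2, z.1)).
Proof.
move=> cf z; apply: (@cts_comp2 _ _ _ f (fun z => (z.2, z.1))); first exact: cf.
by apply: cts_pair; [exact: cts_snd|exact: cts_fst].
Qed.

Lemma itgE l r (f : R -> R) : cton l r f ->
  (\int[mu]_(x in `[l, r]) (f x)%:E = (itg l r f)%:E)%E.
Proof.
move=> cf; rewrite /itg /Rintegral fineK//; apply: integrable_fin_num => //.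
exact: cton_integrable.
Qed.

Lemma leb2_box_itg1 (f : R * R -> R) a b c d : continuous f ->
  (\int[leb2]_(z in box a b c d) (f z)%:E =
   (itg a b (fun x => itg c d (fun y => f (x, y))))%:E)%E.
Proof.
move=> cf; rewrite leb2_slice1; last exact: continuous_box_integrable; last exact: measurable_box.
rewrite -itgE; last by apply: continuous_cton; exact: (@itg_cont _ _ c d f).
rewrite [RHS]integral_mkcond; apply: eq_integral => x _; rewrite patchE.
case: ifPn => [|] xab.
  rewrite -itgE; last by apply: continuous_cton; exact: continuous_slice1.
  congr (integral _ _ _); apply/seteqP; split => y /=; first by case.
  by move=> ycd; split => //; rewrite inE in xab.
rewrite (_ : [set y | _] = set0) ?integral_set0// -subset0 => y [/= xab' _].
by move/negP: xab; apply; rewrite inE.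
Qed.

Lemma leb2_box_itg2 (f : R * R -> R) a b c d : continuous f ->
  (\int[leb2]_(z in box a b c d) (f z)%:E =
   (itg c d (fun y => itg a b (fun x => f (x, y))))%:E)%E.
Proof.
move=> cf; rewrite leb2_slice2; last exact: continuous_box_integrable; last exact: measurable_box.
rewrite -itgE; last first.
  by apply: continuous_cton; apply: (@itg_cont _ _ a b (fun z => f (z.2, z.1))); exact: continuous_swap.
rewrite [RHS]integral_mkcond; apply: eq_integral => y _; rewrite patchE.
case: ifPn => [|] ycd.
  rewrite -itgE; last by apply: continuous_cton; exact: continuous_slice2.
  congr (integral _ _ _); apply/seteqP; split => x /=; first by case.
  by move=> xab; split => //; rewrite inE in ycd.
rewrite (_ : [set x | _] = set0) ?integral_set0// -subset0 => x [/= _ ycd'].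
by move/negP: ycd; apply; rewrite inE.
Qed.

Lemma itg_swap (f : R * R -> R) a b c d : continuous f ->
  itg a b (fun x => itg c d (fun y => f (x, y))) =
  itg c d (fun y => itg a b (fun x => f (x, y))).
Proof. by move=> cf; apply: EFin_inj; rewrite -leb2_box_itg1// -leb2_box_itg2. Qed.

(** Differentiation under the integral by Fubini: the double integral of [df] is computed in both
    orders, and the fundamental theorem of calculus shows that the parameter integral differs by a
    constant from a primitive near [s]. *)
Lemma itg_is_derive (f df : R * R -> R) (l r : R) : continuous f -> continuous df ->
  (forall s t : R, is_derive s 1 (fun x : R => f (x, t)) (df (s, t))) ->
  forall s : R, is_derive s 1 (fun s : R => itg l r (fun t => f (s, t))) (itg l r (fun t => df (s, t))).
Proof.
move=> cf cdf dfP s.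
have cH : continuous (fun s => itg l r (fun t => df (s, t))) by exact: (@itg_cont _ _ l r df).
have [H dH] := primitive_exists (s - 1) (s + 1) cH.
have HE x : s - 1 <= x <= s + 1 ->
    itg l r (fun t => f (x, t)) - itg l r (fun t => f (s - 1, t)) = H x - H (s - 1).
  move=> /andP[sx xs].
  rewrite -itg_sub; [|by apply: continuous_cton; exact: continuous_slice1..].
  transitivity (itg (s - 1) x (fun s => itg l r (fun t => df (s, t)))); last first.
    apply: itg_FTC => //; last by apply: continuous_cton.
    by move=> y /andP[y1 y2]; apply: dH; rewrite y1 (le_trans y2).
  rewrite itg_swap//; apply: itg_ext => t _.
  apply/esym/(itg_FTC (F := fun s => f (s, t))) => //.
  by apply: continuous_cton; exact: continuous_slice2.
have ds : is_derive s 1 (fun x => H x + (itg l r (fun t => f (s - 1, t)) - H (s - 1)))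
    (itg l r (fun t => df (s, t))).
  have dHs : is_derive s 1 H (itg l r (fun t => df (s, t))).
    by apply: dH; rewrite lerBlDr lerDl ler01.
  by derive_with; rewrite addr0.
apply: near_eq_is_derive ds.
have : s \in `]s - 1, s + 1[ by rewrite in_itv/=; apply/andP; split; lra.
move=> /near_in_itvoo; apply: filterS => x; rewrite in_itv/= => /andP[x1 x2].
by rewrite addrCA -HE ?subrKC// !ltW.
Qed.

End Plane.

(** * Comparison estimates from the sign of a derivative *)

Section Monotone.
Context {R : realType}.

Lemma ge0_derive_le (f df : R -> R) (l r : R) : l <= r ->
  (forall x, l <= x <= r -> is_derive x 1 f (df x)) ->
  (forall x, l <= x <= r -> 0 <= df x) -> f l <= f r.
Proof.
move=> lr dfP df0.
have cf : {within `[l, r], continuous f}.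
  by apply: cton_within => x /dfP; exact: is_derive_continuous.
have [x|x xlr E] := @MVT_segment R f df l r lr _ cf.
  by rewrite in_itv/= => /andP[lx xr]; apply: dfP; rewrite !ltW.
by rewrite -subr_ge0 E mulr_ge0 ?subr_ge0// df0.
Qed.

Lemma derive_ge_lin (f df : R -> R) (c l r : R) : l <= r ->
  (forall x, l <= x <= r -> is_derive x 1 f (df x)) ->
  (forall x, l <= x <= r -> c <= df x) -> c * (r - l) <= f r - f l.
Proof.
move=> lr dfP dfc.
have : f l - c * l <= f r - c * r; last by lra.
apply: (@ge0_derive_le (fun x => f x - c * x) (fun x => df x - c)) => //.
- move=> x /dfP dfx; derive_with; ring.
- by move=> x /dfc; rewrite subr_ge0.
Qed.

Lemma derive_le_lin (f df : R -> R) (c l r : R) : l <= r ->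
  (forall x, l <= x <= r -> is_derive x 1 f (df x)) ->
  (forall x, l <= x <= r -> df x <= c) -> f r - f l <= c * (r - l).
Proof.
move=> lr dfP dfc.
have : c * l - f l <= c * r - f r; last by lra.
apply: (@ge0_derive_le (fun x => c * x - f x) (fun x => c - df x)) => //.
- move=> x /dfP dfx; derive_with; ring.
- by move=> x /dfc; rewrite subr_ge0.
Qed.

Lemma sin_ler (x : R) : 0 <= x -> sin x <= x.
Proof.
move=> x0; have := @derive_le_lin sin cos 1 0 x x0.
rewrite sin0 !subr0 mul1r; apply => y _; exact: cos_le1.
Qed.

Lemma cos_ge_quad (x : R) : 0 <= x -> 1 - x ^+ 2 / 2 <= cos x.
Proof.
move=> x0; have := @ge0_derive_le (fun y => cos y + y ^+ 2 / 2) (fun y => y - sin y) 0 x x0.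
rewrite cos0 expr0n/= mul0r addr0 lerBlDr; apply.
- by move=> y _; derive_with; field.
- by move=> y /andP[y0 _]; rewrite subr_ge0 sin_ler.
Qed.

Lemma sin_ge_half (x : R) : 0 <= x <= 1 -> x / 2 <= sin x.
Proof.
move=> /andP[x0 x1]; have := @derive_ge_lin sin cos (1 / 2) 0 x x0.
rewrite sin0 !subr0 mul1r mulrC; apply => y /andP[y0 yx]; apply: le_trans (cos_ge_quad y0).
have : y ^+ 2 <= 1 by rewrite expr_le1// (le_trans yx).
lra.
Qed.

Lemma one_sub_cos_ge (x : R) : 0 <= x <= 1 -> x ^+ 2 / 4 <= 1 - cos x.
Proof.
move=> /andP[x0 x1].
have := @ge0_derive_le (fun y => - cos y - y ^+ 2 / 4) (fun y => sin y - y / 2) 0 x x0.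
rewrite cos0 expr0n/= mul0r subr0 => H.
have : - 1 <= - cos x - x ^+ 2 / 4; last by lra.
apply: H.
- by move=> y _; derive_with; field.
- by move=> y /andP[y0 yx]; rewrite subr_ge0 sin_ge_half// y0 (le_trans yx).
Qed.

Lemma one_sub_cos_le (x : R) : 0 <= x -> 1 - cos x <= x ^+ 2 / 2.
Proof. by move=> /cos_ge_quad; lra. Qed.

(** A decreasing substitution, which [itg_subst] does not cover because it keeps the orientation. *)
Lemma itg_reflect (s l r : R) (f : R -> R) : l <= r -> continuous f ->
  itg l r f = itg (s - r) (s - l) (fun x => f (s - x)).
Proof.
move=> lr cf; have [F dF] := primitive_exists l r cf.
have sl : s - r <= s - l by lra.
have dG x : s - r <= x <= s - l -> is_derive x 1 (fun y => - F (s - y)) (f (s - x)).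
  move=> /andP[x1 x2].
  have dFx : is_derive (s - x) 1 F (f (s - x)) by apply: dF; apply/andP; split; lra.
  have dsx : is_derive x 1 (fun y => s - y) (- 1) by derive_with; ring.
  have dFs := @is_derive_compf _ F (fun y => s - y) _ _ _ dFx dsx.
  by derive_with; ring.
rewrite (itg_FTC lr dF (continuous_cton cf)) (itg_FTC sl dG).
  have -> : s - (s - r) = r by ring.
  have -> : s - (s - l) = l by ring.
  by rewrite opprK addrC.
move=> x _; apply: (@cts_comp _ _ f); first exact: cf.
by cts.
Qed.

End Monotone.

(** * Oscillatory integrals in one variable *)

Section Oscillatory.
Context {R : realType}.
Variables (P P1 P2 a a1 : R -> R).
Hypothesis dP : forall x : R, is_derive x 1 P (P1 x).
Hypothesis dP1 : forall x : R, is_derive x 1 P1 (P2 x).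
Hypothesis cP2 : continuous P2.
Hypothesis da : forall x : R, is_derive x 1 a (a1 x).
Hypothesis ca1 : continuous a1.

Let cP : continuous P. Proof. by move=> x; exact: (is_derive_continuous (dP x)). Qed.
Let cP1 : continuous P1. Proof. by move=> x; exact: (is_derive_continuous (dP1 x)). Qed.
Let ca : continuous a. Proof. by move=> x; exact: (is_derive_continuous (da x)). Qed.

Lemma osc_ibp (l r k w : R) : l <= r -> k != 0 ->
  (forall x, l <= x <= r -> P1 x != 0) ->
  itg l r (fun x => a x * cos (k * P x + w)) =
  a r * sin (k * P r + w) / (k * P1 r) - a l * sin (k * P l + w) / (k * P1 l) -
  itg l r (fun x => sin (k * P x + w) * (a1 x / P1 x - a x * P2 x / P1 x ^+ 2) / k).
Proof.
move=> lr k0 P10.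
set h := (X in _ - itg _ _ X).
set f := (X in itg _ _ X).
have ch : cton l r h.
  move=> x /P10 Px; rewrite /h; cts => //.
  by rewrite expf_neq0.
have cf : cton l r f by move=> x _; rewrite /f; cts.
apply/eqP; rewrite eq_sym subr_eq -itg_add//; apply/eqP/esym.
apply: (itg_FTC (F := fun x => a x * sin (k * P x + w) / (k * P1 x))) => //.
- move=> x lxr; have Px := P10 x lxr.
  have dPx := dP x; have dP1x := dP1 x; have dax := da x.
  derive_with; first by rewrite mulf_neq0.
  by rewrite /f /h; field; rewrite k0 Px.
- by move=> x lxr; apply: cts_add; [exact: cf|exact: ch].
Qed.

(** Nonstationary phase by one integration by parts. The shift [w] lets one statement serve cosines
    and, at [- (pi / 2)], sines. *)
Lemma osc_nonstat (l r k w c M A A1 : R) : l <= r -> 0 < k -> 0 < c ->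
  (forall x, l <= x <= r -> c <= `|P1 x|) ->
  (forall x, l <= x <= r -> `|P2 x| <= M) ->
  (forall x, l <= x <= r -> `|a x| <= A) ->
  (forall x, l <= x <= r -> `|a1 x| <= A1) ->
  `|itg l r (fun x => a x * cos (k * P x + w))| <=
  (2 * A / c + (A1 / c + A * M / c ^+ 2) * (r - l)) / k.
Proof.
move=> lr k0 c0 Pc PM aA aA1.
have P0 x : l <= x <= r -> P1 x != 0.
  by move=> /Pc cP1x; rewrite -normr_gt0 (lt_le_trans c0).
have A0 : 0 <= A by apply: le_trans (aA l _); rewrite ?normr_ge0// lexx.
have A10 : 0 <= A1 by apply: le_trans (aA1 l _); rewrite ?normr_ge0// lexx.
have M0 : 0 <= M by apply: le_trans (PM l _); rewrite ?normr_ge0// lexx.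
have inv x : l <= x <= r -> `|P1 x|^-1 <= c^-1.
  by move=> /Pc h; rewrite lef_pV2 ?posrE// (lt_le_trans c0).
have sin1 x : `|sin x : R| <= 1 by rewrite ler_norml sin_geN1 sin_le1.
have bd x : l <= x <= r -> `|a x * sin (k * P x + w) / (k * P1 x)| <= A / c / k.
  move=> lxr; rewrite invfM mulrA mulrAC !normrM !normfV (gtr0_norm k0).
  rewrite ler_pM2r ?invr_gt0// ler_pM ?mulr_ge0 ?invr_ge0//; last exact: inv.
  by rewrite -[leRHS]mulr1 ler_pM ?aA.
rewrite osc_ibp ?gt_eqF// (le_trans (ler_normB _ _))// mulrDl lerD//.
  rewrite (le_trans (ler_normB _ _))// (_ : 2 * A / c / k = A / c / k + A / c / k); last by field; rewrite (gt_eqF k0) (gt_eqF c0).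
  by rewrite lerD// bd// lexx lr.
rewrite mulrAC; apply: itg_norm_le => //.
  move=> x lxr; have Px := P0 x lxr; have Px2 := expf_neq0 2 Px; have kn0 := lt0r_neq0 k0; cts.
move=> x lxr; rewrite normrM normfV (gtr0_norm k0) ler_pM2r ?invr_gt0//.
rewrite normrM -[leRHS]mul1r ler_pM// (le_trans (ler_normB _ _))// lerD//.
  by rewrite normrM normfV ler_pM ?invr_ge0 ?aA1 ?inv.
rewrite !normrM normfV normrX -exprVn -[in leRHS]exprVn.
rewrite ler_pM ?mulr_ge0 ?exprn_ge0 ?invr_ge0//; first by rewrite ler_pM ?aA ?PM.
by rewrite ler_pXn2r ?nnegrE ?invr_ge0 ?(ltW c0)// inv.
Qed.

(** The first-derivative test of van der Corput. As [P2] has constant sign, [P2 / P1 ^+ 2] is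
    nonnegative and is the exact derivative of -1 / P1, so it integrates to at most 2 / d. The bound
    thus has 1 / d instead of 1 / d^2, which matters when [d] shrinks as the frequency grows. *)
Lemma osc_mono (l r k w d A A1 : R) : l <= r -> 0 < k -> 0 < d ->
  (forall x, l <= x <= r -> d <= `|P1 x|) ->
  (forall x, l <= x <= r -> 0 <= P2 x) ->
  (forall x, l <= x <= r -> `|a x| <= A) ->
  (forall x, l <= x <= r -> `|a1 x| <= A1) ->
  `|itg l r (fun x => a x * cos (k * P x + w))| <= (4 * A + A1 * (r - l)) / d / k.
Proof.
move=> lr k0 c0 Pc PM aA aA1.
have P0 x : l <= x <= r -> P1 x != 0.
  by move=> /Pc cP1x; rewrite -normr_gt0 (lt_le_trans c0).
have A0 : 0 <= A by apply: le_trans (aA l _); rewrite ?normr_ge0// lexx.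
have A10 : 0 <= A1 by apply: le_trans (aA1 l _); rewrite ?normr_ge0// lexx.
have inv x : l <= x <= r -> `|P1 x|^-1 <= d^-1.
  by move=> /Pc h; rewrite lef_pV2 ?posrE// (lt_le_trans c0).
have sin1 x : `|sin x : R| <= 1 by rewrite ler_norml sin_geN1 sin_le1.
have bd x : l <= x <= r -> `|a x * sin (k * P x + w) / (k * P1 x)| <= A / d / k.
  move=> lxr; rewrite invfM mulrA mulrAC !normrM !normfV (gtr0_norm k0).
  rewrite ler_pM2r ?invr_gt0// ler_pM ?mulr_ge0 ?invr_ge0//; last exact: inv.
  by rewrite -[leRHS]mulr1 ler_pM ?aA.
rewrite osc_ibp ?gt_eqF// (le_trans (ler_normB _ _))//.
have -> : (4 * A + A1 * (r - l)) / d / k =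
    (A / d / k + A / d / k) + (A1 * (r - l) / d / k + A * (2 / d) / k).
  by field; rewrite !gt_eqF.
rewrite lerD//.
  by rewrite (le_trans (ler_normB _ _))// lerD// bd// lexx lr.
have cQ : cton l r (fun x => A * P2 x / P1 x ^+ 2).
  by move=> x /P0 Px; cts => //; rewrite expf_neq0.
have cS : cton l r (fun x => sin (k * P x + w) * (a1 x / P1 x - a x * P2 x / P1 x ^+ 2) / k).
  move=> x lxr; have Px := P0 x lxr; have Px2 := expf_neq0 2 Px; have kn0 := lt0r_neq0 k0; cts.
apply: (@le_trans _ _ (itg l r (fun x => (A1 / d + A * P2 x / P1 x ^+ 2) / k))).
  apply: (le_trans (@le_normr_Rintegral _ _ _ _ _ _ _ (cton_integrable cS))) => //.
  apply: itg_le.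
  - exact: cton_norm.
  - by move=> x lxr; have Px2 := expf_neq0 2 (P0 x lxr); have kn0 := lt0r_neq0 k0; cts.
  move=> x lxr; rewrite normrM normfV (gtr0_norm k0) ler_pM2r ?invr_gt0//.
  rewrite normrM -[leRHS]mul1r ler_pM// (le_trans (ler_normB _ _))// lerD//.
    by rewrite normrM normfV ler_pM ?invr_ge0 ?aA1 ?inv.
  rewrite !normrM normfV normrX real_normK ?num_real//.
  rewrite ler_wpM2r ?invr_ge0 ?sqr_ge0// (ger0_norm (PM x lxr)).
  by rewrite ler_wpM2r ?PM ?aA.
rewrite (_ : (fun x => _) = (fun x => k^-1 * (A1 / d + A * P2 x / P1 x ^+ 2))); last first.
  by apply/funext => x; rewrite mulrC.
rewrite itg_scale; last first.
  by move=> x lxr; have Px2 := expf_neq0 2 (P0 x lxr); cts.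
rewrite -mulrDl mulrC ler_pM2r ?invr_gt0//.
rewrite itg_add//; last by move=> x _; exact: cts_cst.
rewrite itg_cst//; apply: lerD; first by rewrite mulrAC.
have dQ x : l <= x <= r -> is_derive x 1 (fun y => - A / P1 y) (A * P2 x / P1 x ^+ 2).
  move=> lxr; have dP1x := dP1 x; have Px := P0 x lxr.
  by derive_with => //; field.
rewrite (itg_FTC lr dQ cQ).
rewrite (_ : _ - _ = A * ((P1 l)^-1 - (P1 r)^-1)); last by ring.
rewrite ler_wpM2l// (le_trans (ler_norm _))// (le_trans (ler_normB _ _))//.
rewrite !normfV (_ : 2 / d = d^-1 + d^-1); last by field; rewrite gt_eqF.
by rewrite lerD// inv// lexx lr.
Qed.

End Oscillatory.

Ltac nneg := repeat first
  [ match goal with H : is_true (0 <= ?x) |- is_true (0 <= ?x) => exact: H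
                  | H : is_true (0 < ?x) |- is_true (0 <= ?x) => exact: (ltW H) end
  | match goal with
    | |- is_true (_ <= _ / _) => apply: divr_ge0
    | |- is_true (_ <= _ * _) => apply: mulr_ge0
    | |- is_true (_ <= _ + _) => apply: addr_ge0
    | |- is_true (_ <= _ ^+ 2) => apply: sqr_ge0
    | |- is_true (_ <= _ ^+ _) => apply: exprn_ge0
    end
  | assumption | apply: ltW; assumption | apply: normr_ge0 | apply: sqrtr_ge0
  | apply: ler01 | apply: ler0n ].

Lemma le_of_eq {R : numDomainType} (x y : R) : x = y -> x <= y.
Proof. by move=> ->. Qed.

(** Lets a cut-off radius tend to 0 without taking limits: the [r] below makes the loss [K * r] at
    most half of the gap [Y - X]. *)
Lemma le_of_small {R : realType} (X Y K r0 : R) : 0 < r0 -> 0 <= K ->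
  (forall r, 0 < r < r0 -> Y - K * r <= X) -> Y <= X.
Proof.
move=> r00 K0 H; rewrite leNgt; apply/negP => XY.
pose r := Num.min (r0 / 2) ((Y - X) / (2 * (K + 1))).
have K1 : 0 < 2 * (K + 1) by lra.
have r_gt0 : 0 < r by rewrite lt_min !divr_gt0// subr_gt0.
have rr0 : r < r0 by rewrite gt_min ltr_pdivrMr// mulr2n mulrDr mulr1 ltrDl r00.
have := H r; rewrite r_gt0 rr0 => /(_ isT).
have : K * r <= (Y - X) / 2.
  apply: (@le_trans _ _ ((K + 1) * ((Y - X) / (2 * (K + 1))))).
    apply: ler_pM => //; [exact: ltW|lra|by rewrite ge_min lexx orbT].
  by apply: le_of_eq; field; lra.
lra.
Qed.

Section Oscillatory2.
Context {R : realType}.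
Variables (P P1 P2 g g1 : R -> R).
Hypothesis dP : forall x : R, is_derive x 1 P (P1 x).
Hypothesis dP1 : forall x : R, is_derive x 1 P1 (P2 x).
Hypothesis cP2 : continuous P2.
Hypothesis dg : forall x : R, is_derive x 1 g (g1 x).
Hypothesis cg1 : continuous g1.

Let cP : continuous P. Proof. by move=> x; exact: (is_derive_continuous (dP x)). Qed.
Let cP1 : continuous P1. Proof. by move=> x; exact: (is_derive_continuous (dP1 x)). Qed.
Let cg : continuous g. Proof. by move=> x; exact: (is_derive_continuous (dg x)). Qed.

(** The second-derivative test of van der Corput: within 1 / q of the stationary point the trivial
    bound suffices, beyond it |P1| >= c / q and [osc_mono] applies. The frequency is written
    [q ^+ 2] so that the decay k^(-1/2) becomes 1 / q. *)
Lemma osc_vdc (s l r q w c A A1 : R) : l <= s -> s <= r -> 0 < q -> 0 < c ->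
  P1 s = 0 ->
  (forall x, l <= x <= r -> c <= P2 x) ->
  (forall x, l <= x <= r -> `|g x| <= A) ->
  (forall x, l <= x <= r -> `|g1 x| <= A1) ->
  `|itg l r (fun x => g x * cos (q ^+ 2 * P x + w))| <=
  (2 * A + 2 * (4 * A + A1 * (r - l)) / c) / q.
Proof.
move=> ls sr q0 c0 P1s cP2' gA g1A.
have A0 : 0 <= A by apply: le_trans (gA l _); rewrite ?normr_ge0// lexx (le_trans ls).
have A10 : 0 <= A1 by apply: le_trans (g1A l _); rewrite ?normr_ge0// lexx (le_trans ls).
set f := (X in itg _ _ X).
have cf : continuous f by move=> x; rewrite /f; cts.
pose t := q^-1; have t0 : 0 < t by rewrite invr_gt0.
(* The window is clamped to [l, r]: when it reaches an endpoint, the outer piece on that side is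
   empty. *)
pose l' := Num.max l (s - t); pose r' := Num.min r (s + t).
have l'1 : l <= l' by rewrite le_max lexx.
have l's : l' <= s by rewrite ge_max ls; lra.
have r's : s <= r' by rewrite le_min sr; lra.
have r'r : r' <= r by rewrite ge_min lexx.
have l'r' := le_trans l's r's.
have P1R x : s <= x <= r -> c * (x - s) <= P1 x.
  move=> /andP[sx xr]; rewrite -[P1 x]subr0 -P1s; apply: derive_ge_lin => // y /andP[sy yx].
  by apply: cP2'; rewrite (le_trans ls sy) (le_trans yx xr).
have P1L x : l <= x <= s -> P1 x <= - (c * (s - x)).
  move=> /andP[lx xs]; rewrite lerNr -[leRHS]add0r -P1s.
  apply: derive_ge_lin => // y /andP[xy ys].
  by apply: cP2'; rewrite (le_trans lx xy) (le_trans ys sr).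
rewrite (itg_cat (m := l') l'1 (le_trans l'r' r'r)); last exact: continuous_cton.
rewrite (itg_cat (m := r') l'r' r'r); last exact: continuous_cton.
have B0 : 0 <= (4 * A + A1 * (r - l)) / (c * t) / q ^+ 2.
  rewrite !divr_ge0 ?mulr_ge0 ?addr_ge0 ?mulr_ge0 ?exprn_ge0 ?(ltW q0) ?(ltW c0) ?(ltW t0)//.
  by rewrite subr_ge0 (le_trans ls).
have q20 : 0 < q ^+ 2 by rewrite exprn_gt0.
have b1 : `|itg l l' f| <= (4 * A + A1 * (r - l)) / (c * t) / q ^+ 2.
  have [l'E|ll'] := eqVneq l' l; first by rewrite l'E itgxx normr0.
  have l'E : l' = s - t.
    move: ll'; rewrite /l' /Num.max; case: ifP => //; by rewrite eqxx.
  apply: (le_trans (osc_mono (d := c * t) (A := A) (A1 := A1) dP dP1 cP2 dg cg1 w _ _ _ _ _ _ _)) => //.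
  - by rewrite mulr_gt0.
  - move=> x /andP[lx xl']; rewrite ler0_norm.
      rewrite lerNr (le_trans (P1L x _)) ?lx ?(le_trans xl')// lerN2 ler_pM2l//.
      by move: xl'; rewrite l'E; lra.
    rewrite (le_trans (P1L x _)) ?lx ?(le_trans xl')// oppr_le0 mulr_ge0 ?(ltW c0)// subr_ge0.
    exact: le_trans xl' l's.
  - move=> x /andP[lx xl']; rewrite (le_trans (ltW c0))// cP2'// lx.
    exact: le_trans xl' (le_trans l's sr).
  - by move=> x /andP[lx xl']; rewrite gA// lx (le_trans xl' (le_trans l's sr)).
  - by move=> x /andP[lx xl']; rewrite g1A// lx (le_trans xl' (le_trans l's sr)).
  - rewrite ler_pM2r ?invr_gt0// ler_pM2r ?invr_gt0 ?mulr_gt0// lerD2l ler_wpM2l// lerD2r.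
    exact: le_trans l's sr.
have b3 : `|itg r' r f| <= (4 * A + A1 * (r - l)) / (c * t) / q ^+ 2.
  have [r'E|rr'] := eqVneq r' r; first by rewrite r'E itgxx normr0.
  have r'E : r' = s + t.
    move: rr'; rewrite /r' /Num.min; case: ifP => //; by rewrite eqxx.
  apply: (le_trans (osc_mono (d := c * t) (A := A) (A1 := A1) dP dP1 cP2 dg cg1 w _ _ _ _ _ _ _)) => //.
  - by rewrite mulr_gt0.
  - move=> x /andP[lx xl']; rewrite ger0_norm.
      rewrite (le_trans _ (P1R x _)) ?xl' ?andbT ?(le_trans r's)// ler_pM2l//.
      by move: lx; rewrite r'E; lra.
    rewrite (le_trans _ (P1R x _)) ?xl' ?andbT ?(le_trans r's)// mulr_ge0 ?(ltW c0)// subr_ge0.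
    exact: le_trans lx.
  - move=> x /andP[lx xl']; rewrite (le_trans (ltW c0))// cP2'// xl' andbT.
    exact: le_trans (le_trans ls r's) lx.
  - by move=> x /andP[lx xl']; rewrite gA// xl' (le_trans (le_trans ls r's) lx).
  - by move=> x /andP[lx xl']; rewrite g1A// xl' (le_trans (le_trans ls r's) lx).
  - rewrite ler_pM2r ?invr_gt0// ler_pM2r ?invr_gt0 ?mulr_gt0// lerD2l ler_wpM2l// lerD2l lerN2.
    exact: le_trans ls r's.
have b2 : `|itg l' r' f| <= 2 * A / q.
  apply: (le_trans (@itg_norm_le _ _ _ _ A l'r' _ _)); first exact: continuous_cton.
    move=> x /andP[l'x xr']; rewrite /f normrM -[leRHS]mulr1 ler_pM//.
      by rewrite gA// (le_trans l'1 l'x) (le_trans xr' r'r).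
    by rewrite ler_norml cos_geN1 cos_le1.
  rewrite [2 * A]mulrC -mulrA ler_wpM2l//.
  have : s - t <= l' by rewrite le_max lexx orbT.
  have : r' <= s + t by rewrite ge_min lexx orbT.
  by rewrite -/t; lra.
apply: (le_trans (ler_normD _ _)); apply: (le_trans (lerD b1 (ler_normD _ _))).
apply: (le_trans (lerD (lexx _) (lerD b2 b3))).
by apply: le_of_eq; rewrite /t; field; rewrite (gt_eqF q0) (gt_eqF c0).
Qed.

(** Integration by parts with 1 - cos instead of -cos as primitive of the sine: the boundary term at
    [s], where [P1] vanishes, tends to 0, and everything else is nonnegative because
    [g * P2 - g1 * P1] is positive. A single short interval then gives the lower bound. *)
Lemma osc_sin_right (s r q c C c3 G T : R) : s <= r -> 0 < q -> 0 < c -> 0 < c3 ->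
  0 < T -> C * T ^+ 2 <= 2 ->
  P s = 0 -> P1 s = 0 ->
  (forall x, s <= x <= r -> c <= P2 x <= C) ->
  (forall x, s <= x <= r -> 0 <= g x <= G) ->
  (forall x, s <= x <= r -> c3 <= g x * P2 x - g1 x * P1 x) ->
  0 <= itg s r (fun x => g x * sin (q ^+ 2 * P x)) /\
  (s + T / q <= r ->
   c3 * c ^+ 2 * T ^+ 3 / (128 * C ^+ 2) / q <= itg s r (fun x => g x * sin (q ^+ 2 * P x))).
Proof.
rewrite le_eqVlt => /predU1P[->|sr] q0 c0 c30 T0 CT Ps P1s bP2 bg bgP.
  rewrite itgxx; split => // H; have : 0 < T / q by rewrite divr_gt0.
  lra.
set k := q ^+ 2; have k0 : 0 < k by rewrite exprn_gt0.
set f := (X in itg _ _ X).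
have cf : continuous f by move=> x; rewrite /f; cts.
have C0 : 0 < C.
  by have := bP2 s; rewrite lexx ltW// => /(_ isT) /andP[cP' PC]; rewrite (lt_le_trans c0)// (le_trans cP').
have G0 : 0 <= G.
  by have := bg s; rewrite lexx ltW// => /(_ isT) /andP[cP' PC]; rewrite (le_trans cP').
have bP1 x : s <= x <= r -> c * (x - s) <= P1 x <= C * (x - s).
  move=> /andP[sx xr]; rewrite -[P1 x]subr0 -P1s; apply/andP; split.
    by apply: derive_ge_lin => // y /andP[sy yx]; have /andP[] := bP2 y (introT andP (conj sy (le_trans yx xr))).
  by apply: derive_le_lin => // y /andP[sy yx]; have /andP[] := bP2 y (introT andP (conj sy (le_trans yx xr))).
have bP x : s <= x <= r -> c * (x - s) ^+ 2 / 2 <= P x <= C * (x - s) ^+ 2 / 2.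
  move=> /andP[sx xr]; apply/andP; split.
    have := @ge0_derive_le _ (fun y => P y - c * (y - s) ^+ 2 / 2) (fun y => P1 y - c * (y - s)) s x sx.
    rewrite Ps subrr expr0n/= !mulr0 mul0r subrr subr_ge0; apply.
      by move=> y _; have dPy := dP y; derive_with; field.
    move=> y /andP[sy yx]; rewrite subr_ge0.
    by have /andP[] := bP1 y (introT andP (conj sy (le_trans yx xr))).
  have := @ge0_derive_le _ (fun y => C * (y - s) ^+ 2 / 2 - P y) (fun y => C * (y - s) - P1 y) s x sx.
  rewrite Ps subrr expr0n/= !mulr0 mul0r subrr subr_ge0; apply.
    by move=> y _; have dPy := dP y; derive_with; field.
  move=> y /andP[sy yx]; rewrite subr_ge0.
  by have /andP[] := bP1 y (introT andP (conj sy (le_trans yx xr))).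
(* The derivative of [g * (1 - cos (k * P)) / (k * P1)] is the integrand minus [h]. The denominator
   vanishes at [s], so integrals of [h] start at [s + rho]. *)
pose h x := (g x * P2 x - g1 x * P1 x) * (1 - cos (k * P x)) / (k * P1 x ^+ 2).
have P1pos x : s < x -> x <= r -> 0 < P1 x.
  move=> sx xr; have /bP1/andP[+ _] : s <= x <= r by rewrite ltW.
  by apply: lt_le_trans; rewrite mulr_gt0// subr_gt0.
have h0 x : s < x -> x <= r -> 0 <= h x.
  move=> sx xr; rewrite /h divr_ge0//; last by rewrite mulr_ge0 ?sqr_ge0 ?ltW.
  apply: mulr_ge0; last by rewrite subr_ge0 cos_le1.
  by apply: le_trans (bgP _ _); rewrite ltW.
have ch a b : s < a -> b <= r -> cton a b h.
  move=> sa br x /andP[ax xb].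
  have Px : P1 x != 0 by rewrite gt_eqF// P1pos// ?(lt_le_trans sa)// (le_trans xb).
  have kP : k * P1 x ^+ 2 != 0 by rewrite mulf_neq0 ?expf_neq0// gt_eqF.
  by rewrite /h; cts.
(* The first summand pays for the discarded piece of length [rho]; the second for the boundary term
   at [s + rho], by 1 - cos y <= y^2 / 2, P <= C rho^2 / 2, P1 >= c rho and rho <= 1. *)
pose K := G + G * k * C ^+ 2 / (8 * c).
have K0 : 0 <= K.
  by rewrite /K; nneg.
have main rho : 0 < rho < Num.min 1 (r - s) -> itg (s + rho) r h - K * rho <= itg s r f.
  rewrite lt_min => /andP[rho0 /andP[rho1 rhor]].
  have srho : s <= s + rho by lra.
  have rhor' : s + rho <= r by lra.
  rewrite (itg_cat srho rhor'); last exact: continuous_cton.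
  have inner : - (G * rho) <= itg s (s + rho) f.
    have := @itg_norm_le _ s (s + rho) f G srho (continuous_cton cf).
    rewrite [s + rho]addrC addrK ler_norml => H; apply: (proj1 (andP (H _))).
    move=> x /andP[sx xs]; rewrite /f normrM -[leRHS]mulr1 ler_pM//.
      have /bg/andP[g0 gG] : s <= x <= r by rewrite sx; lra.
      by rewrite ger0_norm.
    by rewrite ler_norml sin_geN1 sin_le1.
  pose B x := g x * (1 - cos (k * P x)) / (k * P1 x).
  have outer : itg (s + rho) r f = B r - B (s + rho) + itg (s + rho) r h.
    have cF : cton (s + rho) r (fun x => f x + (- h x)).
      move=> x xr; apply: cts_add; first exact: cf.
      by apply: cts_opp; apply: (ch (s + rho) r) => //; lra.
    have dB x : s + rho <= x <= r -> is_derive x 1 B (f x + (- h x)).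
      move=> /andP[x1 x2].
      have Px : P1 x != 0 by rewrite gt_eqF// P1pos//; lra.
      have kP : k * P1 x != 0 by rewrite mulf_neq0// gt_eqF.
      have dPx := dP x; have dP1x := dP1 x; have dgx := dg x.
      rewrite /B; derive_with => //.
      by rewrite /f /h; field; rewrite (gt_eqF k0) Px.
    rewrite -(itg_FTC rhor' dB cF) itg_sub ?subrK//; first exact: continuous_cton.
    by apply: ch => //; lra.
  have Br : 0 <= B r.
    rewrite /B divr_ge0//; last by rewrite mulr_ge0 ?ltW// P1pos.
    apply: mulr_ge0; last by rewrite subr_ge0 cos_le1.
    by have /bg/andP[] : s <= r <= r by rewrite lexx ltW.
  have Bs : B (s + rho) <= G * k * C ^+ 2 / (8 * c) * rho.
    have sI : s <= s + rho <= r by rewrite srho.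
    have /andP[g0 gG] := bg _ sI; have /andP[p0 p1] := bP _ sI.
    have /andP[p10 _] := bP1 _ sI.
    have sE : s + rho - s = rho by ring.
    rewrite sE in p0 p1 p10.
    have Pge0 : 0 <= P (s + rho).
      by apply: le_trans p0; nneg.
    have num : 1 - cos (k * P (s + rho)) <= k ^+ 2 * C ^+ 2 * rho ^+ 4 / 8.
      apply: (le_trans (one_sub_cos_le _)); first by rewrite mulr_ge0 ?(ltW k0).
      rewrite exprMn (_ : _ / 8 = k ^+ 2 * (C * rho ^+ 2 / 2) ^+ 2 / 2); last by field.
      rewrite ler_pM2r ?invr_gt0// ler_pM2l ?exprn_gt0// ler_pXn2r// ?nnegrE//.
      by rewrite (le_trans Pge0).
    apply: (@le_trans _ _ (G * (k ^+ 2 * C ^+ 2 * rho ^+ 4 / 8) / (k * (c * rho)))).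
      rewrite /B ler_pM//.
      - by rewrite mulr_ge0// subr_ge0 cos_le1.
      - by rewrite invr_ge0 mulr_ge0 ?(ltW k0)// (le_trans _ p10)// mulr_ge0 ?ltW.
      - by rewrite ler_pM// subr_ge0 cos_le1.
      - rewrite lef_pV2 ?posrE ?mulr_gt0//; first by rewrite ler_pM2l.
        by rewrite (lt_le_trans _ p10)// mulr_gt0.
    have -> : G * (k ^+ 2 * C ^+ 2 * rho ^+ 4 / 8) / (k * (c * rho)) =
        G * k * C ^+ 2 / (8 * c) * rho * rho ^+ 2.
      by field; rewrite (gt_eqF k0) (gt_eqF c0) (gt_eqF rho0).
    rewrite -[leRHS]mulr1 ler_wpM2l//; last by rewrite expr_le1// ltW.
    by nneg.
  rewrite outer /K mulrDl; lra.
have min0 : 0 < Num.min 1 (r - s) by rewrite lt_min ltr01 subr_gt0.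
split.
  apply: (le_of_small min0 K0) => rho rhoI; apply: le_trans (main rho rhoI).
  rewrite lerD2r itg_ge0// => x /andP[x1 x2]; apply: h0 => //.
  by move/andP: rhoI => [? _]; lra.
move=> sTr.
have Tq0 : 0 < T / q by rewrite divr_gt0.
apply: (@le_of_small _ _ _ K (Num.min (Num.min 1 (r - s)) (T / q / 2))) => //.
  by rewrite lt_min min0 divr_gt0.
move=> rho; rewrite lt_min => /andP[rho0 /andP[rhom rhoT]].
apply: le_trans (main rho _); last by rewrite rho0.
rewrite lerD2r.
(* All the mass is taken from [s + T / (2 q), s + T / q], where [C * T ^+ 2 <= 2] keeps [k * P] in
   [0, 1] and hence 1 - cos y >= y^2 / 4 applies. There h >= c3 c^2 T^2 / (64 C^2), and the length T
   / (2 q) turns 64 into 128. *)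
have o1 : s + rho <= s + T / q / 2 by lra.
have o2 : s + T / q / 2 <= s + T / q by lra.
rewrite (itg_cat o1 (le_trans o2 sTr)); last by apply: ch => //; lra.
rewrite (itg_cat o2 sTr); last by apply: ch => //; lra.
have i1 : 0 <= itg (s + rho) (s + T / q / 2) h.
  by apply: itg_ge0 => x /andP[x1 x2]; apply: h0; lra.
have i3 : 0 <= itg (s + T / q) r h.
  by apply: itg_ge0 => x /andP[x1 x2]; apply: h0; lra.
suff : c3 * c ^+ 2 * T ^+ 3 / (128 * C ^+ 2) / q <= itg (s + T / q / 2) (s + T / q) h by lra.
have -> : c3 * c ^+ 2 * T ^+ 3 / (128 * C ^+ 2) / q =
    itg (s + T / q / 2) (s + T / q) (fun=> c3 * (c ^+ 2 * T ^+ 2 / (64 * C ^+ 2))).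
  by rewrite itg_cst//; field; rewrite (gt_eqF C0) (gt_eqF q0).
apply: itg_le; [by move=> x _; exact: cts_cst|by apply: ch => //; lra|].
move=> x /andP[x1 x2].
have xI : s <= x <= r by apply/andP; split; lra.
rewrite /h -[leRHS]mulrA; apply: ler_pM; [exact: ltW|by nneg|exact: bgP|].
have /andP[p0 p1] := bP _ xI; have /andP[p10 p11] := bP1 _ xI.
set t := x - s in p0 p1 p10 p11.
have t0 : 0 < t by rewrite /t; lra.
have tT : t <= T / q by rewrite /t; lra.
have Tt : T / q / 2 <= t by rewrite /t; lra.
have kt : k * t ^+ 2 <= T ^+ 2.
  rewrite /k -exprMn ler_pXn2r// ?nnegrE; [|by nneg|by nneg].
  by move: tT; rewrite ler_pdivlMr// [leLHS]mulrC.
have kt' : T ^+ 2 / 4 <= k * t ^+ 2.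
  rewrite /k -exprMn (_ : _ / 4 = (T / 2) ^+ 2); last by field.
  rewrite ler_pXn2r// ?nnegrE; [|by nneg|by nneg].
  by move: Tt; rewrite mulrAC ler_pdivrMr// [leRHS]mulrC.
have kP0 : 0 <= k * P x.
  by apply: mulr_ge0; [exact: ltW|apply: le_trans p0; nneg].
have kP1' : k * P x <= 1.
  apply: (@le_trans _ _ (C * (k * t ^+ 2) / 2)).
    by rewrite (_ : _ / 2 = k * (C * t ^+ 2 / 2)) ?ler_pM2l//; field.
  rewrite ler_pdivrMr// mul1r; apply: le_trans CT; by rewrite ler_pM2l.
have num : (k * (c * t ^+ 2 / 2)) ^+ 2 / 4 <= 1 - cos (k * P x).
  apply: (le_trans _ (one_sub_cos_ge _)); last by rewrite kP0.
  rewrite ler_pM2r ?invr_gt0// ler_pXn2r ?nnegrE// ?ler_pM2l//.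
  by nneg.
have P1x : 0 < P1 x by rewrite P1pos//; lra.
rewrite ler_pdivlMr; last by rewrite mulr_gt0 ?exprn_gt0.
apply: le_trans num.
apply: (@le_trans _ _ (c ^+ 2 * T ^+ 2 / (64 * C ^+ 2) * (k * (C * t) ^+ 2))).
  apply: ler_wpM2l; first by nneg.
  by rewrite ler_pM2l// ler_pXn2r ?nnegrE ?(ltW P1x) ?mulr_ge0 ?(ltW C0) ?(ltW t0).
have -> : c ^+ 2 * T ^+ 2 / (64 * C ^+ 2) * (k * (C * t) ^+ 2) =
  c ^+ 2 * (T ^+ 2 / 4) * (k * t ^+ 2) / 16 by field; rewrite gt_eqF.
have -> : (k * (c * t ^+ 2 / 2)) ^+ 2 / 4 = c ^+ 2 * (k * t ^+ 2) * (k * t ^+ 2) / 16.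
  by field.
rewrite ler_pM2r ?invr_gt0//; apply: ler_wpM2r; first by nneg.
by apply: ler_wpM2l => //; exact: sqr_ge0.
Qed.

End Oscillatory2.

(** On the left of [s] nonnegativity is enough. The reflection x -> 2 s - x changes the sign of both
    [P1] and [g1], so the bound on [g * P2 - g1 * P1] is preserved and the one-sided estimate
    applies. *)
Lemma osc_sin_lower {R : realType} (P P1 P2 g g1 : R -> R) (s l r q c C c3 G T : R) :
  (forall x : R, is_derive x 1 P (P1 x)) -> (forall x : R, is_derive x 1 P1 (P2 x)) ->
  continuous P2 -> (forall x : R, is_derive x 1 g (g1 x)) -> continuous g1 ->
  l <= s -> s + T / q <= r -> 0 < q -> 0 < c -> 0 < c3 ->
  0 < T -> C * T ^+ 2 <= 2 -> P s = 0 -> P1 s = 0 ->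
  (forall x, l <= x <= r -> c <= P2 x <= C) ->
  (forall x, l <= x <= r -> 0 <= g x <= G) ->
  (forall x, l <= x <= r -> c3 <= g x * P2 x - g1 x * P1 x) ->
  c3 * c ^+ 2 * T ^+ 3 / (128 * C ^+ 2) / q <= itg l r (fun x => g x * sin (q ^+ 2 * P x)).
Proof.
move=> dP dP1 cP2 dg cg1 ls sTr q0 c0 c30 T0 CT Ps P1s bP2 bg bgP.
have sr : s <= r by apply: le_trans sTr; rewrite lerDl ltW// divr_gt0.
have cP : continuous P by move=> x; exact: (is_derive_continuous (dP x)).
have cg : continuous g by move=> x; exact: (is_derive_continuous (dg x)).
have cP1 : continuous P1 by move=> x; exact: (is_derive_continuous (dP1 x)).
have cf : continuous (fun x => g x * sin (q ^+ 2 * P x)) by move=> x; cts.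
rewrite (itg_cat ls sr); last exact: continuous_cton.
have [_ /(_ sTr) H] := osc_sin_right dP dP1 cP2 dg cg1 sr q0 c0 c30 T0 CT Ps P1s
  (fun x h => bP2 x (introT andP (conj (le_trans ls (proj1 (andP h))) (proj2 (andP h)))))
  (fun x h => bg x (introT andP (conj (le_trans ls (proj1 (andP h))) (proj2 (andP h)))))
  (fun x h => bgP x (introT andP (conj (le_trans ls (proj1 (andP h))) (proj2 (andP h))))).
suff L : 0 <= itg l s (fun x => g x * sin (q ^+ 2 * P x)).
  by apply: le_trans H _; rewrite lerDr.
rewrite (itg_reflect (2 * s) ls cf).
have -> : 2 * s - s = s by ring.
have sl : s <= 2 * s - l by lra.
have cr : continuous (fun y : R => 2 * s - y) by move=> y; cts.
have refl (x : R) : is_derive x 1 (fun y => 2 * s - y) (- 1) by derive_with; ring.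
have dPr (x : R) : is_derive x 1 (fun y => P (2 * s - y)) (- P1 (2 * s - x)).
  apply: is_derive_eq (@is_derive_compf _ P _ _ _ _ (dP _) (refl x)) _; ring.
have dP1r (x : R) : is_derive x 1 (fun y => - P1 (2 * s - y)) (P2 (2 * s - x)).
  have dd := @is_derive_compf _ P1 _ _ _ _ (dP1 _) (refl x).
  derive_with; ring.
have dgr (x : R) : is_derive x 1 (fun y => g (2 * s - y)) (- g1 (2 * s - x)).
  apply: is_derive_eq (@is_derive_compf _ g _ _ _ _ (dg _) (refl x)) _; ring.
have cP2r : continuous (fun y : R => P2 (2 * s - y)) by move=> x; cts.
have cg1r : continuous (fun y : R => - g1 (2 * s - y)) by move=> x; cts.
have sE : 2 * s - s = s by ring.
have I (x : R) : s <= x <= 2 * s - l -> l <= 2 * s - x <= r by move=> /andP[? ?]; apply/andP; split; lra.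
have [] // := @osc_sin_right _ _ _ _ _ _ dPr dP1r cP2r dgr cg1r s (2 * s - l) q c C c3 G T
  sl q0 c0 c30 T0 CT.
- by rewrite sE.
- by rewrite sE P1s oppr0.
- by move=> x /I /bP2.
- by move=> x /I /bg.
- by move=> x /I /bgP; rewrite mulrNN.
Qed.

(** * Asymptotics of a perturbed oscillator and of the Bessel kernel *)

Section Perturbed.
Context {R : realType}.

(** [a + K / x] decreases and [a - K / x] increases; the supremum of the latter is the limit, and
    the rate is read off from the two. *)
Lemma cvg_rate (a a1 : R -> R) (K : R) : 0 <= K ->
  (forall x : R, 1 <= x -> is_derive x 1 a (a1 x)) ->
  (forall x : R, 1 <= x -> `|a1 x| <= K / x ^+ 2) ->
  exists A : R, forall x : R, 1 <= x -> `|a x - A| <= K / x.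
Proof.
move=> K0 da a1K.
have dinv (x : R) : 1 <= x -> is_derive x 1 (fun y => K / y) (- K / x ^+ 2).
  move=> x1; have x0 : x != 0 by rewrite gt_eqF// (lt_le_trans ltr01).
  by derive_with => //; field.
have up x y : 1 <= x -> x <= y -> a y + K / y <= a x + K / x.
  move=> x1 xy; rewrite -lerN2.
  apply: (@ge0_derive_le _ (fun z => - (a z + K / z)) (fun z => K / z ^+ 2 - a1 z)) => //.
    move=> z /andP[xz _]; have z1 := le_trans x1 xz.
    by have d1 := dinv z z1; have d2 := da z z1; derive_with; ring.
  move=> z /andP[xz _]; rewrite subr_ge0 (le_trans (ler_norm _))// a1K//.
  exact: le_trans xz.
have dn x y : 1 <= x -> x <= y -> a x - K / x <= a y - K / y.
  move=> x1 xy.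
  apply: (@ge0_derive_le _ (fun z => a z - K / z) (fun z => a1 z + K / z ^+ 2)) => //.
    move=> z /andP[xz _]; have z1 := le_trans x1 xz.
    by have d1 := dinv z z1; have d2 := da z z1; derive_with; ring.
  move=> z /andP[xz _]; have := a1K z (le_trans x1 xz).
  by rewrite ler_norml => /andP[+ _]; lra.
have cross x y : 1 <= x -> 1 <= y -> a x - K / x <= a y + K / y.
  move=> x1 y1; set m := Num.max x y.
  have xm : x <= m by rewrite le_max lexx.
  have ym : y <= m by rewrite le_max lexx orbT.
  apply: le_trans (dn x m x1 xm) _; apply: le_trans (up y m y1 ym).
  rewrite lerD2l; suff : 0 <= K / m by lra.
  by rewrite divr_ge0// (le_trans ler01)// (le_trans x1).
pose S := [set a x - K / x | x in [set x | 1 <= x]].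
have S0 : S !=set0 by exists (a 1 - K / 1), 1 => /=.
have Sub y : 1 <= y -> ubound S (a y + K / y) by move=> y1 _ [x x1 <-]; exact: cross.
have hS : has_sup S by split => //; exists (a 1 + K / 1); exact: Sub.
exists (sup S) => x x1.
have h1 : a x - K / x <= sup S by apply: sup_upper_bound => //; exists x.
have h2 : sup S <= a x + K / x by apply: ge_sup => //; exact: Sub.
rewrite ler_norml; apply/andP; split; lra.
Qed.

(** The perturbation d / x^2 is integrable: it keeps the energy [f ^+ 2 + f1 ^+ 2] between positive
    constants, and in coordinates rotating with the free oscillator the solution has derivative O(1
    / x^2), hence converges. *)
Lemma perturbed_oscillator (f f1 : R -> R) (d : R) : 0 <= d ->
  (forall x : R, 1 <= x -> is_derive x 1 f (f1 x)) ->
  (forall x : R, 1 <= x -> is_derive x 1 f1 ((d / x ^+ 2 - 1) * f x)) ->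
  0 < f 1 ^+ 2 + f1 1 ^+ 2 ->
  exists A B M : R, [/\ 0 < A ^+ 2 + B ^+ 2, 0 <= M &
    forall x : R, 1 <= x -> `|f x - (A * cos x + B * sin x)| <= M / x].
Proof.
move=> d0 df df1 E1.
pose E x := f x ^+ 2 + f1 x ^+ 2.
pose e1 x := 2 * d * f x * f1 x / x ^+ 2.
have x0 (x : R) : 1 <= x -> 0 < x by move=> x1; exact: lt_le_trans x1.
have dE (x : R) : 1 <= x -> is_derive x 1 E (e1 x).
  move=> x1; have d1 := df x x1; have d2 := df1 x x1; have xp := x0 x x1.
  by rewrite /E; derive_with; rewrite /e1; field; rewrite gt_eqF.
have e1E (x : R) : 1 <= x -> `|e1 x| <= d / x ^+ 2 * E x.
  move=> x1; have xp := x0 x x1.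
  rewrite /e1 (_ : _ / _ = d / x ^+ 2 * (2 * (f x * f1 x))); last first.
    by field; rewrite gt_eqF.
  have dx : 0 <= d / x ^+ 2 by nneg.
  rewrite normrM (ger0_norm dx) ler_wpM2l//.
  have h1 : 0 <= (f x + f1 x) ^+ 2 by exact: sqr_ge0.
  have h2 : 0 <= (f x - f1 x) ^+ 2 by exact: sqr_ge0.
  rewrite ler_norml /E; apply/andP; split; nra.
have dexp (c x : R) : 1 <= x -> is_derive x 1 (fun y => expR (c / y)) (- c / x ^+ 2 * expR (c / x)).
  move=> x1; have xp : x != 0 by rewrite gt_eqF// x0.
  by derive_with => //; field.
have Eup (x : R) : 1 <= x -> E x <= E 1 * expR d.
  move=> x1.
  have := @ge0_derive_le _ (fun z => - (E z * expR (d / z)))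
    (fun z => (d / z ^+ 2 * E z - e1 z) * expR (d / z)) 1 x x1.
  rewrite divr1 lerN2 => H.
  apply: (le_trans _ (H _ _)).
  - rewrite -[leLHS]mulr1 ler_wpM2l//; first by rewrite /E; nneg.
    by rewrite -[leLHS]expR0 ler_expR divr_ge0// ltW// x0.
  - move=> z /andP[z1 _]; have h1 := dE z z1; have h2 := dexp d z z1.
    derive_with; ring.
  - move=> z /andP[z1 _]; rewrite mulr_ge0 ?expR_ge0// subr_ge0.
    exact: le_trans (ler_norm _) (e1E z z1).
have Edn (x : R) : 1 <= x -> E 1 * expR (- d) <= E x.
  move=> x1.
  have := @ge0_derive_le _ (fun z => E z * expR (- d / z))
    (fun z => (d / z ^+ 2 * E z + e1 z) * expR (- d / z)) 1 x x1.
  rewrite divr1 => H.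
  apply: (le_trans (H _ _)).
  - move=> z /andP[z1 _]; have h1 := dE z z1; have h2 := dexp (- d) z z1.
    derive_with; ring.
  - move=> z /andP[z1 _]; rewrite mulr_ge0 ?expR_ge0//.
    by have := e1E z z1; rewrite ler_norml => /andP[+ _]; lra.
  - rewrite -[leRHS]mulr1 ler_wpM2l//; first by rewrite /E; nneg.
    rewrite -[leRHS]expR0 ler_expR mulNr oppr_le0 divr_ge0// ltW//; exact: x0.
pose K := 1 + E 1 * expR d.
have fK (x : R) : 1 <= x -> `|f x| <= K.
  move=> x1; have := Eup x x1; rewrite /E /K => H.
  have h : f x ^+ 2 <= E 1 * expR d by apply: le_trans H; rewrite lerDl sqr_ge0.
  have h3 : 0 <= (f x - 1) ^+ 2 by exact: sqr_ge0.
  have h4 : 0 <= (f x + 1) ^+ 2 by exact: sqr_ge0.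
  rewrite ler_norml -/(E 1); apply/andP; split; nra.
have K0 : 0 <= K by exact: le_trans (normr_ge0 _) (fK 1 (lexx _)).
(* Variation of constants: f = a cos + b sin, and a^2 + b^2 is the energy. *)
pose a x := f x * cos x - f1 x * sin x.
pose b x := f x * sin x + f1 x * cos x.
have bnd (t x : R) : 1 <= x -> `|t| <= 1 -> `|d * f x * t / x ^+ 2| <= d * K / x ^+ 2.
  move=> x1 t1; rewrite !normrM (ger0_norm d0) (ger0_norm (_ : 0 <= (x ^+ 2)^-1)).
    rewrite ler_wpM2r ?invr_ge0 ?sqr_ge0// -[leRHS]mulr1 -!mulrA ler_wpM2l//.
    by rewrite ler_pM// fK.
  by rewrite invr_ge0 sqr_ge0.
have [A HA] : exists A : R, forall x : R, 1 <= x -> `|a x - A| <= d * K / x.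
  apply: (@cvg_rate a (fun x => d * f x * (- sin x) / x ^+ 2)); first by nneg.
    move=> x x1; have d1 := df x x1; have d2 := df1 x x1; have xp := x0 x x1.
    by rewrite /a; derive_with; field; rewrite gt_eqF.
  by move=> x x1; apply: bnd => //; rewrite normrN ler_norml sin_geN1 sin_le1.
have [B HB] : exists A : R, forall x : R, 1 <= x -> `|b x - A| <= d * K / x.
  apply: (@cvg_rate b (fun x => d * f x * (cos x) / x ^+ 2)); first by nneg.
    move=> x x1; have d1 := df x x1; have d2 := df1 x x1; have xp := x0 x x1.
    by rewrite /b; derive_with; field; rewrite gt_eqF.
  by move=> x x1; apply: bnd => //; rewrite ler_norml cos_geN1 cos_le1.
exists A, B, (2 * (d * K)); split; last 2 first.
- by nneg.
- move=> x x1.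
  have -> : f x - (A * cos x + B * sin x) = (a x - A) * cos x + (b x - B) * sin x.
    rewrite /a /b; have := cos2Dsin2 x => H.
    rewrite -[f x in LHS]mulr1 -H; ring.
  rewrite (le_trans (ler_normD _ _))// (_ : 2 * (d * K) / x = d * K / x * 1 + d * K / x * 1); last by ring.
  rewrite lerD// normrM ler_pM// ?HA ?HB// ler_norml ?cos_geN1 ?cos_le1// sin_geN1 sin_le1//.
rewrite lt_neqAle addr_ge0 ?sqr_ge0// andbT eq_sym paddr_eq0 ?sqr_ge0// !sqrf_eq0.
apply/negP => /andP[/eqP A0 /eqP B0].
pose m := E 1 * expR (- d); have m0 : 0 < m by rewrite mulr_gt0// expR_gt0.
(* If A = B = 0, both coordinates are at most d K / x while the energy is at least [m], so m x <= 2
   (d K)^2; this [x] violates that. *)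
pose x := 1 + 2 * (d * K) ^+ 2 / m + 1.
have q0 : 0 <= 2 * (d * K) ^+ 2 / m by nneg.
have x1 : 1 <= x by rewrite /x; lra.
have xp := x0 x x1.
have ab : E x = a x ^+ 2 + b x ^+ 2.
  rewrite /E /a /b; have := cos2Dsin2 x => H.
  rewrite -[LHS]mulr1 -H; ring.
have := HA x x1; have := HB x x1; rewrite A0 B0 !subr0 => hb ha.
have sq (t : R) : `|t| <= d * K / x -> t ^+ 2 <= (d * K) ^+ 2 / x.
  move=> tk; rewrite -real_normK ?num_real//.
  apply: (@le_trans _ _ ((d * K / x) ^+ 2)); first by rewrite ler_pXn2r ?nnegrE//; nneg.
  rewrite expr_div_n; apply: ler_wpM2l; first exact: sqr_ge0.
  by rewrite lef_pV2 ?posrE ?exprn_gt0// expr2 ler_peMl// ltW.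
have := sq _ ha; have := sq _ hb; have := Edn x x1; rewrite -/m ab => h1 h2 h3.
have : m * x <= 2 * (d * K) ^+ 2.
  rewrite -ler_pdivlMr//; apply: le_trans h1 _; lra.
have -> : m * x = m + 2 * (d * K) ^+ 2 + m by rewrite /x; field; rewrite gt_eqF.
lra.
Qed.

End Perturbed.

Section Bessel.
Context {R : realType}.

(* Up to the factor [2 pi], this is J_1(x) / x. *)
Definition bes (x : R) : R := itg (- pi) pi (fun u => cos u ^+ 2 * cos (x * sin u)).

Let bes1 (x : R) : R := itg (- pi) pi (fun u => - (cos u ^+ 2 * sin u * sin (x * sin u))).
Let bes2 (x : R) : R := itg (- pi) pi (fun u => - (cos u ^+ 2 * sin u ^+ 2 * cos (x * sin u))).

Lemma Npi_le_pi : - pi <= pi :> R.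
Proof. by have := pi_ge0 R; lra. Qed.

Let dbes (x : R) : is_derive x 1 bes (bes1 x).
Proof.
apply: (@itg_is_derive _ (fun z => cos z.2 ^+ 2 * cos (z.1 * sin z.2))
   (fun z => - (cos z.2 ^+ 2 * sin z.2 * sin (z.1 * sin z.2)))).
- by move=> z; cts.
- by move=> z; cts.
- by move=> s t /=; derive_with; ring.
Qed.

Let dbes1 (x : R) : is_derive x 1 bes1 (bes2 x).
Proof.
apply: (@itg_is_derive _ (fun z => - (cos z.2 ^+ 2 * sin z.2 * sin (z.1 * sin z.2)))
   (fun z => - (cos z.2 ^+ 2 * sin z.2 ^+ 2 * cos (z.1 * sin z.2)))).
- by move=> z; cts.
- by move=> z; cts.
- by move=> s t /=; derive_with; ring.
Qed.

Lemma continuous_bes : continuous bes.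
Proof. by move=> x; exact: (is_derive_continuous (dbes x)). Qed.

(** The Bessel equation in the form satisfied by J_1(x) / x. The integrand is the [u]-derivative of
    [cos u ^+ 3 * sin (x * sin u)], which vanishes at both ends. *)
Let bes_ode (x : R) : 3 * bes1 x + x * (bes x + bes2 x) = 0.
Proof.
rewrite /bes /bes1 /bes2 -itg_add; [|by move=> u _; cts..].
rewrite -!itg_scale; [|by move=> u _; cts..].
rewrite -itg_add; [|by move=> u _; cts..].
have dF u : - pi <= u <= pi -> is_derive u 1 (fun u => cos u ^+ 3 * sin (x * sin u))
    (3 * - (cos u ^+ 2 * sin u * sin (x * sin u)) +
     x * (cos u ^+ 2 * cos (x * sin u) + - (cos u ^+ 2 * sin u ^+ 2 * cos (x * sin u)))).
  move=> _; derive_with.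
  have := cos2Dsin2 u => H; have E : sin u ^+ 2 = 1 - cos u ^+ 2 by rewrite -H; ring.
  rewrite /= E; ring.
rewrite (itg_FTC Npi_le_pi dF); last by move=> u _; cts.
by rewrite sinN sinpi oppr0 mulr0 sin0 !mulr0 subrr.
Qed.

(** Provides nonzero initial energy for the oscillator. Since |sin u| <= 1, the cosine of [sin u] is
    at least 1 / 2. *)
Let bes_1_gt0 : 0 < bes 1.
Proof.
have dF (u : R) : - pi <= u <= pi ->
    is_derive u 1 (fun u => (u + sin u * cos u) / 4) (cos u ^+ 2 / 2).
  move=> _; derive_with.
  have E : sin u ^+ 2 = 1 - cos u ^+ 2 by rewrite -(cos2Dsin2 u); ring.
  by transitivity ((1 + cos u ^+ 2 - sin u ^+ 2) / 4); [field|rewrite E; field].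
have cG : cton (- pi) pi (fun u : R => cos u ^+ 2 / 2) by move=> u _; cts.
apply: (@lt_le_trans _ _ (itg (- pi) pi (fun u => cos u ^+ 2 / 2))).
  rewrite (itg_FTC Npi_le_pi dF cG) sinN sinpi; have := pi_gt0 R; lra.
apply: itg_le => //; first by move=> u _; cts.
move=> u _; rewrite mul1r ler_wpM2l ?sqr_ge0//.
have : 1 - `|sin u| ^+ 2 / 2 <= cos `|sin u| by rewrite cos_ge_quad.
have -> : cos `|sin u| = cos (sin u) by have [|] := ler0P (sin u); rewrite ?cosN.
have : `|sin u| ^+ 2 <= 1 by rewrite expr_le1// ler_norml sin_geN1 sin_le1.
lra.
Qed.

(** Multiplication by x^(3/2) removes the first-order term of the equation and leaves f'' = (3 / (4
    x^2) - 1) f. *)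
Lemma bes_asymptotics : exists A B M : R, [/\ 0 < A ^+ 2 + B ^+ 2, 0 <= M &
  forall x : R, 1 <= x -> `|x * Num.sqrt x * bes x - (A * cos x + B * sin x)| <= M / x].
Proof.
pose f (x : R) := x * Num.sqrt x * bes x.
pose f1 (x : R) := 3 / 2 * Num.sqrt x * bes x + x * Num.sqrt x * bes1 x.
have sq (x : R) : 1 <= x -> [/\ 0 < x, x = Num.sqrt x ^+ 2 & Num.sqrt x != 0].
  move=> x1; have x0 : 0 < x by exact: lt_le_trans x1.
  by rewrite sqr_sqrtr ?ltW// gt_eqF// sqrtr_gt0.
apply: (@perturbed_oscillator _ f f1 (3 / 4)).
- lra.
- move=> x x1; have [x0 xE s0] := sq x x1; have db := dbes x.
  rewrite /f; derive_with => //; rewrite /f1.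
  move: xE s0; move: (Num.sqrt x) => s xE s0; move: (bes x) (bes1 x) => J J1.
  by rewrite xE; field.
- move=> x x1; have [x0 xE s0] := sq x x1; have db := dbes x; have db1 := dbes1 x.
  have ode : x * bes2 x = - 3 * bes1 x - x * bes x by have := bes_ode x; lra.
  rewrite /f1; derive_with => //; rewrite /f.
  move: xE s0; move: (Num.sqrt x) => s xE s0.
  have -> : x * s * bes2 x = s * (x * bes2 x) by ring.
  rewrite ode; move: (bes x) (bes1 x) => J J1.
  by rewrite xE; field.
- apply: ltr_pwDl; last exact: sqr_ge0.
  by rewrite exprn_gt0// /f sqrtr1 !mul1r.
Qed.

End Bessel.

(** * Oscillatory integrals in two variables *)

Section Phase.
Context {R : realType}.

Lemma near_box (x y : R) (Q : R * R -> Prop) : (\forall z \near (x, y), Q z) ->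
  exists d : R, 0 < d /\ forall x' y' : R, `|x - x'| <= d -> `|y - y'| <= d -> Q (x', y').
Proof.
move=> [[U V] /= [[e /= e0 eU] [f /= f0 fV]] UV].
exists (Num.min e f / 2); have m0 : 0 < Num.min e f by rewrite lt_min e0.
split; first by rewrite divr_gt0.
move=> x' y' xx' yy'; apply: UV; split => /=.
- apply: eU => /=; apply: (le_lt_trans xx'); rewrite ltr_pdivrMr// gt_min; apply/orP; left; lra.
- apply: fV => /=; apply: (le_lt_trans yy'); rewrite ltr_pdivrMr// gt_min; apply/orP; right; lra.
Qed.

Lemma near_bounded (F : R * R -> R) z : continuous F ->
  \forall w \near z, `|F w| <= `|F z| + 1.
Proof.
move=> cF; have /cvgrPdist_le/(_ 1 ltr01) := cF z; apply: filterS => w H.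
rewrite -lerBlDl; apply: le_trans H; rewrite distrC; exact: lerB_dist.
Qed.

Lemma near_norm_gt (F : R * R -> R) z : continuous F -> F z != 0 ->
  \forall w \near z, `|F z| / 2 <= `|F w|.
Proof.
move=> cF Fz; have Fz0 : 0 < `|F z| / 2 by rewrite divr_gt0 ?normr_gt0.
have /cvgrPdist_le/(_ _ Fz0) := cF z; apply: filterS => w H.
have := lerB_dist (F z) (F w); lra.
Qed.

Lemma nat_upper_bound (x : R) : exists N : nat, x <= N%:R.
Proof.
exists (Num.bound `|x|).
exact: le_trans (ler_norm x) (ltW (archi_boundP (normr_ge0 x))).
Qed.

(** Partial derivatives are carried as data. The two variables enter symmetrically, with pure second
    derivatives, because each integration by parts runs along one axis. *)
Definition smooth_phase (P Ps Pss Pa Paa : R * R -> R) : Prop :=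
  [/\ continuous P, continuous Ps /\ continuous Pss, continuous Pa /\ continuous Paa,
      (forall s t : R, is_derive s 1 (fun x => P (x, t)) (Ps (s, t)) /\
                   is_derive s 1 (fun x => Ps (x, t)) (Pss (s, t))) &
      (forall s t : R, is_derive t 1 (fun y => P (s, y)) (Pa (s, t)) /\
                   is_derive t 1 (fun y => Pa (s, y)) (Paa (s, t)))].

Definition smooth_amplitude (a as_ aa : R * R -> R) : Prop :=
  [/\ continuous a, continuous as_, continuous aa,
      (forall s t : R, is_derive s 1 (fun x => a (x, t)) (as_ (s, t))) &
      (forall s t : R, is_derive t 1 (fun y => a (s, y)) (aa (s, t)))].

(** One constant serves every subrectangle of a fixed square, so that the estimate can later be
    summed over a subdivision. *)
Lemma noncritical_s (P Ps Pss Pa Paa a as_ aa : R * R -> R) (w s0 t0 : R) :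
  smooth_phase P Ps Pss Pa Paa -> smooth_amplitude a as_ aa -> Ps (s0, t0) != 0 ->
  exists d C : R, [/\ 0 < d, 0 <= C &
  forall l r m n k : R, s0 - d <= l -> l <= r -> r <= s0 + d -> t0 - d <= m -> m <= n -> n <= t0 + d ->
    0 < k ->
  `|itg m n (fun t => itg l r (fun s => a (s, t) * cos (k * P (s, t) + w)))| <= C / k].
Proof.
move=> [cP [cPs cPss] _ dP _] [ca cas _ da _] Ps0.
set c := `|Ps (s0, t0)| / 2.
have c0 : 0 < c by rewrite divr_gt0 ?normr_gt0.
set M := `|Pss (s0, t0)| + 1; set A := `|a (s0, t0)| + 1; set A1 := `|as_ (s0, t0)| + 1.
have [d [d0 Hd]] : exists d : R, 0 < d /\ forall x' y' : R, `|s0 - x'| <= d -> `|t0 - y'| <= d ->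
    [/\ c <= `|Ps (x', y')|, `|Pss (x', y')| <= M, `|a (x', y')| <= A & `|as_ (x', y')| <= A1].
  apply: (@near_box s0 t0 (fun z => [/\ c <= `|Ps z|, `|Pss z| <= M, `|a z| <= A & `|as_ z| <= A1])).
  have h1 := near_norm_gt cPs Ps0.
  have h2 := near_bounded (s0, t0) cPss.
  have h3 := near_bounded (s0, t0) ca.
  have h4 := near_bounded (s0, t0) cas.
  near=> z; split; [near: z; exact: h1|near: z; exact: h2|near: z; exact: h3|near: z; exact: h4].
have A0 : 0 <= A by rewrite addr_ge0.
have A10 : 0 <= A1 by rewrite addr_ge0.
have M0 : 0 <= M by rewrite addr_ge0.
pose B := 2 * A / c + (A1 / c + A * M / c ^+ 2) * (2 * d).
have B0 : 0 <= B by rewrite /B; nneg.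
exists d, (B * (2 * d)); split => //; first by nneg.
move=> l r m n k l1 lr r1 m1 mn n1 k0.
have cF : continuous (fun z => a (z.2, z.1) * cos (k * P (z.2, z.1) + w)).
  have h1 := continuous_swap ca; have h2 := continuous_swap cP.
  by move=> z; apply: cts_mul; [exact: h1|apply: cts_cos; apply: cts_add; [apply: cts_mul; [exact: cts_cst|exact: h2]|exact: cts_cst]].
apply: (le_trans (@itg_norm_le _ m n _ (B / k) mn _ _)).
- apply: continuous_cton.
  exact: (@itg_cont _ _ l r (fun z => a (z.2, z.1) * cos (k * P (z.2, z.1) + w))).
- move=> t /andP[mt tn].
  have box x : l <= x <= r -> [/\ c <= `|Ps (x, t)|, `|Pss (x, t)| <= M, `|a (x, t)| <= A & `|as_ (x, t)| <= A1].
    by move=> /andP[lx xr]; apply: Hd; rewrite ler_norml; apply/andP; split; lra.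
  apply: le_trans (@osc_nonstat _ (fun x => P (x, t)) (fun x => Ps (x, t)) (fun x => Pss (x, t))
    (fun x => a (x, t)) (fun x => as_ (x, t)) _ _ _ _ _ l r k w c M A A1 lr k0 c0 _ _ _ _) _.
  + by move=> x; have [] := dP x t.
  + by move=> x; have [] := dP x t.
  + exact: continuous_slice2.
  + exact: continuous_slice2.
  + by move=> x /box[].
  + by move=> x /box[].
  + by move=> x /box[].
  + by move=> x /box[].
  + rewrite ler_pM2r ?invr_gt0// /B lerD2l; apply: ler_wpM2l; first by nneg.
    lra.
- rewrite mulrAC ler_pM2r ?invr_gt0//; apply: ler_wpM2l => //; lra.
Unshelve. all: by end_near. Qed.

Lemma smooth_phase_swap P Ps Pss Pa Paa : smooth_phase P Ps Pss Pa Paa ->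
  smooth_phase (fun z => P (z.2, z.1)) (fun z => Pa (z.2, z.1)) (fun z => Paa (z.2, z.1))
    (fun z => Ps (z.2, z.1)) (fun z => Pss (z.2, z.1)).
Proof.
move=> [cP [cPs cPss] [cPa cPaa] ds da]; split.
- exact: continuous_swap.
- by split; exact: continuous_swap.
- by split; exact: continuous_swap.
- by move=> s t; exact: da.
- by move=> s t; exact: ds.
Qed.

Lemma smooth_amplitude_swap a as_ aa : smooth_amplitude a as_ aa ->
  smooth_amplitude (fun z => a (z.2, z.1)) (fun z => aa (z.2, z.1)) (fun z => as_ (z.2, z.1)).
Proof.
move=> [ca cas caa ds da]; split.
- exact: continuous_swap.
- exact: continuous_swap.
- exact: continuous_swap.
- by move=> s t; exact: da.
- by move=> s t; exact: ds.
Qed.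

(** Here the average over [t] pays off: if only the [t]-derivative is nonzero, the order of
    integration is exchanged and the oscillation in [t] is used. *)
Lemma noncritical (P Ps Pss Pa Paa a as_ aa : R * R -> R) (w s0 t0 : R) :
  smooth_phase P Ps Pss Pa Paa -> smooth_amplitude a as_ aa ->
  Ps (s0, t0) != 0 \/ Pa (s0, t0) != 0 ->
  exists d C : R, [/\ 0 < d, 0 <= C &
  forall l r m n k : R, s0 - d <= l -> l <= r -> r <= s0 + d -> t0 - d <= m -> m <= n -> n <= t0 + d ->
    0 < k ->
  `|itg m n (fun t => itg l r (fun s => a (s, t) * cos (k * P (s, t) + w)))| <= C / k].
Proof.
move=> sP sa [Ps0|Pa0]; first exact: noncritical_s sP sa Ps0.
have [d [C [d0 C0 H]]] := noncritical_s w (smooth_phase_swap sP) (smooth_amplitude_swap sa)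
  (Pa0 : (fun z => Pa (z.2, z.1)) (t0, s0) != 0).
exists d, C; split => // l r m n k l1 lr r1 m1 mn n1 k0.
rewrite (@itg_swap _ (fun z => a (z.2, z.1) * cos (k * P (z.2, z.1) + w))); first exact: H.
have [cP _ _ _ _] := sP; have [ca _ _ _ _] := sa.
have h1 := continuous_swap ca; have h2 := continuous_swap cP.
by move=> z; apply: cts_mul; [exact: h1|apply: cts_cos; apply: cts_add; [apply: cts_mul; [exact: cts_cst|exact: h2]|exact: cts_cst]].
Qed.

(** Compactness of the segment at height [t0] gives one radius valid at all its points; the segment
    is then cut into pieces no longer than that radius. *)
Lemma noncritical_segment (P Ps Pss Pa Paa a as_ aa : R * R -> R) (w L0 R0 t0 : R) :
  smooth_phase P Ps Pss Pa Paa -> smooth_amplitude a as_ aa -> L0 <= R0 ->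
  (forall s, L0 <= s <= R0 -> Ps (s, t0) != 0 \/ Pa (s, t0) != 0) ->
  exists d C : R, [/\ 0 < d, 0 <= C & forall m n k : R, t0 - d <= m -> m <= n -> n <= t0 + d -> 0 < k ->
  `|itg m n (fun t => itg L0 R0 (fun s => a (s, t) * cos (k * P (s, t) + w)))| <= C / k].
Proof.
move=> sP sa LR Hnc.
have [cP _ _ _ _] := sP; have [ca _ _ _ _] := sa.
have cF k : continuous (fun z => a z * cos (k * P z + w)).
  by move=> z; apply: cts_mul; [exact: ca|apply: cts_cos; apply: cts_add; [apply: cts_mul; [exact: cts_cst|exact: cP]|exact: cts_cst]].
(* One index controls both the radius 1 / (i + 1) and the constant i + 1, so the covering form of
   compactness, which speaks of all large [i], yields both uniformly. *)
pose good (i : nat) (x : R) := forall l r m n k : R, x - i.+1%:R^-1 <= l -> l <= r -> r <= x + i.+1%:R^-1 ->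
  t0 - i.+1%:R^-1 <= m -> m <= n -> n <= t0 + i.+1%:R^-1 -> 0 < k ->
  `|itg m n (fun t => itg l r (fun s => a (s, t) * cos (k * P (s, t) + w)))| <= i.+1%:R / k.
have key (x : R) : L0 <= x <= R0 -> \forall x' \near x & i \near \oo, good i x'.
  move=> xLR.
  have [d [C [d0 C0 H]]] := noncritical w sP sa (Hnc x xLR).
  exists ([set x' | `|x - x'| < d / 2], [set i : nat | C <= i.+1%:R /\ i.+1%:R^-1 <= d / 2]) => /=.
    split; first by exists (d / 2) => //=; rewrite divr_gt0.
    have [N HN] : exists N : nat, C + (d / 2)^-1 <= N%:R.
      exact: nat_upper_bound.
    exists N => // i /= Ni.
    have d20 : 0 < (d / 2)^-1 by rewrite invr_gt0 divr_gt0.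
    have Ni' : N%:R <= i.+1%:R :> R by rewrite ler_nat (leq_trans Ni).
    split; first lra.
    rewrite -[leRHS]invrK lef_pV2 ?posrE//; lra.
  case=> x' i /= [xx' [Ci id]] l r m n k l1 lr r1 m1 mn n1 k0.
  move: xx'; rewrite ltr_norml => /andP[x1 x2].
  have HC : C / k <= i.+1%:R / k by rewrite ler_pM2r ?invr_gt0.
  apply: le_trans HC.
  move: id l1 r1 m1 n1; move: (i.+1%:R^-1) => z id l1 r1 m1 n1.
  by apply: (H l r m n k _ lr _ _ mn _ k0); lra.
have : \forall i \near \oo, `[L0, R0]%classic `<=` good i.
  have /compact_near_coveringP := @segment_compact R L0 R0.
  by apply => x /= xLR; apply: key; move: xLR; rewrite in_itv.
case=> i _ /(_ i (leqnn i)) Hi.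
have i0 : 0 < i.+1%:R^-1 :> R by rewrite invr_gt0.
(* Induction on the number [j] of pieces. *)
have step : forall j (l r m n k : R), L0 <= l -> l <= r -> r <= R0 -> r - l <= j%:R * i.+1%:R^-1 ->
  t0 - i.+1%:R^-1 <= m -> m <= n -> n <= t0 + i.+1%:R^-1 -> 0 < k ->
  `|itg m n (fun t => itg l r (fun s => a (s, t) * cos (k * P (s, t) + w)))| <= j%:R * i.+1%:R / k.
  elim=> [|j IH] l r m n k Ll lr rR rl m1 mn n1 k0.
    have -> : r = l by apply/eqP; rewrite eq_le lr andbT; move: rl; rewrite mul0r; lra.
    rewrite (@itg_ext _ m n _ (fun=> 0)); last by move=> t _; rewrite itgxx.
    by rewrite itg_cst// !mul0r normr0.
  pose p := Num.min r (l + i.+1%:R^-1).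
  have lp : l <= p by rewrite le_min lr lerDl ltW.
  have pr : p <= r by rewrite ge_min lexx.
  have pl : p <= l + i.+1%:R^-1 by rewrite ge_min lexx orbT.
  have rp : r - p <= j%:R * i.+1%:R^-1.
    have rl' : r - l <= j%:R * i.+1%:R^-1 + i.+1%:R^-1.
      by move: rl; rewrite -[j.+1]addn1 natrD mulrDl mul1r.
    rewrite /p /Num.min; case: ifP => _; first by rewrite subrr mulr_ge0// ltW.
    by rewrite opprD addrA lerBlDr.
  have c1 l' r' : continuous (fun t => itg l' r' (fun s => a (s, t) * cos (k * P (s, t) + w))).
    apply: (@itg_cont _ _ l' r' (fun z => a (z.2, z.1) * cos (k * P (z.2, z.1) + w))).
    exact: (continuous_swap (cF k)).
  rewrite (@itg_ext _ m n _ (fun t => itg l p (fun s => a (s, t) * cos (k * P (s, t) + w)) +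
     itg p r (fun s => a (s, t) * cos (k * P (s, t) + w)))); last first.
    by move=> t _; apply: itg_cat => //; apply: continuous_cton; exact: (@continuous_slice2 _ (fun z => a z * cos (k * P z + w)) t (cF k)).
  rewrite itg_add; [|exact/continuous_cton/c1..].
  rewrite (le_trans (ler_normD _ _))// -[j.+1]addn1 natrD !mulrDl mul1r addrC lerD//.
    by apply: IH => //; exact: le_trans lp.
  have lI : `[L0, R0]%classic l by rewrite /= in_itv/= Ll (le_trans lr).
  by apply: (Hi l lI l p) => //; rewrite lerBlDr lerDl ltW.
have [J HJ] : exists J : nat, (R0 - L0) * i.+1%:R <= J%:R.
  exact: nat_upper_bound.
exists i.+1%:R^-1, (J%:R * i.+1%:R); split => //.
move=> m n k m1 mn n1 k0; apply: step => //.
by rewrite ler_pdivlMr.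
Qed.

End Phase.

Section Critical.
Context {R : realType}.

Lemma near_norm_le (F : R * R -> R) (z : R * R) (b : R) : continuous F -> F z = 0 -> 0 < b ->
  \forall w \near z, `|F w| <= b.
Proof.
move=> cF Fz b0; have /cvgrPdist_le/(_ b b0) := cF z; apply: filterS => w.
by rewrite Fz sub0r normrN.
Qed.

Lemma near_ge_half (F : R * R -> R) (z : R * R) : continuous F -> 0 < F z ->
  \forall w \near z, F z / 2 <= F w.
Proof.
move=> cF F0; have F2 : 0 < F z / 2 by lra.
have /cvgrPdist_le/(_ _ F2) := cF z; apply: filterS => w.
by rewrite ler_norml => /andP[_ h]; lra.
Qed.

(** For each [t] near [t0] the phase vanishes to second order at some [s], so the sine part is at
    least [L / q] for all these [t] and integration over [t] loses nothing. The cosine part has the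
    same order 1 / q, but its amplitude vanishes at (s0, t0), so a small rectangle brings its
    constant below half of [L]. *)
Lemma critical_lower (P Ps Pss Pa Paa g1 g1s g2 g2s : R * R -> R) (s0 t0 e0 : R) :
  smooth_phase P Ps Pss Pa Paa ->
  continuous g1 -> continuous g1s -> continuous g2 -> continuous g2s ->
  (forall s t : R, is_derive s 1 (fun x => g1 (x, t)) (g1s (s, t))) ->
  (forall s t : R, is_derive s 1 (fun x => g2 (x, t)) (g2s (s, t))) ->
  Ps (s0, t0) = 0 -> 0 < Pss (s0, t0) ->
  (forall d : R, 0 < d -> exists h : R, 0 < h /\ forall t : R, `|t0 - t| <= h ->
     exists s : R, [/\ `|s0 - s| <= d, P (s, t) = 0 & Ps (s, t) = 0]) ->
  g1 (s0, t0) = 0 -> 0 < g2 (s0, t0) -> 0 < e0 ->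
  exists d h L K : R, [/\ 0 < d <= e0, 0 < h, 0 < L &
   forall q m n : R, K <= q -> 0 < q -> t0 - h <= m -> m <= n -> n <= t0 + h ->
   L * (n - m) / q <= itg m n (fun t => itg (s0 - d) (s0 + d)
     (fun s => g1 (s, t) * cos (q ^+ 2 * P (s, t)) + g2 (s, t) * sin (q ^+ 2 * P (s, t))))].
Proof.
move=> [cP [cPs cPss] _ dP _] cg1 cg1s cg2 cg2s dg1 dg2 Ps0 Pss0 zero g10 g20 e00.
pose F z := g2 z * Pss z - g2s z * Ps z.
have cF : continuous F by move=> z; rewrite /F; cts.
have F0 : 0 < F (s0, t0) by rewrite /F Ps0 mulr0 subr0 mulr_gt0.
set c := Pss (s0, t0) / 2; set C := `|Pss (s0, t0)| + 1.
set c3 := F (s0, t0) / 2; set G := `|g2 (s0, t0)| + 1; set A1 := `|g1s (s0, t0)| + 1.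
have c0 : 0 < c by rewrite /c; lra.
have c30 : 0 < c3 by rewrite /c3; lra.
have C0 : 0 < C by rewrite ltr_wpDl.
have A10 : 0 < A1 by rewrite ltr_wpDl.
pose T := Num.min 1 (2 / C).
have T0 : 0 < T by rewrite lt_min ltr01 divr_gt0.
have CT : C * T ^+ 2 <= 2.
  have T1 : T <= 1 by rewrite ge_min lexx.
  have T2 : T <= 2 / C by rewrite ge_min lexx orbT.
  apply: (@le_trans _ _ (C * T)); first by rewrite ler_pM2l// expr2 ler_piMr// ltW.
  by move: T2; rewrite ler_pdivlMr// mulrC.
pose L := c3 * c ^+ 2 * T ^+ 3 / (128 * C ^+ 2).
have L0 : 0 < L by rewrite divr_gt0// !mulr_gt0// ?exprn_gt0// mulr_gt0.
(* On an interval of length [2 * d], [osc_vdc] gives the constant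
   [b * (2 + 8 / c) + 4 * A1 * d / c]; the choices of [b] here and of [d] below make each summand at
   most [L / 4]. *)
pose b := L / (4 * (2 + 8 / c)).
have b0 : 0 < b by rewrite divr_gt0// mulr_gt0// addr_gt0// divr_gt0.
have [d1 [d10 Hd]] : exists d : R, 0 < d /\ forall x' y' : R, `|s0 - x'| <= d -> `|t0 - y'| <= d ->
    [/\ c <= Pss (x', y') <= C, 0 <= g2 (x', y') <= G, c3 <= F (x', y'),
        `|g1 (x', y')| <= b & `|g1s (x', y')| <= A1].
  apply: (@near_box _ s0 t0 (fun z => [/\ c <= Pss z <= C, 0 <= g2 z <= G, c3 <= F z,
      `|g1 z| <= b & `|g1s z| <= A1])).
  have h1 := near_ge_half cPss Pss0.
  have h2 := near_bounded (s0, t0) cPss.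
  have h3 := near_ge_half cg2 g20.
  have h4 := near_bounded (s0, t0) cg2.
  have h5 := near_ge_half cF F0.
  have h6 := near_norm_le cg1 g10 b0.
  have h7 := near_bounded (s0, t0) cg1s.
  near=> z; split.
  - apply/andP; split; first by near: z; exact: h1.
    by apply: (le_trans (ler_norm _)); near: z; exact: h2.
  - apply/andP; split; last by apply: (le_trans (ler_norm _)); near: z; exact: h4.
    by apply: (@le_trans _ _ (g2 (s0, t0) / 2)); [lra|near: z; exact: h3].
  - by near: z; exact: h5.
  - by near: z; exact: h6.
  - by near: z; exact: h7.
pose d := Num.min (Num.min d1 e0) (L * c / (16 * A1)).
have Lc0 : 0 < L * c / (16 * A1) by rewrite divr_gt0// mulr_gt0.
have d0 : 0 < d by rewrite !lt_min d10 e00.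
have dd1 : d <= d1 by rewrite !ge_min lexx.
have de0 : d <= e0 by rewrite !ge_min lexx orbT.
have dL : d <= L * c / (16 * A1) by rewrite !ge_min lexx !orbT.
have d20 : 0 < d / 2 by lra.
have [h [h0 Hz]] := zero _ d20.
(* The threshold [2 * T / d] ensures [T / q <= d / 2]; as the stationary point lies within [d / 2]
   of [s0], the point [s + T / q] stays in the interval. *)
exists d, (Num.min h d), (L / 2), (2 * T / d); split.
- by rewrite d0.
- by rewrite lt_min h0.
- lra.
move=> q m n Kq q0 m1 mn n1.
have hh : Num.min h d <= h by rewrite ge_min lexx.
have hd : Num.min h d <= d by rewrite ge_min lexx orbT.
set hm := Num.min h d in m1 n1 hh hd.
have Tqd : T / q <= d / 2.
  rewrite ler_pdivrMr//; move: Kq; rewrite ler_pdivrMr// => Kq; lra.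
have cI : continuous (fun z => g1 z * cos (q ^+ 2 * P z) + g2 z * sin (q ^+ 2 * P z)).
  by move=> z; cts.
have -> : L / 2 * (n - m) / q = itg m n (fun=> L / 2 / q) by rewrite itg_cst// mulrAC.
apply: itg_le.
- by move=> x _; exact: cts_cst.
- apply: continuous_cton.
  apply: (@itg_cont _ _ (s0 - d) (s0 + d) (fun z => g1 (z.2, z.1) * cos (q ^+ 2 * P (z.2, z.1)) +
     g2 (z.2, z.1) * sin (q ^+ 2 * P (z.2, z.1)))).
  exact: (continuous_swap cI).
move=> t /andP[mt tn].
have [s [ss Pst Psst]] : exists s : R, [/\ `|s0 - s| <= d / 2, P (s, t) = 0 & Ps (s, t) = 0].
  by apply: Hz; rewrite ler_norml; apply/andP; split; lra.
move: ss; rewrite ler_norml => /andP[ss1 ss2].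
have box (x : R) : s0 - d <= x <= s0 + d -> [/\ c <= Pss (x, t) <= C, 0 <= g2 (x, t) <= G, c3 <= F (x, t),
        `|g1 (x, t)| <= b & `|g1s (x, t)| <= A1].
  move=> x12; apply: Hd; first by apply: le_trans dd1; rewrite ler_distlC.
  by rewrite ler_norml; apply/andP; split; lra.
have cs (f : R * R -> R) : continuous f -> continuous (fun x : R => f (x, t)).
  by move=> cf; exact: continuous_slice2.
have cPt := cs _ cP; have cg1t := cs _ cg1; have cg2t := cs _ cg2.
rewrite itg_add; [|by apply: continuous_cton => x; cts..].
have sin_part : L / q <= itg (s0 - d) (s0 + d) (fun x => g2 (x, t) * sin (q ^+ 2 * P (x, t))).
  apply: (@osc_sin_lower _ (fun x => P (x, t)) (fun x => Ps (x, t)) (fun x => Pss (x, t))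
    (fun x => g2 (x, t)) (fun x => g2s (x, t)) s _ _ q c C c3 G T) => //.
  - by move=> x; have [] := dP x t.
  - by move=> x; have [] := dP x t.
  - exact: cs.
  - exact: cs.
  - lra.
  - lra.
  - by move=> x /box[].
  - by move=> x /box[].
  - by move=> x /box[].
have dd : s0 - d <= s0 + d by lra.
have cos_part : `|itg (s0 - d) (s0 + d) (fun x => g1 (x, t) * cos (q ^+ 2 * P (x, t)))| <= L / 2 / q.
  have -> : (fun x => g1 (x, t) * cos (q ^+ 2 * P (x, t))) =
      (fun x => g1 (x, t) * cos (q ^+ 2 * P (x, t) + 0)) by apply/funext => x; rewrite addr0.
  apply: le_trans (@osc_vdc _ (fun x => P (x, t)) (fun x => Ps (x, t)) (fun x => Pss (x, t))
    (fun x => g1 (x, t)) (fun x => g1s (x, t)) _ _ _ _ _ s _ _ q 0 c b A1 _ _ q0 c0 _ _ _ _) _ => //.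
  - by move=> x; have [] := dP x t.
  - by move=> x; have [] := dP x t.
  - exact: cs.
  - exact: cs.
  - lra.
  - lra.
  - by move=> x /box[/andP[]].
  - by move=> x /box[].
  - by move=> x /box[].
  rewrite ler_pM2r ?invr_gt0//.
  have -> : s0 + d - (s0 - d) = 2 * d by ring.
  have -> : 2 * b + 2 * (4 * b + A1 * (2 * d)) / c = b * (2 + 8 / c) + 4 * A1 * d / c.
    by field; rewrite gt_eqF.
  have -> : b * (2 + 8 / c) = L / 4.
    rewrite /b; field; rewrite gt_eqF//= gt_eqF//.
    by have := c0; lra.
  have : 4 * A1 * d / c <= L / 4; last lra.
  rewrite ler_pdivrMr//; move: dL; rewrite ler_pdivlMr; last by rewrite mulr_gt0.
  lra.
move: cos_part; rewrite ler_norml => /andP[cos_part _].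
have : L / q = L / 2 / q + L / 2 / q by field; rewrite gt_eqF.
lra.
Unshelve. all: by end_near. Qed.

End Critical.

(** * Algebra of the critical equations *)

Section Algebra.
Context {R : realType}.
Implicit Types e g C S X Y w k : R.

Lemma one_add_eC_gt0 e C S : 0 < e < 1 -> C ^+ 2 + S ^+ 2 = 1 -> 0 < 1 + e * C.
Proof.
move=> /andP[e0 e1] CS.
have C1 : C ^+ 2 <= 1 by rewrite -CS lerDl sqr_ge0.
have : -1 <= C by rewrite leNgt; apply/negP => h; nra.
nra.
Qed.

(* [U = (C + e, sqrt(1 - e^2) S)] and [W = (X - e, sqrt(1 - e^2) Y)]: at a critical
   point the unit vector [(U + W) / k] has the same component along [U'] as [U/|U|],
   hence it is [U/|U|] or, by the focal property, it points to the other focus. *)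
Lemma critical_collinear e g C S X Y w k : 0 < e < 1 -> g ^+ 2 != 1 ->
  C ^+ 2 + S ^+ 2 = 1 -> X ^+ 2 + Y ^+ 2 = g ^+ 2 ->
  0 < w -> w ^+ 2 = (X - e) ^+ 2 + (1 - e ^+ 2) * Y ^+ 2 ->
  k != 0 -> k ^+ 2 = (C + X) ^+ 2 + (1 - e ^+ 2) * (S + Y) ^+ 2 ->
  Y != 0 -> X != 0 -> 1 - e * X != 0 ->
  e * S * k = e ^+ 2 * S * C + X * S - (1 - e ^+ 2) * Y * C ->
  e * Y * (1 - e * X) * k = w * (- C * Y + (1 - e ^+ 2) * S * X - e ^+ 2 * X * Y) ->
  0 < k /\ exists t, [/\ 0 < t, X - e = t * (C + e) & Y = t * S].
Proof.
move=> e01 g1 CS XY w0 wE k0 kE Y0 X0 eX0 eq1 eq2.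
have u0 := one_add_eC_gt0 e01 CS.
have CS' : C ^+ 2 + (- S) ^+ 2 = 1 by rewrite sqrrN.
have /andP[e0 e1] := e01.
have e20 : 1 - e ^+ 2 != 0 by rewrite subr_eq0 eq_sym; apply/negP => /eqP; nra.
(* Squaring [eq1] and inserting the norm of [U + W] leaves a product of two linear conditions:
   [U + W] is parallel to [U], or to the vector from the other focus. *)
have prod : (e * (S + Y) + (C * Y - S * X)) * (e * (S + Y) - (C * Y - S * X)) = 0.
  apply: (mulfI e20); rewrite mulr0.
  have : (1 - e ^+ 2) * ((e * (S + Y) + (C * Y - S * X)) * (e * (S + Y) - (C * Y - S * X))) =
     (e ^+ 2 * S ^+ 2 * ((C + X) ^+ 2 + (1 - e ^+ 2) * (S + Y) ^+ 2) -
     (e ^+ 2 * S * C + X * S - (1 - e ^+ 2) * Y * C) ^+ 2) +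
     (1 - e ^+ 2) * e ^+ 2 * (S + Y) ^+ 2 * (1 - (C ^+ 2 + S ^+ 2)) by ring.
  by rewrite CS subrr mulr0 addr0 -kE -eq1 => ->; ring.
have S0 : S != 0.
  apply/negP => /eqP S0; move: prod; rewrite S0 add0r mul0r subr0.
  rewrite -mulrDl -mulrBl => /eqP; rewrite !mulf_eq0 (negbTE Y0) !orbF.
  move: CS; rewrite S0 expr0n addr0 => C1 /orP[/eqP h|/eqP h].
    have : C = - e by lra.
    by move=> Ce; move: C1; rewrite Ce sqrrN => h2; move: e20; rewrite h2 subrr eqxx.
  have : C = e by lra.
  by move=> Ce; move: C1; rewrite Ce => h2; move: e20; rewrite h2 subrr eqxx.
move/eqP: prod; rewrite mulf_eq0 => /orP[/eqP crA|/eqP crB].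
(* Here W = t U, so w = t (1 + e C) or its negative. The second sign contradicts [eq2]; the first
   gives t > 0. *)
- pose t := Y / S.
  have YE : Y = t * S by rewrite /t divfK.
  have XE : X - e = t * (C + e).
    apply: (mulIf S0); rewrite /t.
    have -> : Y / S * (C + e) * S = Y * (C + e) by field.
    by apply/eqP; rewrite -subr_eq0; apply/eqP; rewrite -[RHS]oppr0 -crA; ring.
  have XE' : X = e + t * (C + e) by rewrite -XE; ring.
  have kt : k = (1 + t) * (1 + e * C).
    apply: (mulfI (mulf_neq0 (lt0r_neq0 e0) S0)); rewrite eq1 YE XE'; ring.
  have wt : (w - t * (1 + e * C)) * (w + t * (1 + e * C)) = 0.
    have -> : (w - t * (1 + e * C)) * (w + t * (1 + e * C)) = w ^+ 2 - t ^+ 2 * (1 + e * C) ^+ 2 by ring.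
    rewrite wE XE YE.
    transitivity (t ^+ 2 * (1 - e ^+ 2) * (C ^+ 2 + S ^+ 2 - 1)); first by ring.
    by rewrite CS subrr mulr0.
  move/eqP: wt; rewrite mulf_eq0 => /orP[/eqP wt|/eqP wt].
    have t0 : 0 < t.
      have : 0 < t * (1 + e * C) by lra.
      by rewrite pmulr_lgt0.
    split; last by exists t.
    by rewrite kt mulr_gt0//; lra.
  exfalso.
  have : 2 * (e * Y * (1 - e * X) * k) = 0.
    have wt' : w = - (t * (1 + e * C)) by lra.
    have E : w * (- C * Y + (1 - e ^+ 2) * S * X - e ^+ 2 * X * Y) = - (e * Y * (1 - e * X) * k).
      by rewrite wt' kt XE' YE; ring.
    by rewrite mulr2n mulrDl mul1r {2}eq2 E subrr.
  move=> /eqP; apply/negP; have e_neq0 := lt0r_neq0 e0.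
  by rewrite !mulf_neq0// ?pnatr_eq0.
(* The other focus: (X + e, Y) = -m (C - e, S). Inserted in [eq2] this gives [eqZ], and squaring
   leaves 4 e X (1 - e^2) (g^2 - 1) = 0, which g^2 != 1 and X != 0 exclude. *)
- exfalso.
  pose m := - Y / S.
  have m0 : m != 0 by rewrite mulf_neq0 ?invr_eq0// oppr_eq0.
  have YE : Y = - (m * S) by rewrite /m divfK// opprK.
  have XE : X = (m - 1) * e - m * C.
    apply: (mulIf S0); have -> : ((m - 1) * e - m * C) * S = - e * S - (- (m * S)) * e + (- (m * S)) * C by ring.
    rewrite -YE; apply/eqP; rewrite -subr_eq0; apply/eqP; rewrite -crB; ring.
  have v0 : 0 < 1 - e * C.
    by have := @one_add_eC_gt0 e (- C) S e01; rewrite sqrrN mulrN; apply.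
  have km : k = (m - 1) * (1 - e * C).
    apply: (mulfI (mulf_neq0 (lt0r_neq0 e0) S0)); rewrite eq1 YE XE; ring.
  have m1 : m - 1 != 0.
    by apply: contra k0 => /eqP h; rewrite km h mul0r.
  pose Z := (1 - e ^+ 2) * m + e * (e + X).
  have eqZ : (1 - e * X) * Z = - w * (1 + e * X).
    apply: (mulfI (mulf_neq0 (mulf_neq0 (lt0r_neq0 e0) Y0) m1)).
    apply: (mulfI m0).
    have E1 : e * Y * (m - 1) * ((1 - e * X) * Z) = m * (e * Y * (1 - e * X) * k).
      have ZE : Z = m * (1 - e * C) by rewrite /Z XE; ring.
      by rewrite ZE km; ring.
    rewrite E1 eq2; rewrite /Z YE XE; ring.
  have ZZ : Z ^+ 2 = w ^+ 2 + 4 * e * X.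
    rewrite wE -[Y ^+ 2](_ : g ^+ 2 - X ^+ 2 = _); last by rewrite -XY; ring.
    have : m ^+ 2 * (C ^+ 2 + S ^+ 2) = m ^+ 2 by rewrite CS mulr1.
    have mC : m * C = (m - 1) * e - X by rewrite XE; ring.
    have -> : m ^+ 2 * (C ^+ 2 + S ^+ 2) = (m * C) ^+ 2 + (- (m * S)) ^+ 2 by ring.
    rewrite -YE mC.
    have -> : Y ^+ 2 = g ^+ 2 - X ^+ 2 by rewrite -XY; ring.
    move=> H; rewrite /Z.
    have -> : ((1 - e ^+ 2) * m + e * (e + X)) ^+ 2 =
      (1 - e ^+ 2) * (m ^+ 2 - (((m - 1) * e - X) ^+ 2 + (g ^+ 2 - X ^+ 2))) +
      ((1 - e ^+ 2) * (e ^+ 2 + 2 * e * X + g ^+ 2) + e ^+ 2 * (e + X) ^+ 2) by ring.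
    by rewrite H subrr mulr0 add0r; ring.
  have fin : 4 * e * X * ((1 - e ^+ 2) * (g ^+ 2 - 1)) = 0.
    have H : ((1 - e * X) * Z) ^+ 2 = (- w * (1 + e * X)) ^+ 2 by rewrite eqZ.
    move: H; rewrite !exprMn ZZ sqrrN => H.
    have -> : 4 * e * X * ((1 - e ^+ 2) * (g ^+ 2 - 1)) = 4 * e * X * (w ^+ 2 - (1 - e * X) ^+ 2).
      by rewrite wE -[Y ^+ 2](_ : g ^+ 2 - X ^+ 2 = _); [ring|rewrite -XY; ring].
    have -> : 4 * e * X * (w ^+ 2 - (1 - e * X) ^+ 2) =
      w ^+ 2 * (1 + e * X) ^+ 2 - (1 - e * X) ^+ 2 * (w ^+ 2 + 4 * e * X) by ring.
    by rewrite H subrr.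
  move/eqP: fin; apply/negP; have e_neq0 := lt0r_neq0 e0.
  by rewrite !mulf_neq0// ?subr_eq0// ?pnatr_eq0.
Qed.

(** A ray from a focus meets the ellipse once: the focal distance 1 + e C is affine in [C], so both
    it and [C + e] scale by [r], which gives (1 - e^2) (r - 1) = 0. *)
Lemma collinear_unique e C S C0 S0 r : 0 < e < 1 -> C ^+ 2 + S ^+ 2 = 1 -> C0 ^+ 2 + S0 ^+ 2 = 1 ->
  0 < r -> C + e = r * (C0 + e) -> S = r * S0 -> C = C0 /\ S = S0.
Proof.
move=> e01 CS CS0 r0 CE SE; have /andP[e0 e1] := e01.
have u0 := one_add_eC_gt0 e01 CS; have u1 := one_add_eC_gt0 e01 CS0.
have nE (c s : R) : c ^+ 2 + s ^+ 2 = 1 ->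
    (1 + e * c) ^+ 2 = (c + e) ^+ 2 + (1 - e ^+ 2) * s ^+ 2.
  move=> H; have -> : s ^+ 2 = 1 - c ^+ 2 by rewrite -H; ring.
  by ring.
have E : (1 + e * C) ^+ 2 = (r * (1 + e * C0)) ^+ 2.
  by rewrite (nE _ _ CS) exprMn (nE _ _ CS0) CE SE; ring.
have {}E : 1 + e * C = r * (1 + e * C0).
  by apply/eqP; rewrite -(@eqrXn2 _ 2)// ?E// ltW// mulr_gt0.
have r1 : r = 1.
  have : (1 - e ^+ 2) * (r - 1) = 0.
    have -> : (1 - e ^+ 2) * (r - 1) = (r * (1 + e * C0) - (1 + e * C)) - e * (r * (C0 + e) - (C + e)) by ring.
    by rewrite -E -CE !subrr mulr0 subrr.
  move/eqP; rewrite mulf_eq0 => /orP[/eqP|/eqP]; [nra|lra].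
by split; [move: CE; rewrite r1; lra|rewrite SE r1 mul1r].
Qed.

End Algebra.

Lemma sum4_le {R : realDomainType} (a b c k : R) : 0 <= a -> 0 <= b -> 0 <= c ->
  1 + a + b + c <= k -> [/\ 1 <= k, a <= k, b <= k & c <= k].
Proof. by move=> a0 b0 c0 H; split; lra. Qed.

Lemma le_of_norm4 {R : realDomainType} (a b c d w x y z : R) :
  `|a| <= x -> `|c| <= y -> `|d| <= z -> `|a + b + c + d| <= w -> b <= x + y + z + w.
Proof.
rewrite !ler_norml => /andP[h1 _] /andP[h2 _] /andP[h3 _] /andP[_ h4]; lra.
Qed.

Lemma cos_eq1_eq0 {R : realType} (x : R) : cos x = 1 -> `|x| < 2 * pi -> x = 0.
Proof.
wlog x0 : x / 0 <= x.
  move=> H; have [|/ltW] := leP 0 x; first exact: H.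
  by move=> x0 cx xpi; apply/eqP; rewrite -oppr_eq0; apply/eqP/H; rewrite ?cosN ?normrN// oppr_ge0.
rewrite ger0_norm// => cx xpi.
have s0 : sin (x / 2) = 0.
  apply/eqP; rewrite -sqrf_eq0; apply/eqP.
  have := cosD (x / 2) (x / 2); have := cos2Dsin2 (x / 2).
  by rewrite -splitr cx -!expr2; lra.
move: x0; rewrite le_eqVlt => /predU1P[->//|x0].
have : 0 < sin (x / 2) by apply: sin_gt0_pi; lra.
by rewrite s0 ltxx.
Qed.

(** * The phases of the ellipse and the exclusion of large frequencies *)

Section EllipsePhase.
Context {R : realType}.
Variables (e g : R).
Hypotheses (e01 : 0 < e < 1) (eg : e < g) (g1 : g ^+ 2 != 1).

(* In the notation of [critical_collinear], [sqW], [sqN] are the squared norms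
   of [W] and [U + W], where [|U| = 1 + e cos s]. *)
Definition sqW (t : R) : R := (g * cos t - e) ^+ 2 + (1 - e ^+ 2) * (g * sin t) ^+ 2.
Definition sqN (z : R * R) : R :=
  (cos z.1 + g * cos z.2) ^+ 2 + (1 - e ^+ 2) * (sin z.1 + g * sin z.2) ^+ 2.
Definition nN (z : R * R) : R := Num.sqrt (sqN z).
Definition nS (z : R * R) : R := 1 + e * cos z.1 + Num.sqrt (sqW z.2).

Let e0 : 0 < e. Proof. by case/andP: e01. Qed.
Let e1 : e < 1. Proof. by case/andP: e01. Qed.
Let g0 : 0 < g. Proof. exact: lt_trans e0 eg. Qed.
Let b0 : 0 < 1 - e ^+ 2. Proof. by have := e0; have := e1; nra. Qed.
Let CS (s : R) := cos2Dsin2 s.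

(** [W = 0] would force sin t = 0 and g cos t = e, hence g = e. *)
Lemma sqW_gt0 t : 0 < sqW t.
Proof.
rewrite lt_neqAle eq_sym; apply/andP; split; last first.
  by rewrite /sqW addr_ge0 ?sqr_ge0// mulr_ge0 ?sqr_ge0// ltW.
rewrite /sqW paddr_eq0 ?sqr_ge0//; last by rewrite mulr_ge0 ?sqr_ge0// ltW.
rewrite (mulf_eq0 (1 - e ^+ 2)) (gt_eqF b0) orFb !sqrf_eq0 (mulf_eq0 g) (gt_eqF g0) orFb.
apply/negP => /andP[/eqP h /eqP s0].
have := CS t; rewrite s0 expr0n addr0 => /eqP; rewrite sqrf_eq1 => /orP[|] /eqP c.
  by move: h; rewrite c => h; move: eg; lra.
by move: h; rewrite c => h; have := e0; have := g0; lra.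
Qed.

(** [U + W = 0] would make one unit vector equal to -g times another, hence g^2 = 1. *)
Lemma sqN_gt0 z : 0 < sqN z.
Proof.
rewrite lt_neqAle eq_sym; apply/andP; split; last first.
  by rewrite /sqN addr_ge0 ?sqr_ge0// mulr_ge0 ?sqr_ge0// ltW.
rewrite /sqN paddr_eq0 ?sqr_ge0//; last by rewrite mulr_ge0 ?sqr_ge0// ltW.
rewrite (mulf_eq0 (1 - e ^+ 2)) (gt_eqF b0) orFb !sqrf_eq0.
apply/negP => /andP[/eqP h /eqP s0].
have h1 : cos z.1 = - (g * cos z.2) by lra.
have h2 : sin z.1 = - (g * sin z.2) by lra.
have := CS z.1; rewrite h1 h2 !sqrrN !exprMn -mulrDr CS mulr1 => h3.
by move: g1; rewrite h3 eqxx.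
Qed.

Lemma nN_gt0 z : 0 < nN z.
Proof. by rewrite sqrtr_gt0 sqN_gt0. Qed.

Lemma sqr_nN z : nN z ^+ 2 = sqN z.
Proof. by rewrite sqr_sqrtr// ltW// sqN_gt0. Qed.

Let nW t := Num.sqrt (sqW t).
Let nW_gt0 t : 0 < nW t. Proof. by rewrite sqrtr_gt0 sqW_gt0. Qed.
Let sqr_nW t : nW t ^+ 2 = sqW t. Proof. by rewrite sqr_sqrtr// ltW// sqW_gt0. Qed.
Let nN0 z : nN z != 0. Proof. by rewrite gt_eqF// nN_gt0. Qed.
Let nW0 t : nW t != 0. Proof. by rewrite gt_eqF// nW_gt0. Qed.

(** Here and in the next five definitions: halves of the first and second derivatives of [sqN] and
    [sqW], so that the norm [nN] has [s]-derivative [qs / nN], and similarly for the others. *)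
Let qs (z : R * R) : R := - (cos z.1 + g * cos z.2) * sin z.1 +
  (1 - e ^+ 2) * (sin z.1 + g * sin z.2) * cos z.1.
Let qss (z : R * R) : R := sin z.1 ^+ 2 - (cos z.1 + g * cos z.2) * cos z.1 +
  (1 - e ^+ 2) * (cos z.1 ^+ 2 - (sin z.1 + g * sin z.2) * sin z.1).
Let qa (z : R * R) : R := - (cos z.1 + g * cos z.2) * (g * sin z.2) +
  (1 - e ^+ 2) * (sin z.1 + g * sin z.2) * (g * cos z.2).
Let qaa (z : R * R) : R := (g * sin z.2) ^+ 2 - (cos z.1 + g * cos z.2) * (g * cos z.2) +
  (1 - e ^+ 2) * ((g * cos z.2) ^+ 2 - (sin z.1 + g * sin z.2) * (g * sin z.2)).
Let w1 (t : R) : R := - (g * cos t - e) * (g * sin t) + (1 - e ^+ 2) * (g * sin t) * (g * cos t).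
Let w2 (t : R) : R := (g * sin t) ^+ 2 - (g * cos t - e) * (g * cos t) +
  (1 - e ^+ 2) * ((g * cos t) ^+ 2 - (g * sin t) ^+ 2).

Let dnN_s (s t : R) : is_derive s 1 (fun x => nN (x, t)) (qs (s, t) / nN (s, t)).
Proof.
have h := sqN_gt0 (s, t); have h0 := nN0 (s, t).
rewrite /nN /sqN /=; derive_with => //.
by rewrite -/(sqN (s, t)) -/(nN (s, t)) /qs /=; field.
Qed.

Let dnN_t (s t : R) : is_derive t 1 (fun x => nN (s, x)) (qa (s, t) / nN (s, t)).
Proof.
have h := sqN_gt0 (s, t); have h0 := nN0 (s, t).
rewrite /nN /sqN /=; derive_with => //.
by rewrite -/(sqN (s, t)) -/(nN (s, t)) /qa /=; field.
Qed.

Let dnW (t : R) : is_derive t 1 nW (w1 t / nW t).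
Proof.
have h := sqW_gt0 t; have h0 := nW0 t.
rewrite /nW /sqW /=; derive_with => //.
by rewrite -/(sqW t) -/(nW t) /w1 /=; field.
Qed.

(** Taken at c = 1 and c = -1, so that [S - N] and [S + N] share one treatment. *)
Definition phase (c : R) (z : R * R) : R := nS z - c * nN z.
Let phs c z := - (e * sin z.1) - c * (qs z / nN z).
Let phss c z := - (e * cos z.1) - c * (qss z / nN z - qs z ^+ 2 / nN z ^+ 3).
Let pha c z := w1 z.2 / nW z.2 - c * (qa z / nN z).
Let phaa c z := (w2 z.2 / nW z.2 - w1 z.2 ^+ 2 / nW z.2 ^+ 3) -
  c * (qaa z / nN z - qa z ^+ 2 / nN z ^+ 3).

Lemma continuous_nN : continuous nN.
Proof. by move=> z; rewrite /nN /sqN; cts. Qed.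
Let cnW : continuous nW.
Proof. by move=> z; rewrite /nW /sqW; cts. Qed.
Lemma continuous_nS : continuous nS.
Proof. by move=> z; rewrite /nS /sqW; cts. Qed.
Let cqs : continuous qs. Proof. by move=> z; rewrite /qs; cts. Qed.
Let cqss : continuous qss. Proof. by move=> z; rewrite /qss; cts. Qed.
Let cqa : continuous qa. Proof. by move=> z; rewrite /qa; cts. Qed.
Let cqaa : continuous qaa. Proof. by move=> z; rewrite /qaa; cts. Qed.
Let cw1 : continuous w1. Proof. by move=> z; rewrite /w1; cts. Qed.
Let cw2 : continuous w2. Proof. by move=> z; rewrite /w2; cts. Qed.

Let smooth c : smooth_phase (phase c) (phs c) (phss c) (pha c) (phaa c).
Proof.
have cN := continuous_nN; have cS := continuous_nS.
split.
- by move=> z; rewrite /phase; cts.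
- split => z; rewrite /phs /phss; have h := nN0 z; have h3 := expf_neq0 3 h; cts.
- split => z; rewrite /pha /phaa; have h := nN0 z; have h3 := expf_neq0 3 h;
  have k := nW0 z.2; have k3 := expf_neq0 3 k; cts.
- move=> s t; have h := dnN_s s t; have h0 := nN0 (s, t); split.
    by rewrite /phase /nS /=; derive_with; rewrite /phs /=; field.
  rewrite /phs /qs /=; derive_with => //.
  by rewrite /phss /qs /qss /=; field.
- move=> s t; have h := dnN_t s t; have h0 := nN0 (s, t).
  have k := dnW t; have k0 := nW0 t; split.
    by rewrite /phase /nS /= -/(nW _); derive_with; rewrite /pha /=; field; rewrite h0.
  rewrite /pha /w1 /qa /=; derive_with => //.
  by rewrite /phaa /w1 /w2 /qa /qaa /=; field; rewrite h0.
Qed.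

Let dinv (f : R -> R) (f' x : R) : f x != 0 -> 0 < f x -> is_derive x 1 f f' ->
  is_derive x 1 (fun y => (f y * Num.sqrt (f y))^-1) (- (3 / 2) * f' / (f x ^+ 2 * Num.sqrt (f x))).
Proof.
move=> fx0 fxp df; have s0 : Num.sqrt (f x) != 0 by rewrite gt_eqF// sqrtr_gt0.
derive_with => //; first by rewrite mulf_neq0.
have E : f x = Num.sqrt (f x) ^+ 2 by rewrite sqr_sqrtr// ltW.
by move: E s0; move: (Num.sqrt (f x)) => r -> r0; field.
Qed.

(** N^(-3/2) is the decay of [bes (k * nN)] with the power of [k] removed. *)
Definition amp (f : R -> R) (z : R * R) : R := f z.1 / (nN z * Num.sqrt (nN z)).
Let amps (f f' : R -> R) (z : R * R) : R := f' z.1 / (nN z * Num.sqrt (nN z)) +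
  f z.1 * (- (3 / 2) * (qs z / nN z) / (nN z ^+ 2 * Num.sqrt (nN z))).
Let ampa (f : R -> R) (z : R * R) : R :=
  f z.1 * (- (3 / 2) * (qa z / nN z) / (nN z ^+ 2 * Num.sqrt (nN z))).

Let smooth_amp (f f' : R -> R) : (forall x : R, is_derive x 1 f (f' x)) -> continuous f' ->
  smooth_amplitude (amp f) (amps f f') (ampa f).
Proof.
move=> df cf'.
have cf : continuous f by move=> x; exact: (is_derive_continuous (df x)).
have cN := continuous_nN.
have nz z : nN z * Num.sqrt (nN z) != 0 by rewrite mulf_neq0// gt_eqF// sqrtr_gt0 nN_gt0.
have nz2 z : nN z ^+ 2 * Num.sqrt (nN z) != 0.
  by rewrite mulf_neq0 ?expf_neq0// gt_eqF// sqrtr_gt0 nN_gt0.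
split.
- by move=> z; have h := nz z; rewrite /amp; cts.
- by move=> z; have h := nz z; have h2 := nz2 z; have h3 := nN0 z; rewrite /amps; cts.
- by move=> z; have h2 := nz2 z; have h3 := nN0 z; rewrite /ampa; cts.
- move=> s t; have h := @dinv (fun x => nN (x, t)) _ s (nN0 (s, t)) (nN_gt0 (s, t)) (dnN_s s t); have k := df s.
  by rewrite /amp /amps /=; derive_with.
- move=> s t; have h := @dinv (fun x => nN (s, x)) _ t (nN0 (s, t)) (nN_gt0 (s, t)) (dnN_t s t).
  by rewrite /amp /ampa /=; derive_with; rewrite mul0r add0r.
Qed.

(** Clearing denominators with [c * nN] and using c^2 = 1 brings both equations to the form of
    [critical_collinear] with c N as its [k]. The sign it gives, c N > 0, rules out common critical
    points of [S + N]. *)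
Let noncrit c s t : c ^+ 2 = 1 -> sin t != 0 -> cos t != 0 -> e * g * cos t != 1 ->
  phs c (s, t) = 0 -> pha c (s, t) = 0 ->
  0 < c /\ exists r, [/\ 0 < r, g * cos t - e = r * (cos s + e) & g * sin t = r * sin s].
Proof.
move=> c1 st ct ect hs ha.
have N0 := nN0 (s, t); have W0 := nW0 t.
have c0 : c != 0 by apply/negP => /eqP h; move: c1; rewrite h expr0n => /eqP; rewrite eq_sym oner_eq0.
have [k0 [r [r0 h1 h2]]] : 0 < c * nN (s, t) /\
    exists r, [/\ 0 < r, g * cos t - e = r * (cos s + e) & g * sin t = r * sin s].
  apply: (@critical_collinear _ e g (cos s) (sin s) (g * cos t) (g * sin t) (nW t) (c * nN (s, t))) => //.
  - by rewrite !exprMn -mulrDr CS mulr1.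
  - by rewrite mulf_neq0.
  - by rewrite exprMn c1 mul1r sqr_nN.
  - by rewrite mulf_neq0// gt_eqF.
  - by rewrite mulf_neq0// gt_eqF.
  - by rewrite subr_eq0 eq_sym mulrA.
  - have : phs c (s, t) * (c * nN (s, t)) = 0 by rewrite hs mul0r.
    have -> : phs c (s, t) * (c * nN (s, t)) = - (e * sin s * (c * nN (s, t))) - c ^+ 2 * qs (s, t).
      by rewrite /phs /=; field.
    rewrite c1 mul1r => H; have -> : e * sin s * (c * nN (s, t)) = - qs (s, t) by lra.
    by rewrite /qs /=; ring.
  - have : pha c (s, t) * (c * nN (s, t) * nW t) = 0 by rewrite ha mul0r.
    have -> : pha c (s, t) * (c * nN (s, t) * nW t) = w1 t * (c * nN (s, t)) - c ^+ 2 * (nW t * qa (s, t)).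
      by rewrite /pha /=; field; rewrite ?N0 ?W0.
    rewrite c1 mul1r => H; have E : w1 t * (c * nN (s, t)) = nW t * qa (s, t) by lra.
    transitivity (w1 t * (c * nN (s, t))); first by rewrite /w1; ring.
    by rewrite E /qa /=; ring.
split; last by exists r.
by move: k0; rewrite pmulr_lgt0// nN_gt0.
Qed.

(* Cross and dot products of [U] and [W], the former up to a constant factor. *)
Let cr (z : R * R) : R := (cos z.1 + e) * (g * sin z.2) - sin z.1 * (g * cos z.2 - e).
Let dot (z : R * R) : R := (cos z.1 + e) * (g * cos z.2 - e) + (1 - e ^+ 2) * (sin z.1 * (g * sin z.2)).

Let nU_gt0 s : 0 < 1 + e * cos s. Proof. exact: (one_add_eC_gt0 e01 (CS s)). Qed.

Let sqU s : (1 + e * cos s) ^+ 2 = (cos s + e) ^+ 2 + (1 - e ^+ 2) * sin s ^+ 2.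
Proof.
have -> : sin s ^+ 2 = 1 - cos s ^+ 2 by rewrite -(CS s); ring.
by ring.
Qed.

(** Lagrange's identity; through it the triangle inequality for [U] and [W] and its equality case
    are read off from [cr] and [dot]. *)
Let lagrange s t : ((1 + e * cos s) * nW t) ^+ 2 = dot (s, t) ^+ 2 + (1 - e ^+ 2) * cr (s, t) ^+ 2.
Proof. by rewrite exprMn sqr_nW sqU /dot /cr /sqW /=; ring. Qed.

Let sqN_dot s t : sqN (s, t) = (1 + e * cos s) ^+ 2 + nW t ^+ 2 + 2 * dot (s, t).
Proof. by rewrite sqr_nW sqU /sqN /dot /sqW /=; ring. Qed.

Let phase_ge0 s t : 0 <= phase 1 (s, t).
Proof.
rewrite /phase mul1r subr_ge0 /nS /= -/(nW t).
have U := nU_gt0 s; have W := nW_gt0 t.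
rewrite -(@ler_pXn2r _ 2) ?nnegrE//; [|exact/ltW/nN_gt0|by rewrite addr_ge0// ltW].
rewrite sqr_nN sqN_dot.
have : dot (s, t) <= (1 + e * cos s) * nW t.
  apply: (le_trans (ler_norm _)); rewrite -(@ler_pXn2r _ 2) ?nnegrE//; last by rewrite mulr_ge0// ltW.
  by rewrite real_normK ?num_real// lagrange lerDl mulr_ge0 ?sqr_ge0// ltW.
by move: (1 + _) (nW _) (dot _) => u w d; lra.
Qed.

Let phase_eq0 s t : cr (s, t) = 0 -> 0 < dot (s, t) -> phase 1 (s, t) = 0.
Proof.
move=> c0 d0; rewrite /phase mul1r /nS /= -/(nW t).
have U := nU_gt0 s; have W := nW_gt0 t.
have E : (1 + e * cos s) * nW t = dot (s, t).
  apply/eqP; rewrite -(@eqrXn2 _ 2)//; [|by rewrite mulr_ge0// ltW|exact: ltW].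
  by rewrite lagrange c0 expr0n mulr0 addr0.
apply/eqP; rewrite subr_eq0 -(@eqrXn2 _ 2)//; [|by rewrite addr_ge0// ltW|exact/ltW/nN_gt0].
by rewrite sqr_nN sqN_dot -E; apply/eqP; ring.
Qed.

(** By the triangle inequality [phase 1] is nonnegative, so a zero is a minimum in [s]. *)
Let phs_eq0 s t : phase 1 (s, t) = 0 -> phs 1 (s, t) = 0.
Proof.
move=> p0; have [_ _ _ ds _] := smooth 1.
have [d1 _] := ds s t.
have s1 : s - 1 < s + 1 by lra.
have sI : s \in `]s - 1, s + 1[ by rewrite in_itv/=; apply/andP; split; lra.
have d2 : is_derive s 1 (fun x => phase 1 (x, t)) 0.
  have dp (x : R) : x \in `]s - 1, s + 1[ -> derivable (fun x => phase 1 (x, t)) x 1.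
    by move=> _; have [[]] := ds x t.
  have mp (x : R) : x \in `]s - 1, s + 1[ -> phase 1 (s, t) <= phase 1 (x, t).
    by move=> _; rewrite p0 phase_ge0.
  exact: (@derive1_at_min R (fun x => phase 1 (x, t)) _ _ _ (ltW s1) dp sI mp).
by rewrite -(@derive_val _ _ _ _ _ _ _ d1) (@derive_val _ _ _ _ _ _ _ d2).
Qed.

Lemma cos_sub_pihalf (x : R) : cos (x + - (pi / 2)) = sin x.
Proof. by rewrite cosB cos_pihalf sin_pihalf mulr0 mulr1 add0r. Qed.

Let noncrit_pair (c L0 R0 t0 : R) (f1 f1' f2 f2' : R -> R) :
  (forall x : R, is_derive x 1 f1 (f1' x)) -> continuous f1' ->
  (forall x : R, is_derive x 1 f2 (f2' x)) -> continuous f2' ->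
  L0 <= R0 ->
  (forall s, L0 <= s <= R0 -> phs c (s, t0) != 0 \/ pha c (s, t0) != 0) ->
  exists d C : R, [/\ 0 < d, 0 <= C & forall m n k : R, t0 - d <= m -> m <= n -> n <= t0 + d -> 0 < k ->
  `|itg m n (fun t => itg L0 R0 (fun s => amp f1 (s, t) * cos (k * phase c (s, t)) +
      amp f2 (s, t) * sin (k * phase c (s, t))))| <= C / k].
Proof.
move=> d1 c1 d2 c2 LR nc.
have [da [Ca [da0 Ca0 Ha]]] := noncritical_segment 0 (smooth c) (smooth_amp d1 c1) LR nc.
have [db [Cb [db0 Cb0 Hb]]] := noncritical_segment (- (pi / 2)) (smooth c) (smooth_amp d2 c2) LR nc.
have [cP _ _ _ _] := smooth c.
have [ca _ _ _ _] := smooth_amp d1 c1.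
have [cb _ _ _ _] := smooth_amp d2 c2.
exists (Num.min da db), (Ca + Cb); split.
- by rewrite lt_min da0.
- by rewrite addr_ge0.
move=> m n k; set d := Num.min da db => m1 mn n1 k0.
have dda : d <= da by rewrite ge_min lexx.
have ddb : d <= db by rewrite ge_min lexx orbT.
have cA : continuous (fun z => amp f1 z * cos (k * phase c z + 0)) by move=> z; cts.
have cB : continuous (fun z => amp f2 z * cos (k * phase c z + - (pi / 2))) by move=> z; cts.
rewrite (@itg_ext _ m n _ (fun t => itg L0 R0 (fun s => amp f1 (s, t) * cos (k * phase c (s, t) + 0)) +
   itg L0 R0 (fun s => amp f2 (s, t) * cos (k * phase c (s, t) + - (pi / 2))))); last first.
  move=> t _; rewrite -itg_add.
  - by apply: itg_ext => x _; rewrite addr0 cos_sub_pihalf.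
  - exact: continuous_cton (@continuous_slice2 _ _ t cA).
  - exact: continuous_cton (@continuous_slice2 _ _ t cB).
rewrite itg_add.
- have -> : (Ca + Cb) / k = Ca / k + Cb / k by rewrite mulrDl.
  apply: (le_trans (ler_normD _ _)); apply: lerD.
    by apply: Ha => //; lra.
  by apply: Hb => //; lra.
- exact: continuous_cton (@itg_cont _ _ L0 R0 _ (continuous_swap cA)).
- exact: continuous_cton (@itg_cont _ _ L0 R0 _ (continuous_swap cB)).
Qed.

(** The intermediate value theorem for the cross product [cr]: its [s]-derivative at (s0, t0) is -r
    (1 + e cos s0) < 0, so it changes sign across [s0] for all nearby [t]. Positivity of [dot]
    selects equal rather than opposite directions, where the triangle inequality is an equality. *)
Let zero_curve s0 t0 r d : 0 < r -> g * cos t0 - e = r * (cos s0 + e) -> g * sin t0 = r * sin s0 ->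
  0 < d -> exists h : R, 0 < h /\ forall t : R, `|t0 - t| <= h ->
  exists s : R, [/\ `|s0 - s| <= d, phase 1 (s, t) = 0 & phs 1 (s, t) = 0].
Proof.
move=> r0 hX hY d0.
pose dcr (z : R * R) : R := sin z.1 * (g * sin z.2) + cos z.1 * (g * cos z.2 - e).
have ccr : continuous cr by move=> z; rewrite /cr; cts.
have cdcr : continuous dcr by move=> z; rewrite /dcr; cts.
have cdot : continuous dot by move=> z; rewrite /dot; cts.
have dcrP (s t : R) : is_derive s 1 (fun x => - cr (x, t)) (dcr (s, t)).
  by rewrite /cr /=; derive_with; rewrite /dcr /=; ring.
have dcr0 : 0 < dcr (s0, t0).
  rewrite /dcr /= hX hY (_ : _ + _ = r * (cos s0 ^+ 2 + sin s0 ^+ 2 + e * cos s0)); last by ring.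
  by rewrite CS mulr_gt0// nU_gt0.
have dot0 : 0 < dot (s0, t0).
  rewrite /dot /= hX hY (_ : _ + _ = r * ((cos s0 + e) ^+ 2 + (1 - e ^+ 2) * sin s0 ^+ 2)); last by ring.
  by rewrite -sqU mulr_gt0// exprn_gt0// nU_gt0.
have cr0 : cr (s0, t0) = 0 by rewrite /cr /= hX hY; ring.
have [d1 [d10 H1]] : exists d : R, 0 < d /\ forall x' y' : R, `|s0 - x'| <= d -> `|t0 - y'| <= d ->
    dcr (s0, t0) / 2 <= dcr (x', y') /\ dot (s0, t0) / 2 <= dot (x', y').
  apply: (@near_box _ s0 t0 (fun z => dcr (s0, t0) / 2 <= dcr z /\ dot (s0, t0) / 2 <= dot z)).
  have h1 := near_ge_half cdcr dcr0.
  have h2 := near_ge_half cdot dot0.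
  by near=> z; split; [near: z; exact: h1|near: z; exact: h2].
pose d' := Num.min d d1.
have d'0 : 0 < d' by rewrite lt_min d0.
have d'd : d' <= d by rewrite ge_min lexx.
have d'd1 : d' <= d1 by rewrite ge_min lexx orbT.
have crL : 0 < cr (s0 - d', t0).
  have sd : s0 - d' <= s0 by lra.
  have := @derive_ge_lin _ (fun x => - cr (x, t0)) (fun x => dcr (x, t0)) (dcr (s0, t0) / 2) _ _ sd.
  rewrite cr0 oppr0 opprK add0r => H.
  apply: lt_le_trans (H _ _).
  - by rewrite mulr_gt0//; lra.
  - move=> x /andP[x1 x2]; apply: (proj1 (H1 _ _ _ _)); last by rewrite subrr normr0 ltW.
    rewrite ler_norml; apply/andP; split; lra.
have crR : cr (s0 + d', t0) < 0.
  have sd : s0 <= s0 + d' by lra.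
  have := @derive_ge_lin _ (fun x => - cr (x, t0)) (fun x => dcr (x, t0)) (dcr (s0, t0) / 2) _ _ sd.
  rewrite cr0 oppr0 subr0 -oppr_gt0 => H.
  apply: lt_le_trans (H _ _).
  - by rewrite mulr_gt0//; lra.
  - move=> x /andP[x1 x2]; apply: (proj1 (H1 _ _ _ _)); last by rewrite subrr normr0 ltW.
    rewrite ler_norml; apply/andP; split; lra.
have cL : continuous (fun z : R * R => cr (s0 - d', z.2)) by move=> z; cts.
have cR : continuous (fun z : R * R => - cr (s0 + d', z.2)) by move=> z; cts.
have [h [h0 Hh]] : exists d : R, 0 < d /\ forall x' y' : R, `|s0 - x'| <= d -> `|t0 - y'| <= d ->
    cr (s0 - d', t0) / 2 <= cr (s0 - d', y') /\ - cr (s0 + d', t0) / 2 <= - cr (s0 + d', y').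
  apply: (@near_box _ s0 t0 (fun z => cr (s0 - d', t0) / 2 <= cr (s0 - d', z.2) /\
     - cr (s0 + d', t0) / 2 <= - cr (s0 + d', z.2))).
  have h1 := @near_ge_half _ _ (s0, t0) cL crL.
  have crR' : 0 < - cr (s0 + d', t0) by rewrite oppr_gt0.
  have h2 := @near_ge_half _ _ (s0, t0) cR crR'.
  by near=> z; split; [near: z; exact: h1|near: z; exact: h2].
exists (Num.min h d1); split; first by rewrite lt_min h0.
move=> t th.
have th' : `|t0 - t| <= h by apply: (le_trans th); rewrite ge_min lexx.
have td1 : `|t0 - t| <= d1 by apply: (le_trans th); rewrite ge_min lexx orbT.
have [|a1 a2] := Hh s0 t _ th'; first by rewrite subrr normr0 ltW.
have sd : s0 - d' <= s0 + d' by lra.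
have cw : {within `[s0 - d', s0 + d'], continuous (fun x => cr (x, t))}.
  exact: cton_within (continuous_cton (@continuous_slice2 _ _ t ccr)).
have [|s sI sE] := @IVT R (fun x => cr (x, t)) _ _ 0 sd cw.
  rewrite ge_min le_max; apply/andP; split; apply/orP; [right|left]; lra.
move: sI; rewrite in_itv/= => /andP[s1 s2].
have ss : `|s0 - s| <= d' by rewrite ler_norml; apply/andP; split; lra.
have dots : 0 < dot (s, t).
  have [_] := H1 s t (le_trans ss d'd1) td1; lra.
have p0 := phase_eq0 sE dots.
by exists s; split; [exact: le_trans ss d'd|exact: p0|exact: phs_eq0].
Unshelve. all: by end_near. Qed.

(** At W = r U the norm is N = (1 + r) (1 + e cos s0), and the second derivative reduces to (1 -
    e^2) r / N. *)
Let critical_data s0 t0 r : 0 < r -> g * cos t0 - e = r * (cos s0 + e) -> g * sin t0 = r * sin s0 ->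
  phs 1 (s0, t0) = 0 /\ 0 < phss 1 (s0, t0).
Proof.
move=> r0 hX hY; have U := nU_gt0 s0.
have X : g * cos t0 = e + r * (cos s0 + e) by rewrite -hX; ring.
have qsE : qs (s0, t0) = - (e * sin s0) * ((1 + r) * (1 + e * cos s0)).
  by rewrite /qs /= X hY; ring.
have NE : nN (s0, t0) = (1 + r) * (1 + e * cos s0).
  apply/eqP; rewrite -(@eqrXn2 _ 2)//; [|exact/ltW/nN_gt0|by rewrite mulr_ge0// ltW// addr_gt0].
  rewrite sqr_nN exprMn sqU /sqN /= X hY; apply/eqP; ring.
have N0 := nN0 (s0, t0).
have p0 : phs 1 (s0, t0) = 0.
  by rewrite /phs /= qsE -NE mul1r mulfK// opprK addNr.
split=> //.
have -> : phss 1 (s0, t0) = (1 - e ^+ 2) * r / nN (s0, t0).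
  apply: (mulIf N0); rewrite divfK//.
  have -> : phss 1 (s0, t0) * nN (s0, t0) =
     - (e * cos s0) * nN (s0, t0) - qss (s0, t0) + (qs (s0, t0) / nN (s0, t0)) ^+ 2.
    by rewrite /phss /=; field.
  rewrite qsE -NE mulfK// NE /qss /= X hY.
  have -> : sin s0 ^+ 2 - (cos s0 + (e + r * (cos s0 + e))) * cos s0 +
    (1 - e ^+ 2) * (cos s0 ^+ 2 - (sin s0 + r * sin s0) * sin s0) =
    e ^+ 2 * sin s0 ^+ 2 - e ^+ 2 * cos s0 ^+ 2 - e * cos s0 - r * (cos s0 ^+ 2 + sin s0 ^+ 2 + e * cos s0)
    + e ^+ 2 * r * sin s0 ^+ 2 by ring.
  rewrite CS.
  have -> : sin s0 ^+ 2 = 1 - cos s0 ^+ 2 by rewrite -(CS s0); ring.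
  have -> : (- (e * sin s0)) ^+ 2 = e ^+ 2 * (1 - cos s0 ^+ 2).
    by rewrite -(CS s0); ring.
  ring.
by rewrite divr_gt0 ?mulr_gt0// nN_gt0.
Qed.

(** Multiplying the oscillation in [k * nS] by the leading Bessel term produces the phases [S - N]
    and [S + N]. *)
Let two_mul_prod (A B p r x y : R) :
  2 * ((p * cos x + r * sin x) * (A * cos y + B * sin y)) =
  ((A * p + B * r) * cos (x - y) + (A * r - B * p) * sin (x - y)) +
  ((A * p - B * r) * cos (x + y) + (A * r + B * p) * sin (x + y)).
Proof. rewrite cosB sinB cosD sinD; ring. Qed.

(** After multiplication by 2 k^(3/2) the vanishing integral is, up to O(1 / k), a sum of parts with
    phases [S - N] and [S + N]. Averaged over [t], all parts are O(1 / k) except the one around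
    [s0], which is at least a constant times k^(-1/2). *)
Lemma no_large_wavenumber (fr fr' fi fi' : R -> R) (A B M s0 t0 r : R) :
  (forall x : R, is_derive x 1 fr (fr' x)) -> continuous fr' ->
  (forall x : R, is_derive x 1 fi (fi' x)) -> continuous fi' ->
  0 <= M -> (forall x : R, 1 <= x -> `|x * Num.sqrt x * bes x - (A * cos x + B * sin x)| <= M / x) ->
  - pi < s0 < pi -> 0 < r -> g * cos t0 - e = r * (cos s0 + e) -> g * sin t0 = r * sin s0 ->
  sin t0 != 0 -> cos t0 != 0 -> e * g * cos t0 != 1 ->
  A * fr s0 + B * fi s0 = 0 -> 0 < A * fi s0 - B * fr s0 ->
  exists K : R, forall k : R, K <= k -> 0 < k ->
  ~ (forall t : R, itg (- pi) pi (fun s =>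
      (fr s * cos (k * nS (s, t)) + fi s * sin (k * nS (s, t))) * bes (k * nN (s, t))) = 0).
Proof.
move=> dfr cfr' dfi cfi' M0 Hbes /andP[s1 s2] r0 hX hY st ct ect F1 F2.
have cfr : continuous fr by move=> x; exact: (is_derive_continuous (dfr x)).
have cfi : continuous fi by move=> x; exact: (is_derive_continuous (dfi x)).
have [p0 pp0] := critical_data r0 hX hY.
(* Cosine and sine densities of the two phases, [f1], [f2] for [S - N] and [f3], [f4] for [S + N].
   By hypothesis [f1] vanishes and [f2] is positive at [s0]. *)
pose f1 x := A * fr x + B * fi x; pose f1' x := A * fr' x + B * fi' x.
pose f2 x := A * fi x - B * fr x; pose f2' x := A * fi' x - B * fr' x.
pose f3 x := A * fr x - B * fi x; pose f3' x := A * fr' x - B * fi' x.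
pose f4 x := A * fi x + B * fr x; pose f4' x := A * fi' x + B * fr' x.
have d1 (x : R) : is_derive x 1 f1 (f1' x) by have := dfr x; have := dfi x => ? ?; derive_with; rewrite /f1'; ring.
have d2 (x : R) : is_derive x 1 f2 (f2' x) by have := dfr x; have := dfi x => ? ?; derive_with; rewrite /f2'; ring.
have d3 (x : R) : is_derive x 1 f3 (f3' x) by have := dfr x; have := dfi x => ? ?; derive_with; rewrite /f3'; ring.
have d4 (x : R) : is_derive x 1 f4 (f4' x) by have := dfr x; have := dfi x => ? ?; derive_with; rewrite /f4'; ring.
have c1 : continuous f1' by move=> x; rewrite /f1'; cts.
have c2 : continuous f2' by move=> x; rewrite /f2'; cts.
have c3 : continuous f3' by move=> x; rewrite /f3'; cts.
have c4 : continuous f4' by move=> x; rewrite /f4'; cts.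
have [ca1 cas1 _ das1 _] := smooth_amp d1 c1.
have [ca2 cas2 _ das2 _] := smooth_amp d2 c2.
have [ca3 _ _ _ _] := smooth_amp d3 c3.
have [ca4 _ _ _ _] := smooth_amp d4 c4.
have nz := expf_neq0.
have amp0 : 0 < (nN (s0, t0) * Num.sqrt (nN (s0, t0)))^-1.
  by rewrite invr_gt0 mulr_gt0 ?nN_gt0// sqrtr_gt0 nN_gt0.
have e00 : 0 < Num.min (s0 + pi) (pi - s0) by rewrite lt_min; apply/andP; split; lra.
have a10 : amp f1 (s0, t0) = 0 by rewrite /amp /= /f1 F1 mul0r.
have a20 : 0 < amp f2 (s0, t0) by rewrite /amp /= mulr_gt0.
have [d [h [L [K0 [/andP[d0 de] h0 L0 Hmain]]]]] :=
  critical_lower (smooth 1) ca1 cas1 ca2 cas2 das1 das2 p0 pp0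
    (fun d => @zero_curve s0 t0 r d r0 hX hY) a10 a20 e00.
move: de; rewrite le_min => /andP[de1 de2].
have sL : - pi <= s0 - d by lra.
have sR : s0 + d <= pi by lra.
have sM : s0 - d <= s0 + d by lra.
(* A common critical point puts [W] on the ray of [U], so [collinear_unique] gives it the sine and
   cosine of [s0]. As [s0] is interior to [-pi, pi], the two angles differ by less than a period and
   coincide. *)
have nc (c s : R) : c ^+ 2 = 1 -> - pi <= s <= pi -> (0 < c -> s != s0) ->
    phs c (s, t0) != 0 \/ pha c (s, t0) != 0.
  move=> cc /andP[sa sb] ss0.
  have [hs|] := eqVneq (phs c (s, t0)) 0; last by left.
  have [ha|] := eqVneq (pha c (s, t0)) 0; last by right.
  have [cp [r' [r'0 hX' hY']]] := noncrit cc st ct ect hs ha.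
  exfalso; move/negP: (ss0 cp); apply.
  have [cE sE] : cos s = cos s0 /\ sin s = sin s0.
    apply: (@collinear_unique _ e _ _ _ _ (r / r')) => //.
    - by rewrite divr_gt0.
    - apply: (mulfI (lt0r_neq0 r'0)); rewrite -hX' hX; field; exact: lt0r_neq0.
    - apply: (mulfI (lt0r_neq0 r'0)); rewrite -hY' hY; field; exact: lt0r_neq0.
  have : cos (s - s0) = 1 by rewrite cosB cE sE -!expr2 CS.
  have P0 := pi_gt0 R.
  move=> cc0; rewrite -subr_eq0; apply/eqP; apply: cos_eq1_eq0 => //.
  by rewrite ltr_norml; apply/andP; split; lra.
have one2 : 1 ^+ 2 = 1 :> R by rewrite expr1n.
have mone2 : (- 1) ^+ 2 = 1 :> R by rewrite sqrrN expr1n.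
have ncL (s : R) : - pi <= s <= s0 - d -> phs 1 (s, t0) != 0 \/ pha 1 (s, t0) != 0.
  move=> /andP[sa sb]; apply: nc => //; first by rewrite sa; lra.
  by move=> _; rewrite lt_eqF//; lra.
have ncR (s : R) : s0 + d <= s <= pi -> phs 1 (s, t0) != 0 \/ pha 1 (s, t0) != 0.
  move=> /andP[sa sb]; apply: nc => //; first by rewrite sb andbT; lra.
  by move=> _; rewrite gt_eqF//; lra.
have ncM (s : R) : - pi <= s <= pi -> phs (- 1) (s, t0) != 0 \/ pha (- 1) (s, t0) != 0.
  by move=> sI; apply: nc => //; rewrite oppr_gt0 ltr10.
have [da [Ca [da0 Ca0 Ha]]] := noncrit_pair d1 c1 d2 c2 sL ncL.
have [db [Cb [db0 Cb0 Hb]]] := noncrit_pair d1 c1 d2 c2 sR ncR.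
have [dc [Cc [dc0 Cc0 Hc]]] := noncrit_pair d3 c3 d4 c4 (@Npi_le_pi R) ncM.
pose hh := Num.min (Num.min h da) (Num.min db dc).
have hh0 : 0 < hh by rewrite !lt_min h0 da0 db0 dc0.
have hh1 : hh <= h by rewrite !ge_min lexx.
have hh2 : hh <= da by rewrite !ge_min lexx !orbT.
have hh3 : hh <= db by rewrite !ge_min lexx !orbT.
have hh4 : hh <= dc by rewrite !ge_min lexx !orbT.
pose m := t0 - hh; pose n := t0 + hh.
have nmE : n - m = hh + hh by rewrite /n /m; ring.
have nm0 : 0 < n - m by rewrite nmE addr_gt0.
have mn : m <= n by rewrite -subr_ge0 ltW.
have mE x : hh <= x -> t0 - x <= m by rewrite lerD2l lerN2.
have nE x : hh <= x -> n <= t0 + x by rewrite lerD2l.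
have cN := continuous_nN.
have cNi : continuous (fun z => (nN z)^-1) by move=> z; have h' := nN0 z; cts.
have [car _ _ _ _] := smooth_amp dfr cfr'.
have [cai _ _ _ _] := smooth_amp dfi cfi'.
have [M1 HM1] := @box_bound _ _ (- pi) pi m n cNi.
have [B1 HB1] := @box_bound _ _ (- pi) pi m n car.
have [B2 HB2] := @box_bound _ _ (- pi) pi m n cai.
have pbox : box (- pi) pi m n (- pi, m).
  by split; rewrite /= in_itv/= ?lexx ?mn// Npi_le_pi.
have M10 : 0 <= M1 by apply: le_trans (HM1 _ pbox).
have B10 : 0 <= B1 by apply: le_trans (HB1 _ pbox).
have B20 : 0 <= B2 by apply: le_trans (HB2 _ pbox).
pose E := 2 * (B1 + B2) * M * M1.
have E0 : 0 <= E by rewrite /E; nneg.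
pose C := Ca + Cb + Cc + E * (pi - - pi) * (n - m).
pose H k z := (amp f1 z * cos (k * phase 1 z) + amp f2 z * sin (k * phase 1 z)) +
  (amp f3 z * cos (k * phase (- 1) z) + amp f4 z * sin (k * phase (- 1) z)).
pose F k z := (fr z.1 * cos (k * nS z) + fi z.1 * sin (k * nS z)) * bes (k * nN z).
have cP1 : continuous (phase 1) by have [] := smooth 1.
have cPm : continuous (phase (- 1)) by have [] := smooth (- 1).
have cS := continuous_nS.
have cbes := @continuous_bes R.
have cH1 k : continuous (fun z => amp f1 z * cos (k * phase 1 z) + amp f2 z * sin (k * phase 1 z)).
  by move=> z; cts.
have cH2 k : continuous (fun z => amp f3 z * cos (k * phase (- 1) z) + amp f4 z * sin (k * phase (- 1) z)).
  by move=> z; cts.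
have cH k : continuous (H k) by move=> z; rewrite /H; cts.
have cF k : continuous (F k) by move=> z; rewrite /F; cts.
(* [M1 <= k] brings the argument k N into the range [1, oo) of the asymptotics; the remainder M / (k
   N) times the amplitudes is at most [E / k]. *)
have near_eq k z : 1 <= k -> M1 <= k -> box (- pi) pi m n z ->
    `|H k z - 2 * (k * Num.sqrt k) * F k z| <= E / k.
  move=> k1 kM bz; have k0 : 0 < k := lt_le_trans ltr01 k1.
  have N0 := nN_gt0 z.
  have Ni : (nN z)^-1 <= M1 by have := HM1 z bz; rewrite ger0_norm// invr_ge0 ltW.
  have kN1 : 1 <= k * nN z.
    by rewrite mulrC -ler_pdivrMl// mulr1 (le_trans Ni).
  set x := k * nN z in kN1 *.
  have x0 : 0 < x := lt_le_trans ltr01 kN1.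
  have sx : Num.sqrt x = Num.sqrt k * Num.sqrt (nN z) by rewrite sqrtrM// ltW.
  have snN0 : Num.sqrt (nN z) != 0 by rewrite gt_eqF// sqrtr_gt0.
  pose D := x * Num.sqrt x * bes x - (A * cos x + B * sin x).
  have key : H k z - 2 * (k * Num.sqrt k) * F k z =
     - (2 * (amp fr z * cos (k * nS z) + amp fi z * sin (k * nS z)) * D).
    have HE : H k z = 2 * ((fr z.1 * cos (k * nS z) + fi z.1 * sin (k * nS z)) *
        (A * cos x + B * sin x)) / (nN z * Num.sqrt (nN z)).
      rewrite two_mul_prod /H /amp /phase.
      have -> : k * (nS z - 1 * nN z) = k * nS z - x by rewrite /x; ring.
      have -> : k * (nS z - - 1 * nN z) = k * nS z + x by rewrite /x; ring.
      by rewrite /f1 /f2 /f3 /f4; field; rewrite snN0 gt_eqF.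
    have DE : D = k * nN z * (Num.sqrt k * Num.sqrt (nN z)) * bes x - (A * cos x + B * sin x).
      by rewrite /D sx.
    by rewrite HE /F /amp -/x DE; field; rewrite snN0 gt_eqF.
  rewrite key normrN !normrM (ger0_norm (ler0n R 2)) /E.
  have -> : 2 * (B1 + B2) * M * M1 / k = 2 * (B1 + B2) * (M * (M1 / k)) by ring.
  apply: ler_pM => //.
  - apply: ler_wpM2l => //; apply: (le_trans (ler_normD _ _)); apply: lerD; rewrite normrM.
      rewrite -[leRHS]mulr1; apply: ler_pM => //; first exact: HB1.
      by rewrite ler_norml cos_geN1 cos_le1.
    rewrite -[leRHS]mulr1; apply: ler_pM => //; first exact: HB2.
    by rewrite ler_norml sin_geN1 sin_le1.
  - apply: (le_trans (Hbes x kN1)); apply: ler_wpM2l => //.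
    by rewrite /x invfM mulrC ler_pM2r ?invr_gt0.
(* The summands ensure in turn k >= 1, k N >= 1, sqrt k >= K0, and sqrt k > C / (L (n - m)), which
   contradicts the final comparison of L (n - m) / sqrt k with C / k. *)
exists (1 + M1 + (`|K0| + 1) ^+ 2 + (C / (L * (n - m)) + 1) ^+ 2) => k kK k0 Hk.
have pp : 0 <= pi - - pi :> R by rewrite subr_ge0 Npi_le_pi.
have C0 : 0 <= C by rewrite /C; nneg.
have Lnm0 : 0 < L * (n - m) by rewrite mulr_gt0.
have CL0 : 0 <= C / (L * (n - m)) by rewrite divr_ge0// ltW.
have sqa : 0 <= (`|K0| + 1) ^+ 2 by exact: sqr_ge0.
have sqb : 0 <= (C / (L * (n - m)) + 1) ^+ 2 by exact: sqr_ge0.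
have [k1 kM kK' kC'] := sum4_le M10 sqa sqb kK.
pose q := Num.sqrt k.
have qE : q ^+ 2 = k by rewrite sqr_sqrtr// ltW.
have q0 : 0 < q by rewrite sqrtr_gt0.
have qK : K0 <= q.
  apply: (le_trans (ler_norm _)); apply: (@le_trans _ _ (`|K0| + 1)); first by rewrite lerDl.
  by rewrite -(@ler_pXn2r _ 2) ?nnegrE ?addr_ge0 ?(ltW q0)// qE.
have qC : C / (L * (n - m)) + 1 <= q.
  by rewrite -(@ler_pXn2r _ 2) ?nnegrE ?addr_ge0 ?(ltW q0)// qE.
have mainL : L * (n - m) / q <= itg m n (fun t => itg (s0 - d) (s0 + d)
     (fun s => amp f1 (s, t) * cos (k * phase 1 (s, t)) + amp f2 (s, t) * sin (k * phase 1 (s, t)))).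
  by rewrite -qE; exact: (Hmain q m n qK q0 (mE _ hh1) mn (nE _ hh1)).
have ia := Ha m n k (mE _ hh2) mn (nE _ hh2) k0.
have ib := Hb m n k (mE _ hh3) mn (nE _ hh3) k0.
have ic := Hc m n k (mE _ hh4) mn (nE _ hh4) k0.
have cI (G : R * R -> R) a b : continuous G -> cton m n (fun t => itg a b (fun s => G (s, t))).
  by move=> cG; exact: continuous_cton (@itg_cont _ _ a b _ (continuous_swap cG)).
have cs (G : R * R -> R) a b t : continuous G -> cton a b (fun s => G (s, t)).
  by move=> cG; exact: continuous_cton (@continuous_slice2 _ _ t cG).
have tot : `|itg m n (fun t => itg (- pi) pi (fun s => H k (s, t)))| <= E * (pi - - pi) * (n - m) / k.
  rewrite mulrAC; apply: itg_norm_le => //; first exact: cI.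
  move=> t /andP[mt tn].
  have -> : itg (- pi) pi (fun s => H k (s, t)) =
      itg (- pi) pi (fun s => H k (s, t) - 2 * (k * Num.sqrt k) * F k (s, t)).
    rewrite itg_sub; [|exact: cs|]; last first.
      by apply: (cs (fun z => 2 * (k * Num.sqrt k) * F k z)) => z; have := cF k; move=> cFk; cts.
    rewrite itg_scale; last exact: cs.
    by rewrite [X in _ * X](Hk t) mulr0 subr0.
  rewrite mulrAC; apply: itg_norm_le; first exact: Npi_le_pi.
    apply: (cs (fun z => H k z - 2 * (k * Num.sqrt k) * F k z)) => z.
    by have cFk := cF k; have cHk := cH k; cts.
  move=> s hs; apply: near_eq => //; split; rewrite /= in_itv/= ?mt//.
have split_tot : itg m n (fun t => itg (- pi) pi (fun s => H k (s, t))) =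
   (itg m n (fun t => itg (- pi) (s0 - d)
     (fun s => amp f1 (s, t) * cos (k * phase 1 (s, t)) + amp f2 (s, t) * sin (k * phase 1 (s, t)))) +
    itg m n (fun t => itg (s0 - d) (s0 + d)
     (fun s => amp f1 (s, t) * cos (k * phase 1 (s, t)) + amp f2 (s, t) * sin (k * phase 1 (s, t)))) +
    itg m n (fun t => itg (s0 + d) pi
     (fun s => amp f1 (s, t) * cos (k * phase 1 (s, t)) + amp f2 (s, t) * sin (k * phase 1 (s, t))))) +
   itg m n (fun t => itg (- pi) pi
     (fun s => amp f3 (s, t) * cos (k * phase (- 1) (s, t)) + amp f4 (s, t) * sin (k * phase (- 1) (s, t)))).
  have i1 := cI _ (- pi) (s0 - d) (cH1 k).
  have i2 := cI _ (s0 - d) (s0 + d) (cH1 k).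
  have i3 := cI _ (s0 + d) pi (cH1 k).
  have i4 := cI _ (- pi) pi (cH2 k).
  rewrite -itg_add// -itg_add//; last by move=> x xI; apply: cts_add; [exact: i1|exact: i2].
  rewrite -itg_add//; last first.
    by move=> x xI; apply: cts_add; [apply: cts_add; [exact: i1|exact: i2]|exact: i3].
  apply: itg_ext => t _; rewrite -itg_cat//; last exact: (cs _ _ _ t (cH1 k)).
  rewrite -itg_cat//; [|exact: le_trans sL sM|exact: (cs _ _ _ t (cH1 k))].
  by rewrite -itg_add//; [exact: (cs _ _ _ t (cH1 k))|exact: (cs _ _ _ t (cH2 k))].
move: tot; rewrite split_tot => tot.
have fin : L * (n - m) / q <= C / k.
  apply: (le_trans mainL); rewrite /C !mulrDl; exact: le_of_norm4 ia ib ic tot.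
have : L * (n - m) * q <= C.
  move: fin; rewrite -qE expr2 invfM mulrA ler_pM2r ?invr_gt0//.
  by rewrite ler_pdivlMr.
rewrite mulrC -ler_pdivlMr// leNgt => /negP; apply.
by apply: lt_le_trans qC; rewrite ltrDl.
Qed.

End EllipsePhase.

(** * Choice of the stationary point *)

Section Choice.
Context {R : realType}.

Lemma periodic_int (f : R -> R) (T : R) (z : int) (a : R) :
  (forall t : R, f (t + T) = f t) -> f (a - z%:~R * T) = f a.
Proof.
move=> fT; have P (n : nat) b : f (b + n%:R * T) = f b.
  by rewrite mulr_natl; apply: (periodicn (f := f)).
case: z => n; first by rewrite -(P n) -[(Posz n)%:~R]/(n%:R) subrK.
by rewrite NegzE mulrNz mulNr opprK; exact: P.
Qed.

Lemma periodic_reduce (t : R) : exists z : int, - pi <= t - z%:~R * (2 * pi) < pi.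
Proof.
have P0 := pi_gt0 R.
have P2 : 0 < 2 * pi :> R by lra.
exists (Num.floor ((t + pi) / (2 * pi))).
have /andP[h1 h2] := floor_itv ((t + pi) / (2 * pi)).
move: h1; rewrite ler_pdivlMr// => h1.
move: h2; rewrite intrD ltr_pdivrMr// mulrDl mul1r => h2.
apply/andP; split; lra.
Qed.

Lemma angle_exists (x y : R) : x ^+ 2 + y ^+ 2 = 1 -> exists t, cos t = x /\ sin t = y.
Proof.
move=> xy; have x1 : -1 <= x <= 1.
  rewrite -ler_norml -(@ler_pXn2r _ 2) ?nnegrE// expr1n real_normK ?num_real//.
  by rewrite -xy lerDl sqr_ge0.
have sE : sin (acos x) = Num.sqrt (y ^+ 2).
  by rewrite sin_acos//; congr Num.sqrt; rewrite -xy; ring.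
have [y0|y0] := leP 0 y.
  by exists (acos x); rewrite acosK ?in_itv//= sE sqrtr_sqr ger0_norm.
by exists (- acos x); rewrite cosN acosK ?in_itv//= sinN sE sqrtr_sqr ltr0_norm// opprK.
Qed.

Lemma cos_injective_half (l r : R) : (0 <= l /\ r <= pi) \/ (- pi <= l /\ r <= 0) ->
  forall x y, l <= x <= r -> l <= y <= r -> cos x = cos y -> x = y.
Proof.
move=> H x y /andP[lx xr] /andP[ly yr]; case: H => [[l0 rp]|[l0 rp]] E.
- by apply: cos_inj => //; rewrite in_itv/=; apply/andP; split; lra.
- apply: oppr_inj; apply: cos_inj; rewrite ?cosN// in_itv/=; apply/andP; split; lra.
Qed.

(** On a half period the cosine is injective, so [size p] distinct angles give more values than [p]
    has roots. *)
Lemma avoid_poly_cos (p : {poly R}) (l r : R) : p != 0 -> l < r ->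
  (0 <= l /\ r <= pi) \/ (- pi <= l /\ r <= 0) ->
  exists s : R, l < s < r /\ p.[cos s] != 0.
Proof.
move=> p0 lr H; apply: contrapT => noex.
have root_all (s : R) : l < s < r -> root p (cos s).
  move=> sI; rewrite rootE; apply/negPn/negP => h; apply: noex; by exists s.
pose n := size p.
pose pt (i : nat) : R := l + (r - l) * (i.+1%:R / n.+1%:R).
have ptI i : (i < n)%N -> l < pt i < r.
  move=> i_n; have i0 : 0 < i.+1%:R / n.+1%:R :> R by rewrite divr_gt0.
  have i1 : i.+1%:R / n.+1%:R < 1 :> R by rewrite ltr_pdivrMr// mul1r ltr_nat.
  have rl : 0 < r - l by rewrite subr_gt0.
  rewrite /pt ltrDl mulr_gt0//= -ltrBrDl -[ltRHS]mulr1 ltr_pM2l//.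
have : (size [seq cos (pt i) | i <- iota 0 n] < size p)%N.
  apply: max_poly_roots => //.
    apply/allP => x /mapP[i]; rewrite mem_iota add0n => /andP[_ i_n] ->.
    exact/root_all/ptI.
  rewrite map_inj_in_uniq ?iota_uniq// => i j; rewrite !mem_iota !add0n /= => i_n j_n E.
  have /andP[i1 i2] := ptI _ i_n; have /andP[j1 j2] := ptI _ j_n.
  have : pt i = pt j by apply: (cos_injective_half H) => //; rewrite !ltW.
  rewrite /pt => /addrI/mulfI; rewrite subr_eq0 gt_eqF// => /(_ isT).
  move=> /(mulIf (invr_neq0 (lt0r_neq0 (ltr0Sn R n)))) /eqP.
  by rewrite eqr_nat => /eqP[].
by rewrite size_map size_iota ltnn.
Qed.

(** The frequency [k] will be the wave number times the semi-major axis. *)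
Definition orth (e g : R) (fr fi : R -> R) (k : R) : Prop := forall t : R,
  itg (- pi) pi (fun s => (fr s * cos (k * nS e g (s, t)) + fi s * sin (k * nS e g (s, t))) *
    bes (k * nN e g (s, t))) = 0.

(** The new pair is the complex density fr + i fi multiplied by the constant c - i d. *)
Lemma orth_lin (e g : R) (fr fi : R -> R) (k c d : R) : 0 < e < 1 -> e < g -> g ^+ 2 != 1 ->
  continuous fr -> continuous fi ->
  orth e g fr fi k -> orth e g fi (fun s => - fr s) k ->
  orth e g (fun s => c * fr s + d * fi s) (fun s => c * fi s - d * fr s) k.
Proof.
move=> e01 eg g1 cfr cfi h1 h2 t.
have cS : continuous (nS e g) by exact: continuous_nS.
have cN : continuous (nN e g) by exact: continuous_nN.
have cb := @continuous_bes R.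
pose a s := (fr s * cos (k * nS e g (s, t)) + fi s * sin (k * nS e g (s, t))) * bes (k * nN e g (s, t)).
pose b s := (fi s * cos (k * nS e g (s, t)) + - fr s * sin (k * nS e g (s, t))) * bes (k * nN e g (s, t)).
have ca : continuous a by move=> x; rewrite /a; cts.
have cB : continuous b by move=> x; rewrite /b; cts.
rewrite (@itg_ext _ _ _ _ (fun s => c * a s + d * b s)); last by move=> s _; rewrite /a /b; ring.
rewrite itg_add; [|by apply: continuous_cton => x; cts..].
rewrite !itg_scale; [|exact: continuous_cton..].
have -> : itg (- pi) pi a = 0 := h1 t.
have -> : itg (- pi) pi b = 0 := h2 t.
by rewrite !mulr0 addr0.
Qed.

(** Any angle where the density is nonzero, apart from finitely many exceptional values of its
    cosine, can serve as [s0]; [t0] is then found on the ray of [U]. *)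
Lemma orth_bounded (e g : R) (fr fr' fi fi' : R -> R) : 0 < e < 1 -> e < g -> g ^+ 2 != 1 ->
  (forall x : R, is_derive x 1 fr (fr' x)) -> continuous fr' ->
  (forall x : R, is_derive x 1 fi (fi' x)) -> continuous fi' ->
  (forall t, fr (t + 2 * pi) = fr t) -> (forall t, fi (t + 2 * pi) = fi t) ->
  (exists t, fr t != 0 \/ fi t != 0) ->
  exists K : R, forall k, K <= k -> 0 < k ->
    ~ (orth e g fr fi k /\ orth e g fi (fun s => - fr s) k).
Proof.
move=> e01 eg g1 dfr cfr' dfi cfi' pfr pfi [t1 ft1].
have /andP[e0 e1] := e01; have g0 : 0 < g := lt_trans e0 eg.
have P0 := pi_gt0 R.
have cfr : continuous fr by move=> x; exact: (is_derive_continuous (dfr x)).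
have cfi : continuous fi by move=> x; exact: (is_derive_continuous (dfi x)).
pose F x := fr x ^+ 2 + fi x ^+ 2.
have cF : continuous F by move=> x; rewrite /F; cts.
have [z /andP[z1 z2]] := periodic_reduce t1.
set s1 := t1 - z%:~R * (2 * pi) in z1 z2.
have Fs1 : F s1 != 0.
  rewrite /F /s1 !periodic_int// paddr_eq0 ?sqr_ge0// !sqrf_eq0 negb_and.
  by apply/orP.
have [d d0 Hd] : exists2 d : R, 0 < d & forall x, `|s1 - x| < d -> F x != 0.
  have Fpos : 0 < F s1 by rewrite lt_neqAle eq_sym Fs1 addr_ge0 ?sqr_ge0.
  have /cvgrPdist_lt/(_ _ Fpos) [d /= d0 Hd] := cF s1.
  exists d => // x xd; have := Hd x xd.
  by apply: contraPneq => ->; rewrite subr0 gtr0_norm ?ltxx.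
(* The interval lies in a half period, as [avoid_poly_cos] requires, and its interior lies where the
   density is nonzero. *)
have [l [r [lr H lrP]]] : exists l r : R, [/\ l < r, (0 <= l /\ r <= pi) \/ (- pi <= l /\ r <= 0) &
    forall x, l < x < r -> - pi < x < pi /\ `|s1 - x| < d].
  have [s0|s0] := leP 0 s1.
    exists s1, (Num.min (s1 + d) pi); split.
    - by rewrite lt_min ltrDl d0.
    - by left; split => //; rewrite ge_min lexx orbT.
    - move=> x /andP[h]; rewrite lt_min => /andP[h1 h2]; split; first by apply/andP; split; lra.
      by rewrite ltr_norml; apply/andP; split; lra.
  exists s1, (Num.min (s1 + d) 0); split.
  - by rewrite lt_min ltrDl d0.
  - by right; split => //; rewrite ge_min lexx orbT.
  - move=> x /andP[h]; rewrite lt_min => /andP[h1 h2]; split; first by apply/andP; split; lra.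
    by rewrite ltr_norml; apply/andP; split; lra.
(* Obtained by eliminating the ratio [rt] below: cos t0 = 0 forces a zero of [p1], e g cos t0 = 1
   forces one of [p2], and [p3] is the squared sine of [s0], proportional to that of [t0]. None
   vanishes at -e, so the product is a nonzero polynomial. *)
pose p1 : {poly R} := (e ^+ 2)%:P * (1 - 'X ^+ 2) - (g ^+ 2)%:P * ('X + e%:P) ^+ 2.
pose p2 : {poly R} := ((1 - e ^+ 2) ^+ 2)%:P * (1 - 'X ^+ 2) - (e ^+ 2 * g ^+ 2 - 1)%:P * ('X + e%:P) ^+ 2.
pose p3 : {poly R} := 1 - 'X ^+ 2.
have ev1 c : p1.[c] = e ^+ 2 * (1 - c ^+ 2) - g ^+ 2 * (c + e) ^+ 2 by rewrite /p1 !hornerE.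
have ev2 c : p2.[c] = (1 - e ^+ 2) ^+ 2 * (1 - c ^+ 2) - (e ^+ 2 * g ^+ 2 - 1) * (c + e) ^+ 2.
  by rewrite /p2 !hornerE.
have ev3 c : p3.[c] = 1 - c ^+ 2 by rewrite /p3 !hornerE.
have b0 : 0 < 1 - e ^+ 2 by nra.
have np (p : {poly R}) (c : R) : p.[c] != 0 -> p != 0 by apply: contraNneq => ->; rewrite horner0.
have pn0 : p1 * p2 * p3 != 0.
  apply: mulf_neq0; first apply: mulf_neq0.
  - by apply: (np _ (- e)); rewrite ev1 addNr expr0n mulr0 subr0 sqrrN gt_eqF// mulr_gt0// exprn_gt0.
  - by apply: (np _ (- e)); rewrite ev2 addNr expr0n mulr0 subr0 sqrrN gt_eqF// mulr_gt0// exprn_gt0.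
  - by apply: (np _ (- e)); rewrite ev3 sqrrN gt_eqF.
have [s0 [sI]] := avoid_poly_cos pn0 lr H.
rewrite !hornerM ev1 ev2 ev3 !mulf_eq0 !negb_or => /andP[/andP[n1 n2] n3].
have [sP sd] := lrP _ sI.
have Fs0 := Hd _ sd.
have CS := cos2Dsin2 s0.
set C := cos s0 in CS n1 n2 n3 *; set S := sin s0 in CS *.
have n3' : 1 - C ^+ 2 = S ^+ 2 by rewrite -CS; ring.
rewrite n3' in n1 n2 n3.
have S0 : S != 0 by rewrite -sqrf_eq0.
pose D := (C + e) ^+ 2 + S ^+ 2.
have D0 : 0 < D by rewrite ltr_wpDl ?sqr_ge0// lt_neqAle eq_sym n3 sqr_ge0.
pose disc := e ^+ 2 * (C + e) ^+ 2 + (g ^+ 2 - e ^+ 2) * D.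
have ge2 : 0 < g ^+ 2 - e ^+ 2 by rewrite subr_gt0 ltr_pXn2r ?nnegrE ?ltW.
(* The positive root of |(e, 0) + rt (C + e, S)|^2 = g^2, a quadratic with leading coefficient [D];
   its constant term e^2 - g^2 is negative, which makes this root positive. *)
pose rt := (Num.sqrt disc - e * (C + e)) / D.
have disc0 : 0 <= disc.
  by rewrite /disc; apply: addr_ge0; [nneg|apply: mulr_ge0; exact: ltW].
have rt0 : 0 < rt.
  rewrite divr_gt0// subr_gt0 (le_lt_trans (ler_norm _))//.
  rewrite -(@ltr_pXn2r _ 2) ?nnegrE ?sqrtr_ge0// sqr_sqrtr// real_normK ?num_real//.
  by rewrite exprMn /disc ltrDl mulr_gt0.
have quad : (e + rt * (C + e)) ^+ 2 + (rt * S) ^+ 2 = g ^+ 2.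
  have -> : (e + rt * (C + e)) ^+ 2 + (rt * S) ^+ 2 =
     ((rt * D + e * (C + e)) ^+ 2 - e ^+ 2 * (C + e) ^+ 2) / D + e ^+ 2.
    by rewrite /D; field; rewrite -/D gt_eqF.
  have -> : rt * D + e * (C + e) = Num.sqrt disc by rewrite /rt divfK ?gt_eqF// subrK.
  rewrite sqr_sqrtr// /disc; field; exact: lt0r_neq0.
have [t0 [ct st]] : exists t, cos t = (e + rt * (C + e)) / g /\ sin t = rt * S / g.
  apply: angle_exists; rewrite !expr_div_n -mulrDl quad divff// expf_neq0//; exact: lt0r_neq0.
have gn0 : g != 0 by exact: lt0r_neq0.
have hX : g * cos t0 - e = rt * (C + e) by rewrite ct mulrC divfK//; ring.
have hY : g * sin t0 = rt * S by rewrite st mulrC divfK.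
have rtn0 := lt0r_neq0 rt0.
have st0 : sin t0 != 0 by rewrite st; apply: mulf_neq0; [exact: mulf_neq0|rewrite invr_eq0].
have rE : (rt * S) ^+ 2 = g ^+ 2 - (g * cos t0) ^+ 2.
  by rewrite -quad -hX; ring.
have ct0 : cos t0 != 0.
  apply: contra n1 => /eqP c0; rewrite c0 mulr0 in hX; rewrite c0 mulr0 expr0n subr0 in rE.
  by rewrite -rE; apply/eqP; rewrite -sqrrN -[- e]add0r hX; ring.
have ect0 : e * g * cos t0 != 1.
  apply: contra n2 => /eqP c1.
  have gc : g * cos t0 = e^-1 by apply: (mulfI (lt0r_neq0 e0)); rewrite mulrA c1 divff// lt0r_neq0.
  have h1 : e * (rt * (C + e)) = 1 - e ^+ 2 by rewrite -hX gc; field; exact: lt0r_neq0.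
  have h2 : e ^+ 2 * (rt * S) ^+ 2 = e ^+ 2 * g ^+ 2 - 1 by rewrite rE gc; field; exact: lt0r_neq0.
  by rewrite -h1 -h2; apply/eqP; ring.
have [A [B [M [AB M0 Hbes]]]] := @bes_asymptotics R.
(* The complex multiplier c1 - i c2 turns the density at [s0] into -B + i A; the cosine coefficient
   then vanishes and the sine coefficient is A^2 + B^2. *)
pose c1 := (- B * fr s0 + A * fi s0) / F s0; pose c2 := (- B * fi s0 - A * fr s0) / F s0.
pose gr s := c1 * fr s + c2 * fi s; pose gi s := c1 * fi s - c2 * fr s.
have grE : gr s0 = - B by rewrite /gr /c1 /c2 /F; field; exact: Fs0.
have giE : gi s0 = A by rewrite /gi /c1 /c2 /F; field; exact: Fs0.
have dgr (x : R) : is_derive x 1 gr (c1 * fr' x + c2 * fi' x).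
  by have := dfr x; have := dfi x => ? ?; rewrite /gr; derive_with; ring.
have dgi (x : R) : is_derive x 1 gi (c1 * fi' x - c2 * fr' x).
  by have := dfr x; have := dfi x => ? ?; rewrite /gi; derive_with; ring.
have cgr : continuous (fun x => c1 * fr' x + c2 * fi' x) by move=> x; cts.
have cgi : continuous (fun x => c1 * fi' x - c2 * fr' x) by move=> x; cts.
have G1 : A * gr s0 + B * gi s0 = 0 by rewrite grE giE; ring.
have G2 : 0 < A * gi s0 - B * gr s0.
  by rewrite grE giE (_ : _ - _ = A ^+ 2 + B ^+ 2)//; ring.
have [K HK] := no_large_wavenumber e01 eg g1 dgr cgr dgi cgi M0 Hbes sP rt0 hX hY st0 ct0 ect0 G1 G2.
by exists K => k kK k0 [h1 h2]; apply: (HK k kK k0); exact: orth_lin.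
Qed.

End Choice.

(** * An identity theorem, and dependence of the integrals on the frequency *)

Section Identity.
Context {R : realType}.
Variables (G : nat -> R -> R) (C L : R).
Hypothesis dG : forall n (x : R), is_derive x 1 (G n) (G n.+1 x).
Hypotheses (C0 : 0 <= C) (L0 : 0 < L).
Hypothesis bG : forall n x, `|G n x| <= C * L ^+ n.

Let cG n : continuous (G n).
Proof. by move=> x; exact: (is_derive_continuous (dG n x)). Qed.

Let derive_bound n p x K : 0 <= K -> (forall y, `|y - p| <= `|x - p| -> `|G n.+1 y| <= K) ->
  `|G n x - G n p| <= K * `|x - p|.
Proof.
move=> K0 H; have [px|xp] := leP p x.
  have px' : 0 <= x - p by rewrite subr_ge0.
  rewrite (ger0_norm px') in H *.
  have Hy (y : R) : p <= y <= x -> - K <= G n.+1 y <= K.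
    move=> /andP[py yx]; rewrite -ler_norml; apply: H; rewrite ger0_norm ?subr_ge0//.
    by rewrite lerD2r.
  rewrite ler_norml; apply/andP; split.
    by rewrite -mulNr; apply: (derive_ge_lin (f := G n) (df := G n.+1)) => // y /Hy/andP[].
  by apply: (derive_le_lin (f := G n) (df := G n.+1)) => // y /Hy/andP[].
have px' : x - p < 0 by rewrite subr_lt0.
rewrite (ltr0_norm px') opprB in H *.
have Hy (y : R) : x <= y <= p -> - K <= G n.+1 y <= K.
  move=> /andP[py yx]; rewrite -ler_norml; apply: H; rewrite distrC ger0_norm ?subr_ge0//.
  by rewrite lerD2l lerN2.
rewrite distrC ler_norml; apply/andP; split.
  by rewrite -mulNr; apply: (derive_ge_lin (f := G n) (df := G n.+1)) => //; [exact: ltW|move=> y /Hy/andP[]].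
by apply: (derive_le_lin (f := G n) (df := G n.+1)) => //; [exact: ltW|move=> y /Hy/andP[]].
Qed.

Let rho : R := (2 * L)^-1.
Let rho0 : 0 < rho. Proof. by rewrite invr_gt0 mulr_gt0. Qed.

(** With radius 1 / (2 L), each use of the mean value theorem gains a factor 1 / 2 against the
    bounds C L^n; proving the estimate for all [n] at once lets it be iterated [N] times. *)
Let flat_ball p : (forall n, G n p = 0) -> forall n x, `|x - p| <= rho -> G n x = 0.
Proof.
move=> Gp n x xp.
have bnd N : forall n x, `|x - p| <= rho -> `|G n x| <= C * L ^+ n * (2^-1) ^+ N.
  elim: N => [|N IH] m y yp; first by rewrite expr0 mulr1.
  rewrite -[G m y]subr0 -(Gp m).
  apply: (le_trans (@derive_bound m p y (C * L ^+ m.+1 * 2^-1 ^+ N) _ _)).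
  - by rewrite !mulr_ge0// exprn_ge0// ltW.
  - by move=> z zy; apply: IH; exact: le_trans yp.
  apply: (@le_trans _ _ (C * L ^+ m.+1 * 2^-1 ^+ N * rho)).
    by rewrite ler_wpM2l// !mulr_ge0// exprn_ge0// ltW.
  by apply: le_of_eq; rewrite /rho !exprS; field; rewrite gt_eqF.
apply/eqP; rewrite -normr_le0; apply/ler_addgt0Pr => e e0; rewrite add0r.
have c0 : 0 <= C * L ^+ n by rewrite mulr_ge0// exprn_ge0// ltW.
have [N HN] := nat_upper_bound (C * L ^+ n / e).
apply: (le_trans (bnd N _ _ xp)); rewrite exprVn ler_pdivrMr ?exprn_gt0//.
rewrite ler_pdivrMr// in HN.
have : (N%:R : R) <= 2 ^+ N by rewrite -natrX ler_nat ltnW// ltn_expl.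
move=> h; apply: (le_trans HN); rewrite mulrC; exact: ler_wpM2l (ltW e0) _ _ h.
Qed.

(** A chain of points from [p] to [x] with steps of length at most [rho]. *)
Let flat_all p : (forall n, G n p = 0) -> forall n x, G n x = 0.
Proof.
move=> Gp n x.
have step : forall (N : nat) y, `|y - p| <= N%:R * rho -> forall n, G n y = 0.
  elim=> [|N IH] y yp m.
    by move: yp; rewrite mul0r normr_le0 subr_eq0 => /eqP ->.
  pose z := y - (y - p) / N.+1%:R.
  have zp : `|z - p| <= N%:R * rho.
    have -> : z - p = (y - p) * (N%:R / N.+1%:R).
      by rewrite /z -[N.+1]addn1 natrD; field; rewrite natr1 pnatr_eq0.
    rewrite normrM [`|N%:R / _|]ger0_norm ?divr_ge0//.
    apply: (@le_trans _ _ (N.+1%:R * rho * (N%:R / N.+1%:R))); first by rewrite ler_wpM2r ?divr_ge0.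
    by apply: le_of_eq; field; rewrite ?[1 + _]addrC natr1 pnatr_eq0.
  apply: (@flat_ball z (IH z zp) m y).
  have -> : y - z = (y - p) / N.+1%:R by rewrite /z; ring.
  by rewrite normrM normfV [`|N.+1%:R|]ger0_norm// ler_pdivrMr// mulrC.
have [N HN] := nat_upper_bound (`|x - p| / rho).
by apply: (step N); rewrite -ler_pdivrMr.
Qed.

(** By Rolle, zeros of [G n] accumulating at a limit point [p] of [Z] produce zeros of [G n.+1]
    accumulating there, so all derivatives vanish at [p]. *)
Lemma identity_theorem (Z : set R) : infinite_set Z -> bounded_set Z ->
  (forall x, Z x -> G 0 x = 0) -> forall x, G 0 x = 0.
Proof.
move=> iZ bZ Z0.
have [p pZ] := infinite_bounded_limit_point_nonempty iZ bZ.
have acc n : forall e : R, 0 < e -> exists x, [/\ x != p, `|p - x| < e & G n x = 0].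
  have cont m : (forall e : R, 0 < e -> exists x, [/\ x != p, `|p - x| < e & G m x = 0]) -> G m p = 0.
    move=> H; apply/eqP; rewrite -normr_le0; apply/ler_addgt0Pr => e e0; rewrite add0r.
    have /cvgrPdist_lt/(_ _ e0) [d /= d0 Hd] := @cG m p.
    have [x [_ xd Gx]] := H d d0.
    by have := Hd x xd; rewrite Gx subr0 => /ltW.
  elim: n => [|n IH] e e0.
    have [x [xp Zx xe]] := pZ _ (nbhsx_ballx p e e0).
    by exists x; split => //; exact: Z0.
  have Gp := cont n IH.
  have [x [xp xe Gx]] := IH e e0.
  have der (y : R) : derivable (G n) y 1 by have [] := dG n y.
  have cw a b : {within `[a, b], continuous (G n)} by apply: continuous_subspaceT; exact: cG.
  have fin (c : R) : is_derive c 1 (G n) 0 -> G n.+1 c = 0.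
    by move=> dc; rewrite -(@derive_val _ _ _ _ _ _ _ (dG n c)) (@derive_val _ _ _ _ _ _ _ dc).
  have [px|px|E] := ltgtP p x; last by rewrite E eqxx in xp.
  - have Epx : G n p = G n x by rewrite Gp Gx.
    have [c cI dc] := Rolle px (fun y _ => der y) (cw p x) Epx.
    move: cI; rewrite in_itv/= => /andP[pc cx].
    exists c; split; [by rewrite gt_eqF| |exact: fin].
    by move: xe; rewrite !ltr_norml => /andP[? ?]; apply/andP; split; lra.
  - have Epx : G n x = G n p by rewrite Gp Gx.
    have [c cI dc] := Rolle px (fun y _ => der y) (cw x p) Epx.
    move: cI; rewrite in_itv/= => /andP[pc cx].
    exists c; split; [by rewrite lt_eqF| |exact: fin].
    by move: xe; rewrite !ltr_norml => /andP[? ?]; apply/andP; split; lra.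
apply: (@flat_all p).
move=> n; apply/eqP; rewrite -normr_le0; apply/ler_addgt0Pr => e e0; rewrite add0r.
have /cvgrPdist_lt/(_ _ e0) [d /= d0 Hd] := @cG n p.
have [x [_ xd Gx]] := acc n d d0.
by have := Hd x xd; rewrite Gx subr0 => /ltW.
Qed.

End Identity.

Section BesselPhase.
Context {R : realType}.

(** In the expansion of the cosine of the sum, the term with [sin (x * sin u)] is odd in [u] and
    integrates to 0. *)
Lemma bes_phase (X x : R) :
  itg (- pi) pi (fun u => cos u ^+ 2 * cos (X + x * sin u)) = cos X * bes x.
Proof.
pose f u : R := cos u ^+ 2 * cos (x * sin u).
pose h u : R := cos u ^+ 2 * sin (x * sin u).
have cf : continuous f by move=> u; rewrite /f; cts.
have ch : continuous h by move=> u; rewrite /h; cts.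
have h0 : itg (- pi) pi h = 0.
  have := itg_reflect 0 (@Npi_le_pi R) ch.
  rewrite !sub0r opprK (@itg_ext _ _ _ (fun y => h (0 - y)) (fun y => - h y)); last first.
    by move=> y _; rewrite /h sub0r cosN sinN mulrN sinN mulrN.
  by rewrite itg_opp; [lra|exact: continuous_cton].
rewrite (@itg_ext _ _ _ _ (fun u => cos X * f u + (- sin X) * h u)); last first.
  by move=> u _; rewrite cosD /f /h; ring.
rewrite itg_add; [|by apply: continuous_cton => u; cts..].
by rewrite !itg_scale ?h0 ?mulr0 ?addr0//; exact: continuous_cton.
Qed.

Lemma bes_phase_sin (X x : R) :
  itg (- pi) pi (fun u => cos u ^+ 2 * sin (X + x * sin u)) = sin X * bes x.
Proof.
rewrite -cos_sub_pihalf -bes_phase; apply: itg_ext => u _.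
by rewrite -cos_sub_pihalf addrAC.
Qed.

End BesselPhase.

Section OrthEntire.
Context {R : realType}.
Variables (e g : R) (fr fi : R -> R).
Hypotheses (cfr : continuous fr) (cfi : continuous fi).

(** Once the Bessel factor is written as an integral over [u], the phase is linear in [k]; each
    [k]-derivative brings one bounded factor [theta], whence the bounds C L^n. *)
Let theta (t s u : R) : R := nS e g (s, t) + nN e g (s, t) * sin u.

(** The derivative of a cos(k x) + b sin(k x) in [k] is [x] times the same expression with (a, b)
    replaced by (b, -a). *)
Let coef (n : nat) (s : R) : R * R := iter n (fun c : R * R => (c.2, - c.1)) (fr s, fi s).

Let term (t : R) n (z : (R * R) * R) : R :=
  cos z.2 ^+ 2 * (theta t z.1.2 z.2 ^+ n *
   ((coef n z.1.2).1 * cos (z.1.1 * theta t z.1.2 z.2) + (coef n z.1.2).2 * sin (z.1.1 * theta t z.1.2 z.2))).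

Let H (t : R) n (k : R) : R := itg (- pi) pi (fun s => itg (- pi) pi (fun u => term t n ((k, s), u))).

Let ccoef n : continuous (fun s => (coef n s).1) /\ continuous (fun s => (coef n s).2).
Proof.
elim: n => [|n [IH1 IH2]]; first by split; [exact: cfr|exact: cfi].
split; first exact: IH2.
pose a s := (coef n s).1; have ca : continuous a := IH1.
change (continuous (fun s => - a s)); by move=> s; cts.
Qed.

Let cterm t n : continuous (term t n).
Proof.
have [c1 c2] := ccoef n.
have cS : continuous (fun s => nS e g (s, t)) by apply: continuous_slice2; exact: continuous_nS.
have cN : continuous (fun s => nN e g (s, t)) by apply: continuous_slice2; exact: continuous_nN.
pose p (z : (R * R) * R) := z.1.2.
have cp : continuous p.
  by move=> z; apply: (@cts_comp2 _ _ _ snd fst); [exact: cts_snd|exact: cts_fst].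
pose k (z : (R * R) * R) := z.1.1.
have ck : continuous k.
  by move=> z; apply: (@cts_comp2 _ _ _ fst fst); [exact: cts_fst|exact: cts_fst].
pose S s := nS e g (s, t); pose N s := nN e g (s, t).
have cS' : continuous S := cS; have cN' : continuous N := cN.
pose a s := (coef n s).1; pose b s := (coef n s).2.
have ca : continuous a := c1; have cb : continuous b := c2.
have -> : term t n = fun z => cos z.2 ^+ 2 * ((S (p z) + N (p z) * sin z.2) ^+ n *
   (a (p z) * cos (k z * (S (p z) + N (p z) * sin z.2)) +
    b (p z) * sin (k z * (S (p z) + N (p z) * sin z.2)))) by [].
by move=> z; cts.
Qed.

Let dH t n (k : R) : is_derive k 1 (H t n) (H t n.+1 k).
Proof.
apply: (@itg_is_derive _ (fun z => itg (- pi) pi (fun u => term t n (z, u)))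
   (fun z => itg (- pi) pi (fun u => term t n.+1 (z, u)))).
- exact: (@itg_cont _ _ _ _ (term t n)).
- exact: (@itg_cont _ _ _ _ (term t n.+1)).
- move=> k' s.
  have slice m : continuous (fun z : R * R => term t m ((z.1, s), z.2)).
    move=> z; apply: (@cts_comp2 _ _ _ (term t m) (fun z => ((z.1, s), z.2))); first exact: cterm.
    by apply: cts_pair; [apply: cts_pair; [exact: cts_fst|exact: cts_cst_]|exact: cts_snd].
  apply: (@itg_is_derive _ (fun z => term t n ((z.1, s), z.2)) (fun z => term t n.+1 ((z.1, s), z.2))) => //.
  move=> x u; rewrite /term /= -/(coef n s).
  move: (coef n s) (theta t s u) => [a b] T /=.
  by derive_with; rewrite [T ^+ n.+1]exprS; ring.
Qed.

Let bH t : exists C L, [/\ 0 <= C, 0 < L & forall n k, `|H t n k| <= C * L ^+ n].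
Proof.
have P0 := @Npi_le_pi R.
have cS : continuous (nS e g) := @continuous_nS _ e g.
have cN : continuous (nN e g) := @continuous_nN _ e g.
have cth : continuous (fun z : R * R => theta t z.1 z.2) by move=> z; rewrite /theta; cts.
have [L HL] := @box_bound _ _ (- pi) pi (- pi) pi cth.
have ccc : continuous (fun z : R * R => `|fr z.1| + `|fi z.1|).
  pose nm (x : R) := `|x|; have cn : continuous nm := @norm_continuous R R^o.
  change (continuous (fun z : R * R => nm (fr z.1) + nm (fi z.1))); by move=> z; cts.
have [C HC] := @box_bound _ _ (- pi) pi (- pi) pi ccc.
have L0 : 0 <= L.
  by apply: le_trans (HL (- pi, - pi) _) => //; split; rewrite /= in_itv/= lexx P0.
have C0 : 0 <= C.
  by apply: le_trans (HC (- pi, - pi) _) => //; split; rewrite /= in_itv/= lexx P0.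
have coefB n s : `|(coef n s).1| <= `|fr s| + `|fi s| /\ `|(coef n s).2| <= `|fr s| + `|fi s|.
  elim: n => [|n [IH1 IH2]]; first by rewrite /= lerDl lerDr !normr_ge0.
  by split => //=; rewrite normrN.
have pp : 0 <= pi - - pi :> R by rewrite subr_ge0.
exists (2 * C * (pi - - pi) * (pi - - pi)), (L + 1); split; [by nneg|by rewrite ltr_wpDl|].
move=> n k.
have E : 2 * C * (pi - - pi) * (pi - - pi) * (L + 1) ^+ n = (L + 1) ^+ n * (2 * C) * (pi - - pi) * (pi - - pi).
  by ring.
rewrite E; apply: itg_norm_le => //.
  apply: continuous_cton; apply: (@continuous_slice1 _ (fun z => itg (- pi) pi (fun u => term t n (z, u)))).
  exact: (@itg_cont _ _ _ _ (term t n)).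
move=> s sI; apply: itg_norm_le => //.
  apply: continuous_cton => u; apply: (@cts_comp2 _ _ _ (term t n) (fun u => ((k, s), u))); first exact: cterm.
  by apply: cts_pair; [exact: cts_cst_|exact: cts_id].
move=> u uI; rewrite /term /=.
have bz : box (- pi) pi (- pi) pi (s, u) by split; rewrite /= in_itv.
have [h1 h2] := coefB n s.
have hC : `|fr s| + `|fi s| <= C.
  by have := HC _ bz; rewrite /= ger0_norm// addr_ge0.
rewrite normrM -[leRHS]mul1r; apply: ler_pM => //.
  by rewrite ger0_norm ?sqr_ge0// -(cos2Dsin2 u) lerDl sqr_ge0.
rewrite normrM; apply: ler_pM => //.
  rewrite normrX; apply: lerXn2r; rewrite ?nnegrE ?normr_ge0 ?addr_ge0//.
  by apply: (le_trans (HL _ bz)); rewrite lerDl.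
apply: (le_trans (ler_normD _ _)).
have -> : 2 * C = C * 1 + C * 1 by ring.
apply: lerD; rewrite normrM; apply: ler_pM => //.
- exact: le_trans hC.
- by rewrite ler_norml cos_geN1 cos_le1.
- exact: le_trans hC.
- by rewrite ler_norml sin_geN1 sin_le1.
Qed.

Lemma orthE (k t : R) :
  itg (- pi) pi (fun s => (fr s * cos (k * nS e g (s, t)) + fi s * sin (k * nS e g (s, t))) *
    bes (k * nN e g (s, t))) =
  itg (- pi) pi (fun s => itg (- pi) pi (fun u => cos u ^+ 2 *
    (fr s * cos (k * nS e g (s, t) + k * nN e g (s, t) * sin u) +
     fi s * sin (k * nS e g (s, t) + k * nN e g (s, t) * sin u)))).
Proof.
apply: itg_ext => s _; rewrite mulrDl -!mulrA -bes_phase -bes_phase_sin.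
rewrite -!itg_scale; [|by move=> u _; cts..].
rewrite -itg_add; [|by move=> u _; cts..].
by apply: itg_ext => u _; ring.
Qed.

Lemma orth_all (Z : set R) : infinite_set Z -> bounded_set Z ->
  (forall k, Z k -> orth e g fr fi k) -> forall k, orth e g fr fi k.
Proof.
move=> iZ bZ HZ k t.
have HE k' : itg (- pi) pi (fun s => (fr s * cos (k' * nS e g (s, t)) + fi s * sin (k' * nS e g (s, t))) *
    bes (k' * nN e g (s, t))) = H t 0 k'.
  rewrite orthE; apply: itg_ext => s _; apply: itg_ext => u _.
  have -> : k' * nS e g (s, t) + k' * nN e g (s, t) * sin u = k' * theta t s u by rewrite /theta; ring.
  by rewrite /term /= expr0 mul1r.
rewrite HE; have [C [L [C0 L0 B]]] := bH t.
apply: (identity_theorem (dH t) C0 L0 B iZ bZ) => x /HZ/(_ t).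
by rewrite HE.
Qed.

End OrthEntire.

(** * Partial derivatives and cut-off functions *)

Section Partial.
Context {R : realType}.
Implicit Types (f g : R * R -> R) (z : R * R).

Let quot1 f z : (fun h : R => h^-1 *: ((f \o shift z) (h *: ((1:R), (0:R))) - f z)) =
  (fun h : R => h^-1 *: (((fun s => f (s, z.2)) \o shift z.1) (h *: (1:R)) - f (z.1, z.2))).
Proof.
apply/funext => h; case: z => x y; congr (_ *: (f _ - _)).
rewrite /shift/=; transitivity (h *: (1 : R^o) + x, h *: (0 : R^o) + y); first by [].
by rewrite scaler0 add0r.
Qed.

Let quot2 f z : (fun h : R => h^-1 *: ((f \o shift z) (h *: ((0:R), (1:R))) - f z)) =
  (fun h : R => h^-1 *: (((fun s => f (z.1, s)) \o shift z.2) (h *: (1:R)) - f (z.1, z.2))).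
Proof.
apply/funext => h; case: z => x y; congr (_ *: (f _ - _)).
rewrite /shift/=; transitivity (h *: (0 : R^o) + x, h *: (1 : R^o) + y); first by [].
by rewrite scaler0 add0r.
Qed.

(** Along a basis vector the planar difference quotient reduces to the one-variable quotient, which
    makes the derivative rules for the line available. *)
Lemma d1E f z : d1 f z = 'D_1 (fun s => f (s, z.2)) z.1.
Proof. by rewrite /d1 /derive quot1. Qed.

Lemma d2E f z : d2 f z = 'D_1 (fun s => f (z.1, s)) z.2.
Proof. by rewrite /d2 /derive quot2. Qed.

Lemma d1_is_derive f (x y : R) : differentiable f (x, y) ->
  is_derive x 1 (fun s : R => f (s, y)) (d1 f (x, y)).
Proof.
move=> H; have df : derivable f (x, y) ((1:R), (0:R)) by exact: diff_derivable.
split; last by rewrite d1E.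
by move: df; rewrite /derivable quot1.
Qed.

Lemma d2_is_derive f (x y : R) : differentiable f (x, y) ->
  is_derive y 1 (fun s : R => f (x, s)) (d2 f (x, y)).
Proof.
move=> H; have df : derivable f (x, y) ((0:R), (1:R)) by exact: diff_derivable.
split; last by rewrite d2E.
by move: df; rewrite /derivable quot2.
Qed.

Lemma d1_val f z (d : R) : is_derive z.1 1 (fun s : R => f (s, z.2)) d -> d1 f z = d.
Proof. by move=> h; rewrite d1E (@derive_val _ _ _ _ _ _ _ h). Qed.

Lemma d2_val f z (d : R) : is_derive z.2 1 (fun s : R => f (z.1, s)) d -> d2 f z = d.
Proof. by move=> h; rewrite d2E (@derive_val _ _ _ _ _ _ _ h). Qed.

Lemma differentiable_fst z : differentiable (fun z : R * R => z.1) z.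
Proof. by apply: (@linear_differentiable _ _ _ fst) => x; exact: cvg_fst. Qed.

Lemma differentiable_snd z : differentiable (fun z : R * R => z.2) z.
Proof. by apply: (@linear_differentiable _ _ _ snd) => x; exact: cvg_snd. Qed.

Lemma differentiable_of_derive (h : R -> R) (x d : R) : is_derive x 1 h d -> differentiable h x.
Proof. by move=> dh; apply/derivable1_diffP; case: dh. Qed.

End Partial.

Section Cutoff.
Context {R : realType}.

(** Test functions are C^1, so the squared positive part is a sufficient building block. *)
Definition sqpos (x : R) : R := Num.max x 0 ^+ 2.

Lemma is_derive_sqpos (x : R) : is_derive x 1 sqpos (2 * Num.max x 0).
Proof.
suff H : (fun h => h^-1 *: ((sqpos \o shift x) (h *: 1) - sqpos x)) @ 0^' --> 2 * Num.max x 0.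
  by split; [apply/cvg_ex; eexists; exact: H|exact: cvg_lim H].
apply/cvgrPdist_le => e e0; near=> h.
have h0 : h != 0 by near: h; exact: nbhs_dnbhs_neq.
have he : `|h| <= e.
  near: h; apply: dnbhs0_le; exact: e0.
apply: (le_trans _ he); rewrite /GRing.scale/= mulr1.
have K : `|sqpos (h + x) - sqpos x - 2 * Num.max x 0 * h| <= `|h| ^+ 2.
  rewrite real_normK ?num_real// /sqpos.
  by rewrite ler_norml; have [a|a] := leP x 0; have [b|b] := leP (h + x) 0; apply/andP; split; nra.
have -> : 2 * Num.max x 0 - h^-1 * (sqpos (h + x) - sqpos x) =
    - (h^-1 * (sqpos (h + x) - sqpos x - 2 * Num.max x 0 * h)) by field.
by rewrite normrN normrM normfV ler_pdivrMl ?normr_gt0.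
Unshelve. all: by end_near. Qed.

Lemma continuous_sqpos : continuous sqpos.
Proof. by move=> x; exact: (is_derive_continuous (is_derive_sqpos x)). Qed.

Lemma continuous_max0 : continuous (fun x : R => Num.max x 0).
Proof.
have -> : (fun x : R => Num.max x 0) = (fun x : R => (x + `|x|) / 2).
  by apply/funext => x; have [h|h] := leP x 0; [rewrite ler0_norm//|rewrite gtr0_norm//]; field.
pose nm (x : R) := `|x|; have cn : continuous nm := @norm_continuous R R^o.
change (continuous (fun x : R => (x + nm x) / 2)); by move=> x; cts.
Qed.

Variable N : R.
Hypothesis N0 : 0 < N.

(** A C^1 cut-off: both inner terms vanish for |t| <= N, which gives the value 1, and one of them is
    at least 1 for |t| >= N + 1, which gives 0. *)
Definition plateau (t : R) : R := sqpos (1 - sqpos (t - N) - sqpos (- t - N)).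

Definition dplateau (t : R) : R := 2 * Num.max (1 - sqpos (t - N) - sqpos (- t - N)) 0 *
  (2 * Num.max (- t - N) 0 - 2 * Num.max (t - N) 0).

Lemma is_derive_plateau (t : R) : is_derive t 1 plateau (dplateau t).
Proof.
have d1 (s : R) : is_derive s 1 (fun t => sqpos (t - N)) (2 * Num.max (s - N) 0).
  have := @is_derive_compf _ sqpos (fun t => t - N) s _ _ (is_derive_sqpos _) _.
  by move=> H; apply: (is_derive_eq (H 1 _)); [derive_with; ring|rewrite mulr1].
have d2 (s : R) : is_derive s 1 (fun t => sqpos (- t - N)) (- (2 * Num.max (- s - N) 0)).
  have := @is_derive_compf _ sqpos (fun t => - t - N) s _ _ (is_derive_sqpos _) _.
  by move=> H; apply: (is_derive_eq (H (-1) _)); [derive_with; ring|rewrite mulrN1].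
have := @is_derive_compf _ sqpos (fun t => 1 - sqpos (t - N) - sqpos (- t - N)) t _ _ (is_derive_sqpos _) _.
move=> H; apply: (is_derive_eq (H (2 * Num.max (- t - N) 0 - 2 * Num.max (t - N) 0) _)) => //.
have {}d1 := d1 t; have {}d2 := d2 t.
by derive_with; ring.
Qed.

Lemma continuous_plateau : continuous plateau.
Proof. by move=> x; exact: (is_derive_continuous (is_derive_plateau x)). Qed.

Lemma continuous_dplateau : continuous dplateau.
Proof.
pose m (x : R) := Num.max x 0.
have cm : continuous m := continuous_max0.
have cs : continuous sqpos := continuous_sqpos.
change (continuous (fun t => 2 * m (1 - sqpos (t - N) - sqpos (- t - N)) * (2 * m (- t - N) - 2 * m (t - N)))).
by move=> t; cts.
Qed.

Lemma plateau1 (t : R) : - N <= t <= N -> plateau t = 1.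
Proof.
move=> /andP[h1 h2]; rewrite /plateau /sqpos.
have /max_idPr -> : t - N <= 0 by lra.
have /max_idPr -> : - t - N <= 0 by lra.
rewrite expr0n/= !subr0.
by have /max_idPl -> : 0 <= 1 :> R by []; rewrite expr1n.
Qed.

Lemma dplateau0 (t : R) : - N <= t <= N -> dplateau t = 0.
Proof.
move=> /andP[h1 h2]; rewrite /dplateau.
have /max_idPr -> : t - N <= 0 by lra.
have /max_idPr -> : - t - N <= 0 by lra.
by rewrite !mulr0 subr0 mulr0.
Qed.

Lemma plateau_out (t : R) : ~ (- (N + 1) <= t <= N + 1) -> plateau t = 0.
Proof.
move=> /negP; rewrite negb_and -!ltNge => h; rewrite {1}/plateau {1}/sqpos.
suff /max_idPr -> : 1 - sqpos (t - N) - sqpos (- t - N) <= 0 by rewrite expr0n.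
have s0 (x : R) : 0 <= sqpos x by exact: sqr_ge0.
have s1 (x : R) : 1 <= x -> 1 <= sqpos x.
  by move=> x1; rewrite /sqpos (max_idPl _) ?expr_ge1// ?(le_trans _ x1)//.
have := s0 (t - N); have := s0 (- t - N).
case/orP: h => h.
  by have := s1 (- t - N); move=> /(_ ltac:(lra)); lra.
by have := s1 (t - N); move=> /(_ ltac:(lra)); lra.
Qed.

End Cutoff.

(** * From the weak formulation to orthogonality with plane waves *)

Definition summable2 {R : realType} (D : set (R * R)) (f : R * R -> R) : Prop :=
  (@leb2 R).-integrable D (EFin \o f).

Definition itg2 {R : realType} (D : set (R * R)) (f : R * R -> R) : R :=
  \int[@leb2 R]_(z in D) f z.

Section Itg2.
Context {R : realType}.
Variables (D : set (R * R)) (N : R).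
Hypotheses (mD : measurable D) (DN : D `<=` box (- N) N (- N) N).
Implicit Types (f g : R * R -> R).

Lemma summable2_add f g : summable2 D f -> summable2 D g -> summable2 D (fun z => f z + g z).
Proof. by move=> sf sg; exact: (@integrableD _ _ _ (@leb2 R) D mD _ _ sf sg). Qed.

Lemma summable2_scale (k : R) f : summable2 D f -> summable2 D (fun z => k * f z).
Proof. by move=> sf; exact: (@integrableZl _ _ _ (@leb2 R) D mD k _ sf). Qed.

Lemma summable2_sub f g : summable2 D f -> summable2 D g -> summable2 D (fun z => f z - g z).
Proof. by move=> sf sg; exact: (@integrableB _ _ _ (@leb2 R) D mD _ _ sf sg). Qed.

Lemma summable2_measurable f : summable2 D f -> measurable_fun D f.
Proof. by move=> /measurable_int/measurable_EFinP. Qed.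

Lemma summable2_le f g : measurable_fun D f -> (forall z, D z -> `|f z| <= g z) ->
  summable2 D g -> summable2 D f.
Proof.
move=> mf fg; apply: (@le_integrable _ _ _ (@leb2 R) D mD) => //; first exact/measurable_EFinP.
by move=> z Dz; rewrite /= lee_fin (le_trans (fg z Dz))// ler_norm.
Qed.

Lemma summable2_bounded f (M : R) : measurable_fun D f -> (forall z, D z -> `|f z| <= M) ->
  summable2 D f.
Proof. by move=> mf fM; exact: (bounded_leb2_integrable mD DN mf fM). Qed.

Lemma itg2_add f g : summable2 D f -> summable2 D g ->
  itg2 D (fun z => f z + g z) = itg2 D f + itg2 D g.
Proof. by move=> sf sg; exact: (@RintegralD _ _ _ (@leb2 R) D _ _ mD sf sg). Qed.

Lemma itg2_sub f g : summable2 D f -> summable2 D g ->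
  itg2 D (fun z => f z - g z) = itg2 D f - itg2 D g.
Proof. by move=> sf sg; exact: (@RintegralB _ _ _ (@leb2 R) D _ _ mD sf sg). Qed.

Lemma itg2_scale (k : R) f : summable2 D f -> itg2 D (fun z => k * f z) = k * itg2 D f.
Proof. by move=> sf; exact: (@RintegralZl _ _ _ (@leb2 R) D _ k mD sf). Qed.

Lemma itg2_norm_le f g : summable2 D f -> summable2 D g -> (forall z, D z -> `|f z| <= g z) ->
  `|itg2 D f| <= itg2 D g.
Proof.
move=> sf sg fg; apply: (le_trans (@le_normr_Rintegral _ _ _ (@leb2 R) D _ mD sf)).
apply: (@le_Rintegral _ _ _ (@leb2 R) D _ _ mD) => //.
have mf := summable2_measurable sf.
apply: summable2_le sg; first exact: measurableT_comp.
by move=> z Dz; rewrite normr_id; exact: fg.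
Qed.

(** The set [D] is bounded, so constants are summable and |f g| <= |M| (1 + f^2) suffices. *)
Lemma L2_summable_mul f g (M : R) : L2 D f -> measurable_fun D g ->
  (forall z, D z -> `|g z| <= M) -> summable2 D (fun z => f z * g z).
Proof.
move=> [mf f2] mg gM.
have s1 : summable2 D (fun z => `|M| * (1 + f z ^+ 2)).
  apply: summable2_scale; apply: summable2_add => //.
  by apply: (@summable2_bounded _ 1) => // z _; rewrite normr1.
apply: summable2_le s1; first exact: measurable_funM.
move=> z Dz; rewrite normrM mulrC; apply: ler_pM => //.
  exact: le_trans (gM z Dz) (ler_norm _).
by rewrite -(real_normK (num_real (f z))); nra.
Qed.

Lemma L2_sub f g : L2 D f -> L2 D g -> L2 D (fun z => f z - g z).
Proof.
move=> [mf f2] [mg g2]; split; first exact: measurable_funB.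
have s1 : summable2 D (fun z => 2 * (f z ^+ 2 + g z ^+ 2)).
  by apply: summable2_scale; exact: summable2_add.
apply: summable2_le s1; first by apply: measurable_funX; exact: measurable_funB.
by move=> z Dz; rewrite ger0_norm ?sqr_ge0//; have := sqr_ge0 (f z + g z); lra.
Qed.

Lemma L2_bounded f (M : R) : measurable_fun D f -> (forall z, D z -> `|f z| <= M) -> L2 D f.
Proof.
move=> mf fM; split => //; apply: (@summable2_bounded _ (M ^+ 2)).
  exact: measurable_funX.
by move=> z Dz; rewrite normrX; apply: lerXn2r; rewrite ?nnegrE ?(le_trans _ (fM z Dz))// fM.
Qed.

Lemma L2_continuous f : continuous f -> L2 D f.
Proof.
move=> cf; have [M HM] := @box_bound _ f (- N) N (- N) N cf.
apply: (@L2_bounded _ M); last by move=> z /DN; exact: HM.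
by apply: measurable_funTS; exact: continuous2_measurable.
Qed.

Lemma itg2_box f : continuous f -> (forall z, ~ D z -> f z = 0) ->
  itg2 D f = itg2 (box (- N) N (- N) N) f.
Proof.
move=> cf f0; rewrite /itg2 Rintegral_mkcond [RHS]Rintegral_mkcond; congr Rintegral.
apply/funext => z; rewrite /patch; case: ifPn => zD; case: ifPn => zB //.
  by move: zB; rewrite notin_setE => -[]; apply: DN; rewrite -inE.
by rewrite f0//; move: zD; rewrite notin_setE.
Qed.

End Itg2.

Section NonScatteringOrthogonality.
Context {R : realType}.
Variables (D : set (R * R)) (N : R).
Hypotheses (mD : measurable D) (N0 : 0 < N).
Hypothesis DN : forall z, D z -> (- N < z.1 < N) /\ (- N < z.2 < N).
Variables (A B T : R).

Let DB : D `<=` box (- N) N (- N) N.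
Proof. by move=> z /DN[/andP[a b] /andP[c d]]; split; rewrite /= in_itv/= !ltW. Qed.

(** The free constant [T] lets the same plane wave be a cosine or a sine. *)
Let ph (z : R * R) : R := T + (A * z.1 + B * z.2).
Let W (z : R * R) : R := cos (ph z).
Let V (z : R * R) : R := sin (ph z).

Let cW : continuous W. Proof. by move=> z; rewrite /W /ph; cts. Qed.
Let cV : continuous V. Proof. by move=> z; rewrite /V /ph; cts. Qed.

(** The cut-off acts outside a box containing [D]: the plane wave becomes an admissible test
    function and is unchanged on [D]. *)
Let psi (z : R * R) : R := W z * (plateau N z.1 * plateau N z.2).

Let diff_ph z : differentiable ph z.
Proof.
apply: differentiableD; first exact: differentiable_cst.
by apply: differentiableD; apply: differentiableM; (try exact: differentiable_cst);
  [exact: differentiable_fst|exact: differentiable_snd].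
Qed.

Let diff_W z : differentiable W z.
Proof.
apply: (@differentiable_comp _ _ _ _ ph cos); first exact: diff_ph.
exact: differentiable_of_derive (is_derive_cos _).
Qed.

Let d1psi z : d1 psi z = - A * V z * (plateau N z.1 * plateau N z.2) + W z * (dplateau N z.1 * plateau N z.2).
Proof.
apply: d1_val; rewrite /psi /W /V /ph/=.
have db := is_derive_plateau N z.1.
by derive_with; ring.
Qed.

Let d2psi z : d2 psi z = - B * V z * (plateau N z.1 * plateau N z.2) + W z * (plateau N z.1 * dplateau N z.2).
Proof.
apply: d2_val; rewrite /psi /W /V /ph/=.
have db := is_derive_plateau N z.2.
by derive_with; ring.
Qed.

Let C1c_psi : C1c setT psi.
Proof.
have cb := @continuous_plateau _ N; have cdb := @continuous_dplateau _ N.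
have cW' := cW; have cV' := cV.
split.
- move=> z; apply: differentiableM; first exact: diff_W.
  apply: differentiableM.
    apply: (@differentiable_comp _ _ _ _ fst (plateau N)); first exact: differentiable_fst.
    exact: differentiable_of_derive (is_derive_plateau _ _).
  apply: (@differentiable_comp _ _ _ _ snd (plateau N)); first exact: differentiable_snd.
  exact: differentiable_of_derive (is_derive_plateau _ _).
- by rewrite (funext d1psi) => z; cts.
- by rewrite (funext d2psi) => z; cts.
- exists (box (- (N + 1)) (N + 1) (- (N + 1)) (N + 1)); split => //; first exact: compact_box.
  move=> z zB; rewrite /psi.
  have [h|/(@plateau_out _ N) ->] := pselect (- (N + 1) <= z.1 <= N + 1); last by rewrite mul0r mulr0.
  have [h'|/(@plateau_out _ N) ->] := pselect (- (N + 1) <= z.2 <= N + 1); last by rewrite !mulr0.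
  by case: zB; split; rewrite /= in_itv.
Qed.

Let psi_D z : D z -> [/\ psi z = W z, d1 psi z = - A * V z & d2 psi z = - B * V z].
Proof.
move=> /DN[/andP[a b] /andP[c d]].
have h1 : - N <= z.1 <= N by rewrite !ltW.
have h2 : - N <= z.2 <= N by rewrite !ltW.
by rewrite d1psi d2psi /psi !plateau1// !dplateau0//; split; ring.
Qed.

Let K := A ^+ 2 + B ^+ 2.

Lemma C1c_zero f : C1c D f -> forall z, ~ D z -> [/\ f z = 0, d1 f z = 0 & d2 f z = 0].
Proof.
move=> [df _ _ [C [cC CD f0]]] z nDz.
have nC : ~ C z by move/CD.
have oC : nbhs z (~` C).
  by apply: open_nbhs_nbhs; split => //; rewrite openC; apply: compact_closed => //; exact: norm_hausdorff.
have nf : \forall w \near z, f w = cst 0 w by apply: filterS oC => w; exact: f0.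
by split; [exact: f0|rewrite /d1 (near_eq_derive _ nf) ?derive_cst|rewrite /d2 (near_eq_derive _ nf) ?derive_cst].
Qed.

(** A function in [C1c D] vanishes with its derivatives outside [D], so the integral extends to a
    box, where Fubini and the fundamental theorem of calculus replace the divergence theorem on
    [D]. *)
Let green f : C1c D f ->
  itg2 D (fun z => d1 f z * (- A * V z) + d2 f z * (- B * V z) - K * f z * W z) = 0.
Proof.
move=> Cf; have [df c1 c2 _] := Cf.
have cW' := cW; have cV' := cV.
have cf : continuous f by move=> z; exact: differentiable_continuous.
have NN : - N <= N by apply: ltW; rewrite (lt_trans _ N0)// oppr_lt0.
have edge x y : ~ (- N < x < N) \/ ~ (- N < y < N) -> f (x, y) = 0.
  by move=> h; have [] := @C1c_zero f Cf (x, y) _ => // /DN[] /=; tauto.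
pose E1 z := d1 f z * (- A * V z) + f z * (- A * (A * W z)).
pose E2 z := d2 f z * (- B * V z) + f z * (- B * (B * W z)).
have cE1 : continuous E1 by move=> z; rewrite /E1; cts.
have cE2 : continuous E2 by move=> z; rewrite /E2; cts.
have i1 : itg2 D E1 = 0.
  rewrite (itg2_box DB) //; last first.
    by move=> z /(C1c_zero Cf)[h1 h2 _]; rewrite /E1 h1 h2 !mul0r addr0.
  rewrite /itg2 /Rintegral leb2_box_itg2//=.
  rewrite (@itg_ext _ _ _ _ (fun=> 0)) ?itg_cst ?mul0r// => y _.
  have dF (x : R) : - N <= x <= N -> is_derive x 1 (fun x => f (x, y) * (- A * V (x, y))) (E1 (x, y)).
    move=> _; have d := d1_is_derive (df (x, y)).
    by rewrite /E1 /V /W /ph/=; derive_with; ring.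
  rewrite (itg_FTC NN dF); last by apply: continuous_cton; exact: continuous_slice2.
  by rewrite !edge ?mul0r ?subr0//; left; rewrite ltxx ?andbF.
have i2 : itg2 D E2 = 0.
  rewrite (itg2_box DB) //; last first.
    by move=> z /(C1c_zero Cf)[h1 _ h2]; rewrite /E2 h1 h2 !mul0r addr0.
  rewrite /itg2 /Rintegral leb2_box_itg1//=.
  rewrite (@itg_ext _ _ _ _ (fun=> 0)) ?itg_cst ?mul0r// => x _.
  have dF (y : R) : - N <= y <= N -> is_derive y 1 (fun y => f (x, y) * (- B * V (x, y))) (E2 (x, y)).
    move=> _; have d := d2_is_derive (df (x, y)).
    by rewrite /E2 /V /W /ph/=; derive_with; ring.
  rewrite (itg_FTC NN dF); last by apply: continuous_cton; exact: continuous_slice1.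
  by rewrite !edge ?mul0r ?subr0//; right; rewrite ltxx ?andbF.
have sc g : continuous g -> summable2 D g.
  move=> cg; have [M HM] := @box_bound _ g (- N) N (- N) N cg.
  apply: (summable2_bounded mD DB (M := M)); last by move=> z /DB; exact: HM.
  by apply: measurable_funTS; exact: continuous2_measurable.
rewrite -[RHS](addr0 (0 : R)) -{1}i1 -i2 -itg2_add//; [|exact: sc..].
congr (itg2 D _); apply/funext => z; rewrite /E1 /E2 /K; ring.
Qed.

(** Takes the place of the Cauchy-Schwarz inequality: with [t] of the size of the error, a small
    integral of x^2 gives a small integral of |x|. *)
Let le_sq (t x : R) : 0 < t -> `|x| <= t + x ^+ 2 / t.
Proof.
move=> t0; rewrite -(ler_pM2l t0) mulrDr -(real_normK (num_real x)).
have -> : t * (`|x| ^+ 2 / t) = `|x| ^+ 2 by field; rewrite gt_eqF.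
have := sqr_ge0 (t - `|x|); have := normr_ge0 x; have := mulr_ge0 (ltW t0) (normr_ge0 x); nra.
Qed.

Let le_part (t p1 p2 p3 : R) : 0 <= t -> 0 <= p1 -> 0 <= p2 -> 0 <= p3 ->
  [/\ t + p1 <= 3 * t * 1 + (p1 + p2 + p3), t + p2 <= 3 * t * 1 + (p1 + p2 + p3)
    & t + p3 <= 3 * t * 1 + (p1 + p2 + p3)].
Proof. by move=> *; split; lra. Qed.

Let le_one (x : R) : `|x| <= 1 -> forall y : R, `|y * x| <= `|y|.
Proof. by move=> x1 y; rewrite normrM ler_piMr. Qed.

(** With K = k^2 q the wave solves Delta W + K W = 0, and testing with it gives form(u - v) = (K -
    k^2) int v W. As u - v is a limit of functions compactly supported in [D], the left side is 0 by
    [green], while K - k^2 = k^2 (q - 1) is nonzero. *)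
Lemma nonscat_real_orth (k q : R) (v : R * R -> R) :
  k != 0 -> q != 1 -> A ^+ 2 + B ^+ 2 = k ^+ 2 * q -> nonscat_real D k q v ->
  L2 D v /\ itg2 D (fun z => v z * W z) = 0.
Proof.
move=> k0 q1 KE [u [g1 [g2 [[Lu Lg1 Lg2 _] [[Lf Lf1 Lf2 _] [f [Cf f_lim]]] H]]]].
(* Square integrability of [v] and its derivatives is recovered from that of u and u - v. *)
have Lsub (x y : R * R -> R) : L2 D x -> L2 D (fun z => x z - y z) -> L2 D y.
  move=> Lx Lxy; have := L2_sub mD Lx Lxy; congr (L2 D _); apply/funext => z; ring.
have Lv := Lsub _ _ Lu Lf; have Lv1 := Lsub _ _ Lg1 Lf1; have Lv2 := Lsub _ _ Lg2 Lf2.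
split => //.
have mc (g : R * R -> R) : continuous g -> measurable_fun D g.
  by move=> cg; apply: measurable_funTS; exact: continuous2_measurable.
have sW (g : R * R -> R) : L2 D g -> summable2 D (fun z => g z * W z).
  move=> Lg; apply: (L2_summable_mul mD DB Lg (mc _ cW) (M := 1)) => z _.
  by rewrite ler_norml cos_geN1 cos_le1.
have sV (g : R * R -> R) : L2 D g -> summable2 D (fun z => g z * V z).
  move=> Lg; apply: (L2_summable_mul mD DB Lg (mc _ cV) (M := 1)) => z _.
  by rewrite ler_norml sin_geN1 sin_le1.
pose form (x y w : R * R -> R) (z : R * R) : R := (- A) * (x z * V z) + (- B) * (y z * V z) - K * (w z * W z).
have sform x y w : L2 D x -> L2 D y -> L2 D w -> summable2 D (form x y w).
  move=> Lx Ly Lw; apply: summable2_sub => //; last by apply: summable2_scale => //; exact: sW.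
  by apply: summable2_add => //; apply: summable2_scale => //; exact: sV.
have E1 : itg2 D (form g1 g2 u) = itg2 D (fun z => form (d1 v) (d2 v) v z + (K - k ^+ 2) * (v z * W z)).
  rewrite /itg2 /Rintegral; congr fine; have := H psi C1c_psi.
  move=> h; apply: (etrans (etrans _ h) _); apply: eq_integral => z; rewrite inE => /psi_D[h1 h2 h3].
    by congr EFin; rewrite h1 h2 h3 /form /K KE; ring.
  by congr EFin; rewrite h1 h2 h3 /form; ring.
have E2 : itg2 D (form (fun z => g1 z - d1 v z) (fun z => g2 z - d2 v z) (fun z => u z - v z)) =
    (K - k ^+ 2) * itg2 D (fun z => v z * W z).
  have -> : form (fun z => g1 z - d1 v z) (fun z => g2 z - d2 v z) (fun z => u z - v z) =
      fun z => form g1 g2 u z - form (d1 v) (d2 v) v z.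
    by apply/funext => z; rewrite /form; ring.
  rewrite itg2_sub//; [|exact: sform..].
  rewrite E1 itg2_add//; [|exact: sform|by apply: summable2_scale => //; exact: sW].
  rewrite itg2_scale//; [ring|exact: sW].
suff E0 : itg2 D (form (fun z => g1 z - d1 v z) (fun z => g2 z - d2 v z) (fun z => u z - v z)) = 0.
  move: E2; rewrite E0 => /esym/eqP; rewrite mulf_eq0 => /orP[|/eqP//].
  have -> : K - k ^+ 2 = k ^+ 2 * (q - 1) by rewrite /K KE; ring.
  by rewrite mulf_eq0 expf_eq0/= (negPf k0) subr_eq0 (negPf q1).
set a := (fun z => g1 z - d1 v z) in Lf1 f_lim *; set b := (fun z => g2 z - d2 v z) in Lf2 f_lim *.
set c := (fun z => u z - v z) in Lf f_lim *.
pose m := itg2 D (fun=> 1).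
have s1 : summable2 D (fun=> 1) by apply: (summable2_bounded mD DB (M := 1)) => // z _; rewrite normr1.
have m0 : 0 <= m by apply: Rintegral_ge0.
pose M := `|A| + `|B| + `|K|.
have M0 : 0 <= M by rewrite !addr_ge0.
(* An approximant with squared error below t^2 is subtracted, and [le_sq] with this [t], applied to
   the three error terms, bounds the rest by M (3 t m + t^2 / t). *)
have bound (t : R) : 0 < t -> `|itg2 D (form a b c)| <= t * (M * (3 * m + 1)).
  move=> t0.
  have t2 : 0 < t ^+ 2 by rewrite exprn_gt0.
  have /fine_cvgP[_ /cvgrPdist_lt/(_ _ t2)] := f_lim.
  have /fine_cvgP[fin _] := f_lim.
  move=> /(filterI fin)[n _ /(_ n (leqnn n))[/= finn]].
  set I := (X in fine X) => small.
  have [dfn c1 c2 _] := Cf n.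
  have Lfn : L2 D (f n) by apply: (L2_continuous mD DB) => z; exact: differentiable_continuous.
  have Lfn1 : L2 D (d1 (f n)) := L2_continuous mD DB c1.
  have Lfn2 : L2 D (d2 (f n)) := L2_continuous mD DB c2.
  pose x z := a z - d1 (f n) z; pose y z := b z - d2 (f n) z; pose w z := c z - f n z.
  have Lx : L2 D x := L2_sub mD Lf1 Lfn1.
  have Ly : L2 D y := L2_sub mD Lf2 Lfn2.
  have Lw : L2 D w := L2_sub mD Lf Lfn.
  have -> : itg2 D (form a b c) = itg2 D (form x y w).
    have -> : form x y w = fun z => form a b c z -
        (d1 (f n) z * (- A * V z) + d2 (f n) z * (- B * V z) - K * f n z * W z).
      by apply/funext => z; rewrite /form /x /y /w; ring.
    rewrite itg2_sub// ?green ?subr0//; first exact: sform.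
    have := sform _ _ _ Lfn1 Lfn2 Lfn; congr (summable2 D _).
    by apply/funext => z; rewrite /form; ring.
  pose sq z := w z ^+ 2 + x z ^+ 2 + y z ^+ 2.
  have ssq : summable2 D sq.
    by apply: summable2_add => //; [apply: summable2_add => //; [exact: Lw.2|exact: Lx.2]|exact: Ly.2].
  have sqI : itg2 D sq < t ^+ 2.
    by move: small; rewrite sub0r normrN; apply: le_lt_trans; exact: ler_norm.
  have pw z : D z -> `|form x y w z| <= M * (3 * t * 1 + t^-1 * sq z).
    move=> _; rewrite /form.
    have V1 : `|V z| <= 1 by rewrite ler_norml sin_geN1 sin_le1.
    have W1 : `|W z| <= 1 by rewrite ler_norml cos_geN1 cos_le1.
    have sqz : w z ^+ 2 / t + x z ^+ 2 / t + y z ^+ 2 / t = t^-1 * sq z by rewrite /sq; ring.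
    have [q1' q2 q3] : [/\ 0 <= w z ^+ 2 / t, 0 <= x z ^+ 2 / t & 0 <= y z ^+ 2 / t].
      by split; apply: divr_ge0; rewrite ?sqr_ge0// ltW.
    pose Z := 3 * t * 1 + t^-1 * sq z.
    have [pw px py] := le_part (ltW t0) q1' q2 q3; rewrite sqz -/Z in pw px py.
    have b1 : `|x z * V z| <= Z := le_trans (le_one V1 _) (le_trans (le_sq _ t0) px).
    have b2 : `|y z * V z| <= Z := le_trans (le_one V1 _) (le_trans (le_sq _ t0) py).
    have b3 : `|w z * W z| <= Z := le_trans (le_one W1 _) (le_trans (le_sq _ t0) pw).
    apply: (le_trans (ler_normB _ _)).
    apply: (le_trans (lerD (ler_normD _ _) (lexx _))).
    rewrite (normrM (- A)) (normrM (- B)) (normrM K) !normrN -/Z /M (mulrDl _ _ Z) (mulrDl _ _ Z).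
    by apply: lerD; [apply: lerD|]; exact: ler_wpM2l.
  apply: (le_trans (itg2_norm_le mD (sform _ _ _ Lx Ly Lw) _ pw)).
    by apply: summable2_scale => //; apply: summable2_add => //; exact: summable2_scale.
  rewrite itg2_scale//; last by apply: summable2_add => //; exact: summable2_scale.
  rewrite itg2_add//; [|exact: summable2_scale..].
  rewrite !itg2_scale// -/m mulrCA; apply: ler_wpM2l => //.
  have : t^-1 * itg2 D sq <= t by rewrite ler_pdivrMl// -expr2 ltW.
  lra.
apply/eqP; rewrite -normr_le0; apply/ler_addgt0Pr => e e0; rewrite add0r.
have p0 : 0 < M * (3 * m + 1) + 1 by rewrite ltr_wpDl// mulr_ge0// addr_ge0// mulr_ge0.
have t0 : 0 < e / (M * (3 * m + 1) + 1) by rewrite divr_gt0.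
apply: (le_trans (bound _ t0)); rewrite mulrAC ler_pdivrMr// ler_pM2l// lerDl//.
Qed.

End NonScatteringOrthogonality.

(** * Periodic integrals and the Fourier transform of the disc *)

Section PeriodicIntegral.
Context {R : realType}.
Variable f : R -> R.
Hypotheses (cf : continuous f) (pf : forall x : R, f (x + 2 * pi) = f x).

(** For a primitive [F], the difference F (x + 2 pi) - F x has derivative 0. *)
Lemma itg_periodic (a : R) : itg a (a + 2 * pi) f = itg (- pi) pi f.
Proof.
have P0 := pi_gt0 R; have a0 := normr_ge0 a; have aN := ler_norm (- a); have aP := ler_norm a.
rewrite normrN in aN.
have [F dF] := primitive_exists (- (`|a| + pi)) (`|a| + 3 * pi) cf.
pose H (x : R) := F (x + 2 * pi) - F x.
have dH (x : R) : - (`|a| + pi) <= x <= `|a| + pi -> is_derive x 1 H 0.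
  move=> /andP[x1 x2].
  have h1 := dF x _; have h2 := dF (x + 2 * pi) _.
  have {}h1 : is_derive x 1 F (f x) by apply: h1; apply/andP; split; lra.
  have {}h2 : is_derive (x + 2 * pi) 1 F (f (x + 2 * pi)) by apply: h2; apply/andP; split; lra.
  have h3 : is_derive x 1 (fun x => x + 2 * pi) 1 by derive_with; ring.
  have h4 := @is_derive_compf _ F (fun x => x + 2 * pi) x _ _ h2 h3.
  by rewrite /H; derive_with; rewrite pf; ring.
have cH (x y : R) : - (`|a| + pi) <= x -> x <= y -> y <= `|a| + pi -> H x = H y.
  move=> h1 h2 h3; apply/esym/eqP; rewrite -subr_eq0; apply/eqP.
  have dHxy (z : R) : x <= z <= y -> is_derive z 1 H 0.
    by move=> /andP[? ?]; apply: dH; apply/andP; split; lra.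
  by rewrite -(itg_FTC h2 dHxy) ?itg_cst ?mul0r//; apply: continuous_cton => z; cts.
have EH (b : R) : - (`|a| + pi) <= b -> b <= `|a| + pi -> itg b (b + 2 * pi) f = H b.
  move=> h1 h2; have b2 : b <= b + 2 * pi by lra.
  have dFb (x : R) : b <= x <= b + 2 * pi -> is_derive x 1 F (f x).
    by move=> /andP[? ?]; apply: dF; apply/andP; split; lra.
  by rewrite (itg_FTC b2 dFb) //; exact: continuous_cton.
have -> : itg (- pi) pi f = itg (- pi) (- pi + 2 * pi) f by congr itg; ring.
rewrite !EH; [|lra..].
by have [h|h] := leP a (- pi); [apply: cH|apply/esym; apply: cH]; lra.
Qed.

Lemma itg_periodic_shift (a : R) : itg (- pi) pi (fun x => f (x + a)) = itg (- pi) pi f.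
Proof.
have P0 := pi_gt0 R.
have dphi (x : R) : - pi <= x <= pi -> is_derive x 1 (fun x => x + a) 1.
  by move=> _; derive_with; ring.
have c1 : cton (- pi) pi (fun _ : R => 1 : R) by apply: continuous_cton => x; cts.
have ab : - pi + a <= - pi + a + 2 * pi by lra.
rewrite -(itg_periodic (- pi + a)) (@itg_subst _ (- pi) pi _ _ f _ _ (@Npi_le_pi R) cf dphi c1 ab) //; last by ring.
by apply: itg_ext => x _; rewrite mulr1.
Qed.

(** The arc [pi / 2, 3 pi / 2] is reflected onto [- pi / 2, pi / 2] by u -> pi - u. *)
Lemma itg_periodic_fold :
  itg (- (pi / 2)) (pi / 2) (fun u => f u + f (pi - u)) = itg (- pi) pi f.
Proof.
have P0 := pi_gt0 R.
rewrite itg_add; [|exact: continuous_cton|by apply: continuous_cton => u; cts].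
rewrite -(itg_periodic (- (pi / 2))) (@itg_cat _ _ (pi / 2) (- (pi / 2) + 2 * pi)); [|lra|lra|exact: continuous_cton].
congr (_ + _); rewrite [RHS](itg_reflect pi) //; last lra.
have -> : pi - (- (pi / 2) + 2 * pi) = - (pi / 2) :> R by lra.
by have -> : pi - pi / 2 = pi / 2 :> R by lra.
Qed.

End PeriodicIntegral.

Section HalfDiscFourier.
Context {R : realType}.

Lemma sin_add2pi (x : R) : sin (x + 2 * pi) = sin x.
Proof. by rewrite mulr_natl sinD2pi. Qed.

Lemma cos_add2pi (x : R) : cos (x + 2 * pi) = cos x.
Proof. by rewrite mulr_natl cosD2pi. Qed.

Lemma bes_opp (x : R) : bes (- x) = bes x.
Proof. by apply: itg_ext => u _; rewrite mulNr cosN. Qed.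

(* Integration by parts removes the weight: the derivative of
   [- cos w * sin (T + p * sin w)] is
   [sin w * sin (T + p * sin w) - p * cos w ^+ 2 * cos (T + p * sin w)]. *)
Lemma itg_cos_sin_phase (T p c s : R) : p != 0 ->
  itg (- pi) pi (fun w => (c * cos w + s * sin w) * sin (T + p * sin w)) = s * p * (cos T * bes p).
Proof.
move=> p0; rewrite -bes_phase.
pose F w := - (c / p * cos (T + p * sin w)) - s * (cos w * sin (T + p * sin w)).
pose dF w := (c * cos w + s * sin w) * sin (T + p * sin w) - s * p * (cos w ^+ 2 * cos (T + p * sin w)).
have cdF : continuous dF by move=> w; rewrite /dF; cts.
have dFP (w : R) : - pi <= w <= pi -> is_derive w 1 F (dF w).
  by move=> _; rewrite /F /dF; derive_with; field.
have : itg (- pi) pi dF = 0.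
  rewrite (itg_FTC (@Npi_le_pi R) dFP); last exact: continuous_cton.
  by rewrite /F sinN cosN sinpi oppr0 subrr.
rewrite /dF itg_sub; [|by apply: continuous_cton => w; cts..].
rewrite [X in _ - X]itg_scale; last by apply: continuous_cton => w; cts.
by move/eqP; rewrite subr_eq0 => /eqP.
Qed.

(** The Fourier transform of the unit disc in coordinates (cos u * y, sin u), with area element
    cos^2 u du dy. Integration in [y] leaves two boundary terms that combine into an integral over
    the whole circle; there a rotation aligns (p, r) with an axis, so only its norm [n] remains. *)
Lemma half_disc_fourier (T p r n : R) : n ^+ 2 = p ^+ 2 + r ^+ 2 ->
  itg (- (pi / 2)) (pi / 2) (fun u => itg (- 1) 1 (fun y =>
    cos u ^+ 2 * cos (T + p * sin u + r * cos u * y))) = cos T * bes n.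
Proof.
(* Integration in [y] divides by [r], so r = 0 is treated apart; then n = p up to sign, and [bes] is
   even. *)
move=> nE; have [r0|r0] := eqVneq r 0.
  have -> : bes n = bes p.
    have /eqP : n ^+ 2 = p ^+ 2 by rewrite nE r0; ring.
    by rewrite eqf_sqr => /orP[/eqP ->//|/eqP ->]; exact: bes_opp.
  pose f (u : R) := cos u ^+ 2 * cos (T + p * sin u).
  have cf : continuous f by move=> u; rewrite /f; cts.
  rewrite -bes_phase -(@itg_periodic_fold _ f) //; last first.
    by move=> x; rewrite /f cos_add2pi sin_add2pi.
  apply: itg_ext => u _; rewrite /f.
  have -> : cos (pi - u) = - cos u by rewrite cosB cospi sinpi; ring.
  have -> : sin (pi - u) = sin u by rewrite sinB cospi sinpi; ring.
  rewrite (@itg_ext _ _ _ _ (fun=> cos u ^+ 2 * cos (T + p * sin u))); last first.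
    by move=> y _; rewrite r0 !mul0r addr0.
  by rewrite itg_cst; [ring|lra].
have n0 : n != 0.
  apply/negP => /eqP n0; move: nE; rewrite n0 expr0n/= => /esym/eqP.
  by rewrite paddr_eq0 ?sqr_ge0// !sqrf_eq0 (negPf r0) andbF.
have [dl [cd sd]] : exists dl, cos dl = p / n /\ sin dl = r / n.
  by apply: angle_exists; rewrite !expr_div_n -mulrDl -nE mulfV// expf_neq0.
pose h (u : R) := cos u * sin (T + p * sin u + r * cos u).
have ch : continuous h by move=> u; rewrite /h; cts.
apply: (mulfI r0); rewrite -itg_scale; last first.
  apply: continuous_cton; apply: (@itg_cont _ _ (- 1) 1 (fun z => cos z.1 ^+ 2 *
    cos (T + p * sin z.1 + r * cos z.1 * z.2))) => z; cts.
transitivity (itg (- pi) pi h).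
  rewrite -itg_periodic_fold //; last by move=> x; rewrite /h cos_add2pi sin_add2pi.
  apply: itg_ext => u _; rewrite /h.
  have -> : cos (pi - u) = - cos u by rewrite cosB cospi sinpi; ring.
  have -> : sin (pi - u) = sin u by rewrite sinB cospi sinpi; ring.
  rewrite -itg_scale; last by apply: continuous_cton => y; cts.
  have dF (y : R) : - 1 <= y <= 1 -> is_derive y 1 (fun y => cos u * sin (T + p * sin u + r * cos u * y))
      (r * (cos u ^+ 2 * cos (T + p * sin u + r * cos u * y))).
    by move=> _; derive_with; ring.
  rewrite (itg_FTC _ dF); [|lra|by apply: continuous_cton => y; cts].
  by rewrite !mulr1 !mulrN !mulNr mulr1.
pose h2 (w : R) := (p / n * cos w + r / n * sin w) * sin (T + n * sin w).
have ch2 : continuous h2 by move=> u; rewrite /h2; cts.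
have -> : r * (cos T * bes n) = (r / n) * n * (cos T * bes n) by field.
rewrite -(@itg_cos_sin_phase T n (p / n) (r / n) n0) -(@itg_periodic_shift _ h2 ch2 _ dl); last first.
  by move=> x; rewrite /h2 cos_add2pi sin_add2pi.
apply: itg_ext => u _; rewrite /h /h2 -cd -sd; congr (_ * sin _).
  by rewrite -{1}(addrK dl u) cosB; ring.
by rewrite sinD cd sd; field.
Qed.

End HalfDiscFourier.

(** * Integration over an ellipse by slices *)

Section EllipseSlices.
Context {R : realType}.
Variables (a b th : R) (c : R * R).
Hypotheses (a0 : 0 < a) (b0 : 0 < b).
Local Notation mu := (@lebesgue_measure R).

(** Half the height of the ellipse in the second coordinate. Then [ell_delta] is half the width of
    the horizontal slice through the centre, and [ell_gamma] is the shear that moves the midpoints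
    of the slices. *)
Definition ell_beta : R := Num.sqrt (a ^+ 2 * sin th ^+ 2 + b ^+ 2 * cos th ^+ 2).
Definition ell_delta : R := a * b / ell_beta.
Definition ell_gamma : R := (a ^+ 2 - b ^+ 2) * sin th * cos th / ell_beta.

Local Notation be := ell_beta.
Local Notation de := ell_delta.
Local Notation ga := ell_gamma.
Local Notation D := (ellipse_region a b c th).

Let be2_gt0 : 0 < a ^+ 2 * sin th ^+ 2 + b ^+ 2 * cos th ^+ 2.
Proof.
have sc := cos2Dsin2 th.
have [s0|s0] := eqVneq (sin th) 0.
  by move: sc; rewrite s0 expr0n/= mulr0 addr0 add0r => ->; rewrite mulr1 exprn_gt0.
apply: ltr_wpDr; first by rewrite mulr_ge0 ?sqr_ge0.
by apply: mulr_gt0; [exact: exprn_gt0|rewrite exprn_even_gt0].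
Qed.

Lemma ell_betaE : be ^+ 2 = a ^+ 2 * sin th ^+ 2 + b ^+ 2 * cos th ^+ 2.
Proof. by rewrite sqr_sqrtr// ltW. Qed.

Lemma ell_beta_gt0 : 0 < be.
Proof. by rewrite sqrtr_gt0. Qed.

Lemma ell_delta_gt0 : 0 < de.
Proof. by rewrite divr_gt0 ?mulr_gt0 ?ell_beta_gt0. Qed.

(** Completing the square in the first coordinate: a shear and a scaling carry the ellipse to the
    unit disc. *)
Lemma ellipse_formE z : D z <->
  ((z.1 - c.1 - ga * ((z.2 - c.2) / be)) / de) ^+ 2 < 1 - ((z.2 - c.2) / be) ^+ 2.
Proof.
rewrite /ellipse_region/= ltrBrDr; set lhs := (X in X < 1); set rhs := (X in _ <-> X < 1).
suff -> : lhs = rhs by [].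
rewrite /lhs /rhs /de /ga; have h := ell_beta_gt0; have bE := ell_betaE.
have sc := cos2Dsin2 th.
move: (z.1 - c.1) (z.2 - c.2) => X Y.
have a1 := lt0r_neq0 a0; have b1 := lt0r_neq0 b0; have h1 := lt0r_neq0 h.
have -> : ((X - (a ^+ 2 - b ^+ 2) * sin th * cos th / be * (Y / be)) / (a * b / be)) ^+ 2 + (Y / be) ^+ 2 =
  ((be ^+ 2 * X - (a ^+ 2 - b ^+ 2) * sin th * cos th * Y) ^+ 2 + (a * b * Y) ^+ 2) / (be ^+ 2 * (a * b) ^+ 2).
  by field; rewrite a1 b1 h1.
have -> : (X * cos th + Y * sin th) ^+ 2 / a ^+ 2 + (- X * sin th + Y * cos th) ^+ 2 / b ^+ 2 =
  be ^+ 2 * (b ^+ 2 * (X * cos th + Y * sin th) ^+ 2 + a ^+ 2 * (- X * sin th + Y * cos th) ^+ 2) /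
    (be ^+ 2 * (a * b) ^+ 2).
  by field; rewrite a1 b1 h1.
(* The factor 1 makes both sides homogeneous in the sine and cosine, so that [ring] closes the
   identity. *)
have -> : (a * b * Y) ^+ 2 = (a * b * Y) ^+ 2 * (cos th ^+ 2 + sin th ^+ 2) ^+ 2.
  by rewrite sc expr1n mulr1.
by congr (_ / _); rewrite bE; ring.
Qed.

Let w (y : R) : R := Num.sqrt (1 - ((y - c.2) / be) ^+ 2).
Let m (y : R) : R := c.1 + ga * ((y - c.2) / be).

Let slice y : [set x | D (x, y)] = `]m y - de * w y, m y + de * w y[%classic.
Proof.
have d0 := ell_delta_gt0.
apply/seteqP; split => x; rewrite /= in_itv/=.
  move=> /(ellipse_formE (x, y))/=; rewrite /w /m.
  set t := 1 - _; set X := (X in (X / de) ^+ 2) => h.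
  have t0 : 0 < t by apply: le_lt_trans h; exact: sqr_ge0.
  have : `|X / de| < Num.sqrt t.
    by rewrite -(@ltr_pXn2r _ 2) ?nnegrE ?sqrtr_ge0// real_normK ?num_real// sqr_sqrtr// ltW.
  rewrite normrM normfV (gtr0_norm d0) ltr_pdivrMr// ltr_norml mulrC /X => /andP[? ?].
  by apply/andP; split; lra.
move=> xI; apply/(ellipse_formE (x, y)); rewrite /=; move: xI; rewrite /w /m.
set t := 1 - _; set X := (X in (X / de) ^+ 2) => /andP[h1 h2].
have hX : `|X| < de * Num.sqrt t by rewrite ltr_norml /X; apply/andP; split; lra.
have s0 : 0 < Num.sqrt t by rewrite -(pmulr_rgt0 _ d0); apply: le_lt_trans hX.
have t0 : 0 < t by rewrite -sqrtr_gt0.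
rewrite expr_div_n ltr_pdivrMr ?exprn_gt0// -(sqr_sqrtr (ltW t0)) -exprMn -(real_normK (num_real X)).
rewrite [_ * de]mulrC ltr_pXn2r//; by rewrite nnegrE mulr_ge0// ltW.
Qed.

Lemma measurable_ellipse : measurable D.
Proof.
pose F (z : R * R) : R := ((z.1 - c.1) * cos th + (z.2 - c.2) * sin th) ^+ 2 / a ^+ 2
           + (- (z.1 - c.1) * sin th + (z.2 - c.2) * cos th) ^+ 2 / b ^+ 2.
have cF : continuous F.
  have a2 : (a ^+ 2)^-1 = (a ^+ 2)^-1 by [].
  pose a' := (a ^+ 2)^-1; pose b' := (b ^+ 2)^-1.
  change (continuous (fun z : R * R => ((z.1 - c.1) * cos th + (z.2 - c.2) * sin th) ^+ 2 * a'
           + (- (z.1 - c.1) * sin th + (z.2 - c.2) * cos th) ^+ 2 * b')).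
  by move=> z; cts.
apply: open2_measurable.
have -> : D = F @^-1` [set x | x < 1] by [].
by apply: open_comp => [z _|]; [exact: cF|exact: open_lt].
Qed.

Lemma ellipse_bounded : exists2 N : R, 0 < N & forall z, D z -> - N < z.1 < N /\ - N < z.2 < N.
Proof.
have h := ell_beta_gt0; have d := ell_delta_gt0.
have g0 := normr_ge0 ga; have c10 := normr_ge0 c.1; have c20 := normr_ge0 c.2.
exists (`|c.1| + `|c.2| + `|ga| + de + be); first by lra.
move=> z /ellipse_formE; set Y := (z.2 - c.2) / be; set X := (X in (X / de) ^+ 2) => H.
have Y1 : `|Y| < 1.
  rewrite -(@ltr_pXn2r _ 2) ?nnegrE// expr1n real_normK ?num_real//.
  by have := sqr_ge0 (X / de); lra.
have X1 : `|X / de| < 1.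
  rewrite -(@ltr_pXn2r _ 2) ?nnegrE// expr1n real_normK ?num_real//.
  by have := sqr_ge0 Y; lra.
have z2 : z.2 = c.2 + be * Y by rewrite /Y; field; rewrite lt0r_neq0.
have z1 : z.1 = c.1 + ga * Y + de * (X / de) by rewrite /X; field; rewrite lt0r_neq0.
have n1 : `|ga * Y| <= `|ga| by rewrite normrM ler_piMr// ltW.
have n2 : `|be * Y| < be by rewrite normrM (gtr0_norm h) gtr_pMr.
have n3 : `|de * (X / de)| < de by rewrite normrM (gtr0_norm d) gtr_pMr.
have tri (x y : R) := ler_normD x y.
split; rewrite -ltr_norml.
  rewrite z1; apply: (le_lt_trans (tri _ _)); have := tri c.1 (ga * Y); lra.
rewrite z2; apply: (le_lt_trans (tri _ _)); lra.
Qed.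

Definition ell_point (u y : R) : R * R :=
  (c.1 + ga * sin u + de * cos u * y, c.2 + be * sin u).

(** At height c.2 + be sin u the slice has half-width de cos u; the Jacobian is de cos u times be
    cos u, and de be = a b. *)
Lemma itg2_ellipse (f : R * R -> R) : continuous f ->
  itg2 D f = a * b * itg (- (pi / 2)) (pi / 2) (fun u => itg (- 1) 1 (fun y =>
    cos u ^+ 2 * f (ell_point u y))).
Proof.
move=> cf; have mD := measurable_ellipse; have [N N0 DN] := ellipse_bounded.
have h0 := ell_beta_gt0; have d0 := ell_delta_gt0.
have DB : D `<=` box (- N) N (- N) N.
  by move=> z /DN[/andP[? ?] /andP[? ?]]; split; rewrite /= in_itv/= !ltW.
have sf : leb2.-integrable D (EFin \o f).
  have [M HM] := @box_bound _ f (- N) N (- N) N cf.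
  apply: (bounded_leb2_integrable mD DB (M := M)); last by move=> z /DB; exact: HM.
  by apply: measurable_funTS; exact: continuous2_measurable.
pose P (y : R) : R := de * w y * itg (- 1) 1 (fun x => f (m y + de * w y * x, y)).
have inner y : (\int[mu]_(x in [set x | D (x, y)]) (f (x, y))%:E = (P y)%:E)%E.
  have cfy : continuous (fun x => f (x, y)) by exact: continuous_slice2.
  rewrite slice; have [w0|w0] := leP (w y) 0.
    have wy : w y = 0 by apply/eqP; rewrite eq_le w0 sqrtr_ge0.
    by rewrite wy mulr0 subr0 addr0 set_itv_ge ?bnd_simp ?ltxx// integral_set0 /P wy mulr0 mul0r.
  have cst : cton (- 1) 1 (fun _ : R => de * w y) by apply: continuous_cton => x; cts.
  have dphi (x : R) : - 1 <= x <= 1 -> is_derive x 1 (fun x => m y + de * w y * x) (de * w y).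
    by move=> _; derive_with; ring.
  have N1 : - 1 <= 1 :> R by lra.
  have dw : 0 < de * w y by rewrite mulr_gt0.
  have lr : m y - de * w y <= m y + de * w y by lra.
  rewrite integral_itv_bndo_bndc; last first.
    by apply/measurable_EFinP; apply: measurable_funTS; exact: continuous_measurable_fun.
  rewrite integral_itv_obnd_cbnd; last first.
    by apply/measurable_EFinP; apply: measurable_funTS; exact: continuous_measurable_fun.
  rewrite itgE; last exact: continuous_cton.
  rewrite (itg_subst N1 cfy dphi cst lr) ?mulrN1 ?mulr1// /P -itg_scale; last first.
    by apply: continuous_cton => x; apply: (@cts_comp _ _ (fun x => f (x, y)) (fun x => m y + de * w y * x));
      [exact: cfy|cts].
  by congr EFin; apply: itg_ext => x _; rewrite mulrC.
have cw : continuous w by move=> y; rewrite /w; cts.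
have cm : continuous m by move=> y; rewrite /m; cts.
have cP : continuous P.
  pose k (z : R * R) := f (m z.1 + de * w z.1 * z.2, z.1).
  have ck : continuous k.
    move=> z; apply: (@cts_comp2 _ _ _ f (fun z => (m z.1 + de * w z.1 * z.2, z.1))); first exact: cf.
    by cts.
  pose G y := itg (- 1) 1 (fun x => k (y, x)).
  have cG : continuous G by exact: (@itg_cont _ _ _ _ k).
  have -> : P = fun y => de * w y * G y by [].
  by move=> y; cts.
(* Above and below the ellipse the radicand of [w] is negative and [Num.sqrt] returns 0. *)
have P0 y : ~ (c.2 - be <= y <= c.2 + be) -> P y = 0.
  move=> /negP; rewrite negb_and -!ltNge => h; rewrite /P (_ : w y = 0) ?mulr0 ?mul0r//.
  apply: ler0_sqrtr; rewrite subr_le0.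
  have : 1 < `|(y - c.2) / be|.
    by rewrite normrM normfV (gtr0_norm h0) ltr_pdivlMr// mul1r ltr_normr; apply/orP; case/orP: h => ?; [right|left]; lra.
  by rewrite -(real_normK (num_real (_ / _))) => /ltW; exact: exprn_ege1.
have bb : c.2 - be <= c.2 + be by lra.
have pp : - (pi / 2) <= pi / 2 :> R by have := pi_gt0 R; lra.
have -> : itg2 D f = itg (c.2 - be) (c.2 + be) P.
  rewrite /itg2 /itg [RHS]Rintegral_mkcond /Rintegral leb2_slice2//; congr fine.
  apply: eq_integral => y _; rewrite inner.
  rewrite /= patchE; case: ifPn => //; rewrite notin_setE/= in_itv/= => h; congr EFin; exact: P0.
have dphi (u : R) : - (pi / 2) <= u <= pi / 2 -> is_derive u 1 (fun u => c.2 + be * sin u) (be * cos u).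
  by move=> _; derive_with; ring.
have cdphi : cton (- (pi / 2)) (pi / 2) (fun u => be * cos u) by apply: continuous_cton => u; cts.
rewrite (itg_subst pp cP dphi cdphi bb) ?sinN ?sin_pihalf ?mulrN1 ?mulr1//.
rewrite -itg_scale; last first.
  apply: continuous_cton; apply: (@itg_cont _ _ (- 1) 1 (fun z => cos z.1 ^+ 2 * f (ell_point z.1 z.2))).
  have cp : continuous (fun z : R * R => ell_point z.1 z.2) by move=> z; rewrite /ell_point; cts.
  pose k z := f (ell_point z.1 z.2).
  have ck : continuous k.
    by move=> z; apply: (@cts_comp2 _ _ _ f (fun z => ell_point z.1 z.2)); [exact: cf|exact: cp].
  change (continuous (fun z => cos z.1 ^+ 2 * k z)); by move=> z; cts.
apply: itg_ext => u /andP[u1 u2].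
have cu : 0 <= cos u by apply: cos_ge0_pihalf; apply/andP; split; lra.
have se : (c.2 + be * sin u - c.2) / be = sin u by field; rewrite lt0r_neq0.
have wE : w (c.2 + be * sin u) = cos u.
  by rewrite /w se -(cos2Dsin2 u) addrK sqrtr_sqr ger0_norm.
have cfu : continuous (fun x : R => f (ell_point u x)).
  move=> x; apply: (@cts_comp2 _ _ _ f (ell_point u)); first exact: cf.
  by rewrite /ell_point; cts.
pose h x := f (ell_point u x); have ch : continuous h := cfu.
rewrite [X in _ = _ * X]itg_scale; last exact: continuous_cton.
have <- : de * be = a * b by rewrite /de divfK// lt0r_neq0.
by rewrite /P wE /m se -/(ell_point u _); ring.
Qed.

End EllipseSlices.

(** * Orthogonality for Herglotz waves on an ellipse *)

Section HerglotzOrthogonality.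
Context {R : realType}.
Variables (a b th : R) (c : R * R).
Hypotheses (a0 : 0 < a) (b0 : 0 < b).
Local Notation D := (ellipse_region a b c th).

(** This is [half_disc_fourier] with p = A ga + B be and r = A de; the norm of (p, r) equals that of
    the frequency written in the axes of the ellipse and weighted by [a] and [b]. *)
Lemma ellipse_fourier (T A B n : R) :
  n ^+ 2 = a ^+ 2 * (A * cos th + B * sin th) ^+ 2 + b ^+ 2 * (B * cos th - A * sin th) ^+ 2 ->
  itg (- (pi / 2)) (pi / 2) (fun u => itg (- 1) 1 (fun y => cos u ^+ 2 *
    cos (T + (A * (ell_point a b th c u y).1 + B * (ell_point a b th c u y).2)))) =
  cos (T + (A * c.1 + B * c.2)) * bes n.
Proof.
move=> nE; have h0 := ell_beta_gt0 th a0 b0; have bE := ell_betaE th a0 b0.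
rewrite -(@half_disc_fourier _ _ (A * ell_gamma a b th + B * ell_beta a b th) (A * ell_delta a b th)).
  by apply: itg_ext => u _; apply: itg_ext => y _; rewrite /ell_point/=; congr (_ * cos _); ring.
rewrite nE /ell_gamma /ell_delta; move: h0 bE; set be := ell_beta a b th => h0 bE.
have h1 := lt0r_neq0 h0; have sc := cos2Dsin2 th.
have -> : (A * ((a ^+ 2 - b ^+ 2) * sin th * cos th / be) + B * be) ^+ 2 + (A * (a * b / be)) ^+ 2 =
  ((A * ((a ^+ 2 - b ^+ 2) * sin th * cos th) + B * be ^+ 2) ^+ 2 + (A * (a * b)) ^+ 2) / be ^+ 2.
  by field.
have -> : (A * (a * b)) ^+ 2 = (A * (a * b)) ^+ 2 * (cos th ^+ 2 + sin th ^+ 2) ^+ 2.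
  by rewrite sc expr1n mulr1.
by apply: (mulIf (expf_neq0 2 h1)); rewrite divfK ?expf_neq0// bE; ring.
Qed.

Variables (phr phim : R -> R).
Hypotheses (cphr : continuous phr) (cphim : continuous phim).

Let kern (k A B T : R) (z : (R * R) * R) : R :=
  phr z.2 * cos (T + ((k * cos z.2 + A) * z.1.1 + (k * sin z.2 + B) * z.1.2)) -
  phim z.2 * sin (T + ((k * cos z.2 + A) * z.1.1 + (k * sin z.2 + B) * z.1.2)).

Let ckern k A B T : continuous (kern k A B T).
Proof.
pose x1 (z : (R * R) * R) := z.1.1; pose x2 (z : (R * R) * R) := z.1.2.
have c1 : continuous x1.
  by move=> z; apply: (@cts_comp2 _ _ _ fst fst); [exact: cts_fst|exact: cts_fst].
have c2 : continuous x2.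
  by move=> z; apply: (@cts_comp2 _ _ _ snd fst); [exact: cts_snd|exact: cts_fst].
have c1' := cphr; have c2' := cphim.
change (continuous (fun z : (R * R) * R =>
  phr z.2 * cos (T + ((k * cos z.2 + A) * x1 z + (k * sin z.2 + B) * x2 z)) -
  phim z.2 * sin (T + ((k * cos z.2 + A) * x1 z + (k * sin z.2 + B) * x2 z)))).
by move=> z; cts.
Qed.

(** The real part of the complex wave times exp(i (T + A x + B y)): under the integral over
    directions the two frequencies add. *)
Let combine (k A B T : R) z :
  herglotz_re k phr phim z * cos (T + (A * z.1 + B * z.2)) -
  herglotz_im k phr phim z * sin (T + (A * z.1 + B * z.2)) =
  itg (- pi) pi (fun s => kern k A B T (z, s)).
Proof.
have c1 := cphr; have c2 := cphim.
rewrite /herglotz_re /herglotz_im -/(itg _ _ _) -/(itg _ _ _).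
set w := T + (A * z.1 + B * z.2).
rewrite ![itg _ _ _ * _]mulrC -!itg_scale; [|by apply: continuous_cton => s; cts..].
rewrite -itg_sub; [|by apply: continuous_cton => s; cts..].
apply: itg_ext => s _; rewrite /kern/=.
have -> : T + ((k * cos s + A) * z.1 + (k * sin s + B) * z.2) =
  k * (z.1 * cos s + z.2 * sin s) + w by rewrite /w; ring.
by rewrite (cosD _ w) (sinD _ w); ring.
Qed.

(** The real part of the wave is tested at phase T and the imaginary part at T - pi / 2, where the
    cosine becomes a sine. After Fubini each direction contributes the Fourier transform of the
    ellipse at the combined frequency. *)
Lemma non_scattering_orth (q k A B T : R) (n : R -> R) : k != 0 -> q != 1 -> A ^+ 2 + B ^+ 2 = k ^+ 2 * q ->
  (forall s, n s ^+ 2 = a ^+ 2 * ((k * cos s + A) * cos th + (k * sin s + B) * sin th) ^+ 2 +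
    b ^+ 2 * ((k * sin s + B) * cos th - (k * cos s + A) * sin th) ^+ 2) ->
  non_scattering D q k phr phim ->
  itg (- pi) pi (fun s =>
    (phr s * cos (T + ((k * cos s + A) * c.1 + (k * sin s + B) * c.2)) -
     phim s * sin (T + ((k * cos s + A) * c.1 + (k * sin s + B) * c.2))) * bes (n s)) = 0.
Proof.
move=> k0 q1 AB nE [Hre Him].
have mD := measurable_ellipse a b th c; have [N N0 DN] := @ellipse_bounded _ a b th c a0 b0.
have DB : D `<=` box (- N) N (- N) N.
  by move=> z /DN[/andP[? ?] /andP[? ?]]; split; rewrite /= in_itv/= !ltW.
have [Lre Ire] := nonscat_real_orth mD N0 DN T k0 q1 AB Hre.
have [Lim Iim] := nonscat_real_orth mD N0 DN (T - pi / 2) k0 q1 AB Him.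
have sc v T' : L2 D v -> summable2 D (fun z => v z * cos (T' + (A * z.1 + B * z.2))).
  move=> Lv; apply: (L2_summable_mul mD DB Lv (M := 1)) => [|z _].
    by apply: measurable_funTS; apply: continuous2_measurable => z; cts.
  by rewrite ler_norml cos_geN1 cos_le1.
have cF : continuous (fun z => itg (- pi) pi (fun s => kern k A B T (z, s))).
  by apply: (@itg_cont _ _ _ _ (kern k A B T)); exact: ckern.
have F0 : itg2 D (fun z => itg (- pi) pi (fun s => kern k A B T (z, s))) = 0.
  rewrite -[RHS](subrr 0) -{1}Ire -Iim -itg2_sub//; [|exact: sc..].
  congr (itg2 D _); apply/funext => z; rewrite -combine; congr (_ - _ * _).
  by rewrite addrAC cos_sub_pihalf.
move: F0; rewrite itg2_ellipse// => /eqP; rewrite !mulf_eq0 (gt_eqF a0) (gt_eqF b0)/= => /eqP F0.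
pose K (z : (R * R) * R) := cos z.1.1 ^+ 2 * kern k A B T (ell_point a b th c z.1.1 z.2, z.1.2).
have cK : continuous K.
  pose u (z : (R * R) * R) := z.1.1.
  have cu : continuous u.
    by move=> z; apply: (@cts_comp2 _ _ _ fst fst); [exact: cts_fst|exact: cts_fst].
  pose p (z : (R * R) * R) := (ell_point a b th c (u z) z.2, z.1.2).
  have cp : continuous p.
    move=> z; apply: (@cts_pair _ _ _ (fun z => ell_point a b th c (u z) z.2) (fun z => z.1.2)).
      by rewrite /ell_point; cts.
    by apply: (@cts_comp2 _ _ _ snd fst); [exact: cts_snd|exact: cts_fst].
  pose G z := kern k A B T (p z).
  have cG : continuous G.
    by move=> z; apply: (@cts_comp2 _ _ _ (kern k A B T) p); [exact: ckern|exact: cp].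
  change (continuous (fun z => cos (u z) ^+ 2 * G z)); by move=> z; cts.
rewrite -[RHS]F0; symmetry.
transitivity (itg (- (pi / 2)) (pi / 2) (fun u => itg (- pi) pi (fun s => itg (- 1) 1 (fun y => K ((u, s), y))))).
  apply: itg_ext => u _.
  have cKu : continuous (fun z : R * R => K ((u, z.2), z.1)).
    move=> z; apply: (@cts_comp2 _ _ _ K (fun z => ((u, z.2), z.1))); first exact: cK.
    by apply: cts_pair; [apply: cts_pair; [exact: cts_cst_|exact: cts_snd]|exact: cts_fst].
  rewrite -(@itg_swap _ (fun z => K ((u, z.2), z.1)))//.
  apply: itg_ext => y _; rewrite -itg_scale//; apply: continuous_cton.
  move=> s; apply: (@cts_comp2 _ _ _ (kern k A B T) (fun s => (ell_point a b th c u y, s))); first exact: ckern.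
  by apply: cts_pair; [exact: cts_cst_|exact: cts_id].
rewrite (@itg_swap _ (fun z => itg (- 1) 1 (fun y => K (z, y)))); last exact: (@itg_cont _ _ _ _ K).
apply: itg_ext => s _; rewrite /K/= /kern/=.
pose pt := ell_point a b th c; pose A' := k * cos s + A; pose B' := k * sin s + B.
have cpt : continuous (fun z : R * R => pt z.1 z.2) by move=> z; rewrite /pt /ell_point; cts.
pose ph (z : R * R) := A' * (pt z.1 z.2).1 + B' * (pt z.1 z.2).2.
have cph : continuous ph by move=> z; rewrite /ph /pt /ell_point/=; cts.
pose f1 (z : R * R) := cos z.1 ^+ 2 * cos (T + ph z).
pose f2 (z : R * R) := cos z.1 ^+ 2 * cos (T - pi / 2 + ph z).
have cf1 : continuous f1 by move=> z; rewrite /f1; cts.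
have cf2 : continuous f2 by move=> z; rewrite /f2; cts.
have I1 := @ellipse_fourier T A' B' (n s) (nE s).
have I2 := @ellipse_fourier (T - pi / 2) A' B' (n s) (nE s).
have -> : sin (T + (A' * c.1 + B' * c.2)) = cos (T - pi / 2 + (A' * c.1 + B' * c.2)).
  by rewrite addrAC cos_sub_pihalf.
pose J1 u := itg (- 1) 1 (fun y => f1 (u, y)); pose J2 u := itg (- 1) 1 (fun y => f2 (u, y)).
have cJ1 : continuous J1 by exact: (@itg_cont _ _ _ _ f1).
have cJ2 : continuous J2 by exact: (@itg_cont _ _ _ _ f2).
rewrite mulrBl -!mulrA -I1 -I2.
symmetry; transitivity (itg (- (pi / 2)) (pi / 2) (fun u => phr s * J1 u - phim s * J2 u)).
  rewrite itg_sub; [|by apply: continuous_cton => u; cts..].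
  by rewrite !itg_scale//; exact: continuous_cton.
apply: itg_ext => u _; rewrite /J1 /J2.
have cf1u : continuous (fun y => f1 (u, y)) by exact: continuous_slice1.
have cf2u : continuous (fun y => f2 (u, y)) by exact: continuous_slice1.
pose h1 y := f1 (u, y); pose h2 y := f2 (u, y).
have ch1 : continuous h1 := cf1u; have ch2 : continuous h2 := cf2u.
rewrite -!itg_scale; [|exact: continuous_cton..].
rewrite -(@itg_sub _ _ _ (fun y => phr s * h1 y) (fun y => phim s * h2 y)); [|by apply: continuous_cton => y; cts..].
apply: itg_ext => y _; rewrite /h1 /h2 /f1 /f2/= -/A' -/B' -/(ph (u, y)).
have -> : cos (T - pi / 2 + ph (u, y)) = sin (T + ph (u, y)) by rewrite addrAC cos_sub_pihalf.
by ring.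
Qed.

End HerglotzOrthogonality.

(** * The ellipse with a focus at the origin, and finiteness *)

Section EllipseAtFocus.
Context {R : realType}.
Variables (q a b th om sg : R) (c : R * R) (phr phim : R -> R).
Hypotheses (q0 : 0 < q) (q1 : q != 1) (b0 : 0 < b) (a0 : 0 < a).
Variable e : R.
Hypothesis eE : e ^+ 2 = 1 - b ^+ 2 / a ^+ 2.
Hypotheses (cE : c = (- (a * e * cos om), - (a * e * sin om))) (sg2 : sg ^+ 2 = 1).
Hypotheses (com : cos om = sg * cos th) (som : sin om = sg * sin th).
Hypotheses (cphr : continuous phr) (cphim : continuous phim).
Hypotheses (pphr : forall t : R, phr (t + 2 * pi) = phr t) (pphim : forall t : R, phim (t + 2 * pi) = phim t).

Local Notation g := (Num.sqrt q).

Let b2E : b ^+ 2 = a ^+ 2 * (1 - e ^+ 2).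
Proof. by rewrite eE; field; rewrite lt0r_neq0. Qed.

(** The freedom in [T] is spent on completing the phase to a multiple of |U| + |W|. The remaining
    shift [d] produces both identities, at 0 and at -pi / 2. *)
Let orth_shift (k t d : R) : 0 < k ->
  non_scattering (ellipse_region a b c th) q k phr phim ->
  itg (- pi) pi (fun s =>
    (phr (s + om) * cos (d - k * a * nS e g (s, t)) - phim (s + om) * sin (d - k * a * nS e g (s, t))) *
      bes (k * a * nN e g (s, t))) = 0.
Proof.
move=> k0 NS.
(* The plane wave has direction t + om and wave number k sqrt q. *)
pose A := k * g * cos (t + om); pose B := k * g * sin (t + om).
pose Q s := a ^+ 2 * ((k * cos s + A) * cos th + (k * sin s + B) * sin th) ^+ 2 +
    b ^+ 2 * ((k * sin s + B) * cos th - (k * cos s + A) * sin th) ^+ 2.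
have Q0 s : 0 <= Q s by rewrite addr_ge0// mulr_ge0 ?sqr_ge0.
pose n s := Num.sqrt (Q s).
(* The centre contributes -k a (e cos s + e g cos t) to the phase. Since |U| = 1 + e cos s, the
   first term lacks only a constant; [T] supplies it, cancels the second term and adds -k a |W|. *)
pose T := d - k * a * (1 + Num.sqrt (sqW e g t) - e * g * cos t).
have AB : A ^+ 2 + B ^+ 2 = k ^+ 2 * q.
  by rewrite /A /B !exprMn -mulrDr cos2Dsin2 mulr1 sqr_sqrtr// ltW.
have := @non_scattering_orth _ a b th c a0 b0 phr phim cphr cphim q k A B T n
  (lt0r_neq0 k0) q1 AB (fun s => sqr_sqrtr (Q0 s)) NS.
pose P s := (phr s * cos (T + ((k * cos s + A) * c.1 + (k * sin s + B) * c.2)) -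
     phim s * sin (T + ((k * cos s + A) * c.1 + (k * sin s + B) * c.2))) * bes (n s).
have cP : continuous P.
  have c1 := cphr; have c2 := cphim; have cb := @continuous_bes R.
  by move=> s; rewrite /P /n /Q; cts.
rewrite -/(itg _ _ P) -(@itg_periodic_shift _ P cP _ om); last first.
  by move=> s; rewrite /P /n /Q pphr pphim cos_add2pi sin_add2pi.
move=> E; rewrite -[RHS]E; apply: itg_ext => s _; rewrite /P.
have -> : T + ((k * cos (s + om) + A) * c.1 + (k * sin (s + om) + B) * c.2) = d - k * a * nS e g (s, t).
  have om1 := cos2Dsin2 om.
  have h1 : cos (s + om) * cos om + sin (s + om) * sin om = cos s by rewrite -cosB addrK.
  have h2 : cos (t + om) * cos om + sin (t + om) * sin om = cos t by rewrite -cosB addrK.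
  by rewrite /T /A /B /nS cE/= -h1 -h2; ring.
congr (_ * bes _).
have -> : n (s + om) = Num.sqrt ((k * a) ^+ 2 * sqN e g (s, t)).
  rewrite /n; congr Num.sqrt.
  have h1 x : cos (x + om) * cos th + sin (x + om) * sin th = sg * cos x.
    have -> : cos th = sg * cos om by rewrite com mulrA -expr2 sg2 mul1r.
    have -> : sin th = sg * sin om by rewrite som mulrA -expr2 sg2 mul1r.
    by rewrite -{3}(addrK om x) cosB; ring.
  have h2 x : sin (x + om) * cos th - cos (x + om) * sin th = sg * sin x.
    have -> : cos th = sg * cos om by rewrite com mulrA -expr2 sg2 mul1r.
    have -> : sin th = sg * sin om by rewrite som mulrA -expr2 sg2 mul1r.
    by rewrite -{3}(addrK om x) sinB; ring.
  have -> : (k * a) ^+ 2 * sqN e g (s, t) = k ^+ 2 *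
      (a ^+ 2 * (sg * cos s + g * (sg * cos t)) ^+ 2 + b ^+ 2 * (sg * sin s + g * (sg * sin t)) ^+ 2).
    rewrite b2E /sqN/= -[(k * a) ^+ 2]mulr1 -sg2; ring.
  by rewrite -!h1// -!h2// /Q /A /B; ring.
by rewrite sqrtrM ?sqr_ge0// sqrtr_sqr gtr0_norm// mulr_gt0.
Qed.

Lemma non_scattering_orth_focus (k : R) : 0 < k ->
  non_scattering (ellipse_region a b c th) q k phr phim ->
  orth e g (fun s => phr (s + om)) (fun s => phim (s + om)) (k * a) /\
  orth e g (fun s => phim (s + om)) (fun s => - phr (s + om)) (k * a).
Proof.
move=> k0 NS; split=> t.
  rewrite -[RHS](@orth_shift k t 0 k0 NS); apply: itg_ext => s _.
  by rewrite sub0r cosN sinN; ring.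
rewrite -[RHS](@orth_shift k t (- (pi / 2)) k0 NS); apply: itg_ext => s _.
set x := k * a * nS _ _ _.
have -> : cos (- (pi / 2) - x) = - sin x.
  by rewrite addrC cos_sub_pihalf sinN.
have -> : sin (- (pi / 2) - x) = - cos x.
  by rewrite -opprD sinN sinD cos_pihalf sin_pihalf; ring.
ring.
Qed.

Lemma finite_non_scattering (phr' phim' : R -> R) :
  0 < e < 1 -> e < g ->
  (forall x : R, is_derive x 1 phr (phr' x)) -> continuous phr' ->
  (forall x : R, is_derive x 1 phim (phim' x)) -> continuous phim' ->
  (exists t, phr t != 0 \/ phim t != 0) ->
  finite_set [set k : R | 0 < k /\ non_scattering (ellipse_region a b c th) q k phr phim].
Proof.
move=> e01 eg dphr cphr' dphim cphim' [t0 ft0].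
have g1 : g ^+ 2 != 1 by rewrite sqr_sqrtr// ltW.
have shift (f f' : R -> R) : (forall x : R, is_derive x 1 f (f' x)) ->
    forall x : R, is_derive x 1 (fun s => f (s + om)) (f' (x + om)).
  move=> df x; have h : is_derive x 1 (fun s => s + om) 1 by derive_with; ring.
  have := @is_derive_compf _ f (fun s => s + om) x _ _ (df (x + om)) h.
  by rewrite mulr1.
have cshift (f : R -> R) : continuous f -> continuous (fun s => f (s + om)).
  by move=> cf s; cts.
have pshift (f : R -> R) : (forall t, f (t + 2 * pi) = f t) -> forall t, f (t + 2 * pi + om) = f (t + om).
  by move=> pf t; rewrite addrAC pf.
have nz : exists t, phr (t + om) != 0 \/ phim (t + om) != 0 by exists (t0 - om); rewrite subrK.
have [K HK] := @orth_bounded _ e g _ _ _ _ e01 eg g1 (shift _ _ dphr) (cshift _ cphr')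
  (shift _ _ dphim) (cshift _ cphim') (pshift _ pphr) (pshift _ pphim)
  nz.
set S := [set k : R | _]; apply: contrapT => infS.
have ltK k : S k -> k * a < K.
  move=> [k0 NS]; rewrite ltNge; apply/negP => Kk.
  by apply: (HK (k * a) Kk); [exact: mulr_gt0|exact: non_scattering_orth_focus].
pose Z := [set x : R | S (x / a)].
have aN0 := lt0r_neq0 a0.
have infZ : infinite_set Z.
  move=> finZ; apply: infS; apply: (sub_finite_set _ (finite_image (fun x => x / a) finZ)).
  by move=> k Sk; exists (k * a); rewrite /Z/= ?mulfK.
have ZK x : Z x -> 0 < x < K.
  move=> Zx; apply/andP; split; last by have := ltK _ Zx; rewrite divfK.
  by case: Zx => xa _; have := mulr_gt0 xa a0; rewrite divfK.
have bndZ : bounded_set Z.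
  exists K; split; first exact: num_real.
  move=> M KM x /ZK/andP[x0 xK]; rewrite /= gtr0_norm//.
  exact: ltW (lt_trans xK KM).
have orthZ x : Z x -> orth e g (fun s => phr (s + om)) (fun s => phim (s + om)) x /\
    orth e g (fun s => phim (s + om)) (fun s => - phr (s + om)) x.
  by move=> [xa NS]; have := non_scattering_orth_focus xa NS; rewrite divfK.
have cr := cshift _ cphr; have ci := cshift _ cphim.
have cnr : continuous (fun s => - phr (s + om)).
  pose f s := phr (s + om); have cf : continuous f := cr.
  change (continuous (fun s => - f s)); by move=> s; cts.
(* A positive frequency beyond the bound, where the identities hold by the identity theorem. *)
apply: (HK (Num.max K 1)); [by rewrite le_max lexx|by rewrite lt_max ltr01 orbT|].
split; first by apply: (orth_all cr ci infZ bndZ) => x /orthZ[].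
by apply: (orth_all ci cnr infZ bndZ) => x /orthZ[].
Qed.

End EllipseAtFocus.

(** With s = sqrt q and 1/4 < q < 1, it rests on s^2 - 3/4 + 1/(4 s) = (s + 1) (2 s - 1)^2 / (4 s)
    >= 0; the double zero s = 1/2 is the value q = 1/4 at which the two regimes meet. *)
Lemma eccentricity_lt_sqrt {R : realType} (q x : R) : 0 < q -> q != 1 -> x < 1 ->
  ((1 < q \/ (4^-1 < q /\ q < 1)) -> x < 3 / 4 - (4 * Num.sqrt q)^-1) ->
  (q <= 4^-1 -> x < q) -> x < q.
Proof.
move=> q0 q1 x1 h1 h2; have [q4|q4] := leP q 4^-1; first exact: h2.
have [ql|qg|E] := ltgtP q 1; [|exact: lt_trans x1 qg|by rewrite E eqxx in q1].
have {h1 h2} := h1 (or_intror (conj q4 ql)).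
have s0 : 0 < Num.sqrt q by rewrite sqrtr_gt0.
have sq := sqr_sqrtr (ltW q0); move: s0 sq; set s := Num.sqrt q => s0 sq h.
apply: (lt_le_trans h); rewrite -sq -subr_ge0.
have -> : s ^+ 2 - (3 / 4 - (4 * s)^-1) = (s + 1) * (2 * s - 1) ^+ 2 / (4 * s).
  by field; rewrite lt0r_neq0.
by apply: divr_ge0; [apply: mulr_ge0; [lra|exact: sqr_ge0]|lra].
Qed.

Theorem theorem3 (R : realType) (q a b th : R) (c : R * R) (phr phim : R -> R) :
  0 < q -> q != 1 ->
  0 < b -> b <= a ->
  (focus_plus a b c th = (0, 0) \/ focus_minus a b c th = (0, 0)) ->
  ((1 < q \/ (4^-1 < q /\ q < 1)) ->
     0 < eccentricity a b ^+ 2 /\ eccentricity a b ^+ 2 < 3 / 4 - (4 * Num.sqrt q)^-1) ->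
  (q <= 4^-1 -> 0 < eccentricity a b ^+ 2 /\ eccentricity a b ^+ 2 < q) ->
  C1_circle phr -> C1_circle phim ->
  (exists t : R, phr t != 0 \/ phim t != 0) ->
  finite_set [set k : R | 0 < k /\ non_scattering (ellipse_region a b c th) q k phr phim].
Proof.
move=> q0 q1 b0 ba foc h1 h2 [pphr dphr cphr'] [pphim dphim cphim'] nz.
have a0 : 0 < a := lt_le_trans b0 ba.
have eE : eccentricity a b ^+ 2 = 1 - b ^+ 2 / a ^+ 2.
  rewrite sqr_sqrtr// subr_ge0 ler_pdivrMr ?exprn_gt0// mul1r.
  by rewrite ler_pXn2r// nnegrE ltW.
have e0 : 0 <= eccentricity a b by exact: sqrtr_ge0.
have fE : Num.sqrt (a ^+ 2 - b ^+ 2) = a * eccentricity a b.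
  rewrite -[RHS]ger0_norm ?mulr_ge0 ?(ltW a0)// -sqrtr_sqr exprMn eE; congr Num.sqrt.
  by field; rewrite lt0r_neq0.
rewrite /focus_plus /focus_minus fE in foc.
move: h1 h2 eE e0 foc; set e := eccentricity a b => h1 h2 eE e0 foc.
have e2 : 0 < e ^+ 2.
  have [/h2[]//|q4] := leP q 4^-1.
  have [ql|qg|E] := ltgtP q 1; last by rewrite E eqxx in q1.
    by have [] := h1 (or_intror (conj q4 ql)).
  by have [] := h1 (or_introl qg).
have e21 : e ^+ 2 < 1 by rewrite eE gtrBl divr_gt0 ?exprn_gt0.
have e2q : e ^+ 2 < q by apply: eccentricity_lt_sqrt => // [/h1[]|/h2[]].
have e1 : e < 1 by rewrite -(@ltr_pXn2r _ 2) ?nnegrE// expr1n.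
have eg : e < Num.sqrt q.
  rewrite -(@ltr_pXn2r _ 2%N) ?nnegrE ?sqrtr_ge0// (sqr_sqrtr (ltW q0)); exact: e2q.
have e01 : 0 < e < 1.
  by rewrite e1 lt_neqAle e0 eq_sym !andbT; apply/eqP => E; rewrite E expr0n ltxx in e2.
have der (f : R -> R) : (forall t, derivable f t 1) -> forall x : R, is_derive x 1 f ('D_1 f x).
  by move=> df x; split.
have ctn (f : R -> R) : (forall t, derivable f t 1) -> continuous f.
  by move=> df x; exact: (is_derive_continuous (der f df x)).
(* The angle [om] points from the centre to the focus at the origin: [th] for the plus focus and
   [th + pi], with sign -1, for the minus focus. *)
case: foc => [] [c1 c2].
  have cE : c = (- (a * e * cos th), - (a * e * sin th)).
    by rewrite (surjective_pairing c); congr (_, _); apply/eqP; rewrite -addr_eq0; apply/eqP.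
  by apply: (@finite_non_scattering _ q a b th th 1 c phr phim q0 q1 b0 a0 e eE cE _ _ _
    (ctn _ dphr) (ctn _ dphim) pphr pphim _ _ e01 eg (der _ dphr) cphr' (der _ dphim) cphim' nz);
    rewrite ?expr1n ?mul1r.
have cE : c = (- (a * e * cos (th + pi)), - (a * e * sin (th + pi))).
  by rewrite (surjective_pairing c) cosDpi sinDpi !mulrN !opprK; congr (_, _);
    apply/eqP; rewrite -subr_eq0; apply/eqP.
by apply: (@finite_non_scattering _ q a b th (th + pi) (- 1) c phr phim q0 q1 b0 a0 e eE cE _ _ _
  (ctn _ dphr) (ctn _ dphim) pphr pphim _ _ e01 eg (der _ dphr) cphr' (der _ dphim) cphim' nz);
  rewrite ?sqrrN ?expr1n ?mulN1r ?cosDpi ?sinDpi.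
Qed.
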